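(* Let $\mathfrak g=\mathbb R e_1\ltimes L$ be an almost abelian Lie algebra of dimension $D=N+1$ with $\mathrm{ad}_{e_1}|_L=\mathcal J_N$ in real Jordan normal form with respect to the basis $e_2,\dots,e_D$ of $L$. Then the moduli space $\mathfrak P\Omega^2_{D,\mathrm{closed}}(\mathfrak g)$ of symplectic forms on $\mathfrak g$ is finite. Moreover, if $[\omega]\in\mathfrak P\Omega^2_{D,\mathrm{closed}}(\mathfrak g)$, then there exists a permutation matrix $P\in\mathrm{Per}(D,\mathbb R)_{e_1}$ such that $[\omega]=[P.\omega_0]$.
   Context: All Lie algebras are real. An almost abelian Lie algebra is a non-abelian Lie algebra containing a codimension 1 abelian subalgebra; it can be written $\mathfrak g=\mathbb R e_1\ltimes L$ with $L=\mathrm{Span}(e_2,\dots,e_D)$ an abelian ideal, with bracket determined by $[e_1,v]=\mathrm{ad}_{e_1}v$, $v\in L$. We identify $\mathfrak g\cong\mathbb R^D$ via the basis $e_1,\dots,e_D$, with dual basis $\varepsilon^1,\dots,\varepsilon^D$. Real Jordan normal form: $\mathcal J_N$ is a direct sum of real Jordan blocks $\mathcal J_n(\lambda)$ (upper Jordan blocks, $\lambda\in\mathbb R$) and blocks $\mathcal C_n(a,b)$, $b>0$ ($2n\times2n$, with $\begin{pmatrix}a&b\\-b&a\end{pmatrix}$ on the block diagonal and $I_2$ on the block superdiagonal), arranged as all real-eigenvalue blocks followed by all $\mathcal C$-blocks. The real blocks are ordered by first listing the zero-eigenvalue blocks, in non-increasing size, and then, for each distinct $\lambda_\mu>0$ occurring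 as the absolute value of an eigenvalue, the blocks with eigenvalue $\lambda_\mu$ in non-increasing size followed by those with eigenvalue $-\lambda_\mu$ in non-increasing size. The $\mathcal C$-blocks are ordered by first listing those with $a=0$, grouped by $b$ with non-increasing sizes, and then, for each distinct pair $(a_\mu,b_\mu)$ with $a_\mu,b_\mu>0$, the blocks $\mathcal C_n(a_\mu,b_\mu)$ followed by the blocks $\mathcal C_n(-a_\mu,b_\mu)$, each in non-increasing size. $\Omega^2_{D,\mathrm{closed}}(\mathfrak g)$ is the set of nondegenerate (rank $D$) skew-symmetric bilinear forms $\omega$ on $\mathfrak g$ satisfying $\omega(x,[y,z])+\omega(z,[x,y])+\omega(y,[z,x])=0$ for all $x,y,z$ (symplectic forms). $\mathrm{GL}(D,\mathbb R)$ acts on 2-forms by $g.\omega=\omega(g^{-1}\cdot,g^{-1}\cdot)$. Let $\mathbb R^\times\mathrm{Aut}(\mathfrak g)=\{c\phi: c\in\mathbb R\setminus\{0\},\ \phi\in\mathrm{Aut}(\mathfrak g)\}$, a subgroup of $\mathrm{GL}(D,\mathbb R)$. The moduli space $\mathfrak P\Omega^2_{D,\mathrm{closed}}(\mathfrak g)$ is the set of orbits of $\mathbb R^\times\mathrm{Aut}(\mathfrak g)$ on $\Omega^2_{D,\mathrm{closed}}(\mathfrak g)$, and $[\omega]$ denotes the $\mathbb R^\times\mathrm{Aut}(\mathfrak g)$-orbit of a 2-form $\omega$ of rank $D$. For $D=2d$ even, $\omega_0=\sum_{i=1}^{d}\varepsilon^i\wedge\varepsilon^{d+i}$ is the canonical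 2-form (for $D$ odd there are no forms of rank $D$). $\mathrm{Per}(D,\mathbb R)_{e_1}$ is the set of $D\times D$ permutation matrices of the form $\begin{pmatrix}1&0\\0&P'\end{pmatrix}$ with $P'$ a $(D-1)\times(D-1)$ permutation matrix. *)

(* Defs.v *)
From HB Require Import structures.
From mathcomp Require Import all_boot all_order all_algebra all_fingroup.
From mathcomp Require Import boolp classical_sets cardinality reals.

Set Implicit Arguments.
Unset Strict Implicit.
Unset Printing Implicit Defensive.

Import Order.TTheory GRing.Theory Num.Theory.

Local Open Scope classical_set_scope.
Local Open Scope ring_scope.

(* Indices are 0-based: the mathematical e_1, ..., e_D are the columns
   delta_mx i 0 with i : 'I_D, so e_1 is the one of index 0. *)

(** Lie algebras on R^D *)

Definition lie_algebra (R : realType) (D : nat)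
    (br : {bilinear 'cV[R]_D -> 'cV[R]_D -> 'cV[R]_D}) : Prop :=
  (forall x, br x x = 0) /\
  (forall x y z, br x (br y z) + br y (br z x) + br z (br x y) = 0).

(* A subspace on which the bracket vanishes is automatically a subalgebra. *)
Definition almost_abelian (R : realType) (D : nat)
    (br : {bilinear 'cV[R]_D -> 'cV[R]_D -> 'cV[R]_D}) : Prop :=
  [/\ lie_algebra br,
      exists x y, br x y <> 0 &
      exists U : {vspace 'cV[R]_D},
        (\dim U).+1 = D /\ (forall x y, x \in U -> y \in U -> br x y = 0)].

Definition e1 (R : realType) (N : nat) : 'cV[R]_N.+1 := delta_mx 0 0.

(* The inclusion of L = Span (e_2, ..., e_D), with its coordinates in that
   basis, into R^D. *)
Definition inL (R : realType) (N : nat) (v : 'cV[R]_N) : 'cV[R]_N.+1 :=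
  col_mx (0 : 'cV[R]_1) v.

(* g = R e_1 |x L with L an abelian ideal and J the matrix of ad_{e_1} on L. *)
Definition is_semidirect (R : realType) (N : nat)
    (br : {bilinear 'cV[R]_N.+1 -> 'cV[R]_N.+1 -> 'cV[R]_N.+1})
    (J : 'M[R]_N) : Prop :=
  (forall v w : 'cV[R]_N, br (inL v) (inL w) = 0) /\
  (forall v : 'cV[R]_N, br (e1 R N) (inL v) = inL (J *m v)).

(** Real Jordan normal form *)

Inductive jblock (R : realType) : Type :=
| RealBlock (n : nat) (lambda : R)
| ComplexBlock (n : nat) (a b : R).

Definition jblock_dim (R : realType) (B : jblock R) : nat :=
  match B with
  | RealBlock n _ => n
  | ComplexBlock n _ _ => n.*2
  end.

Definition real_jordan_block (R : realType) (n : nat) (lambda : R) : 'M[R]_n :=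
  \matrix_(i < n, j < n)
    if i == j then lambda else if j == i.+1 :> nat then 1 else 0.

(* 2x2 blocks (a, b; -b, a) on the block diagonal, where i./2 is the block of
   the index i and odd i its position in the block; the I_2 blocks on the block
   superdiagonal amount to the entries (i, i + 2). *)
Definition complex_jordan_block (R : realType) (n : nat) (a b : R) :
    'M[R]_(n.*2) :=
  \matrix_(i < n.*2, j < n.*2)
    if i./2 == j./2 then
      if i == j then a else if odd j then b else - b
    else if j == i.+2 :> nat then 1 else 0.

Definition jblock_mx (R : realType) (B : jblock R) : 'M[R]_(jblock_dim B) :=
  match B with
  | RealBlock n lambda => real_jordan_block n lambda
  | ComplexBlock n a b => complex_jordan_block n a b
  end.

Definition jblocks_dim (R : realType) (Bs : seq (jblock R)) : nat :=
  (\sum_(k < size Bs) jblock_dim (tnth (in_tuple Bs) k))%N.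

Definition jblocks_mx (R : realType) (Bs : seq (jblock R)) :
    'M[R]_(jblocks_dim Bs) :=
  \mxdiag_(k < size Bs) jblock_mx (tnth (in_tuple Bs) k).

Definition block_sizes (s : seq nat) : bool :=
  all (leq 1) s && sorted geq s.

(* A group (l, (s, t)) stands for the blocks of eigenvalue l with sizes s,
   followed by those of eigenvalue - l with sizes t. *)
Definition real_group (R : realType) (g : R * (seq nat * seq nat)) :
    seq (jblock R) :=
  [seq RealBlock n g.1 | n <- g.2.1] ++ [seq RealBlock n (- g.1) | n <- g.2.2].

Definition imag_group (R : realType) (g : R * seq nat) : seq (jblock R) :=
  [seq ComplexBlock n 0 g.1 | n <- g.2].

Definition complex_group (R : realType)
    (g : (R * R) * (seq nat * seq nat)) : seq (jblock R) :=
  [seq ComplexBlock n g.1.1 g.1.2 | n <- g.2.1] ++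
  [seq ComplexBlock n (- g.1.1) g.1.2 | n <- g.2.2].

(* The prescribed order of the blocks; the mutual order of the groups inside
   rs, ims and cs is left free. *)
Definition jordan_ordered (R : realType) (Bs : seq (jblock R)) : Prop :=
  exists (zs : seq nat) (rs : seq (R * (seq nat * seq nat)))
         (ims : seq (R * seq nat)) (cs : seq ((R * R) * (seq nat * seq nat))),
    [/\ block_sizes zs,
        uniq [seq g.1 | g <- rs] /\
          (forall g, g \in rs ->
             [/\ 0 < g.1, block_sizes g.2.1 & block_sizes g.2.2]),
        uniq [seq g.1 | g <- ims] /\
          (forall g, g \in ims -> 0 < g.1 /\ block_sizes g.2),
        uniq [seq g.1 | g <- cs] /\
          (forall g, g \in cs ->
             [/\ 0 < g.1.1, 0 < g.1.2, block_sizes g.2.1 & block_sizes g.2.2]) &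
        Bs = [seq RealBlock n 0 | n <- zs] ++ flatten (map (@real_group R) rs)
             ++ flatten (map (@imag_group R) ims)
             ++ flatten (map (@complex_group R) cs)].

Definition real_jordan_normal_form (R : realType) (N : nat) (J : 'M[R]_N) :
    Prop :=
  exists (Bs : seq (jblock R)) (eN : jblocks_dim Bs = N),
    jordan_ordered Bs /\ J = castmx (eN, eN) (jblocks_mx Bs).

(** 2-forms on R^D, represented by their Gram matrices w i j = w(e_i, e_j) *)

Definition form_val (R : realType) (D : nat) (w : 'M[R]_D) (x y : 'cV[R]_D) :
    R := (x^T *m w *m y) 0 0.

Definition closed_form (R : realType) (D : nat)
    (br : {bilinear 'cV[R]_D -> 'cV[R]_D -> 'cV[R]_D}) (w : 'M[R]_D) : Prop :=
  forall x y z,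
    form_val w x (br y z) + form_val w z (br x y) + form_val w y (br z x) = 0.

Definition symplectic_forms (R : realType) (D : nat)
    (br : {bilinear 'cV[R]_D -> 'cV[R]_D -> 'cV[R]_D}) : set 'M[R]_D :=
  [set w | [/\ w^T = - w, \rank w = D & closed_form br w]].

(* g.w = w(g^-1 _, g^-1 _). *)
Definition form_act (R : realType) (D : nat) (g w : 'M[R]_D) : 'M[R]_D :=
  (invmx g)^T *m w *m invmx g.

Definition lie_aut (R : realType) (D : nat)
    (br : {bilinear 'cV[R]_D -> 'cV[R]_D -> 'cV[R]_D}) : set 'M[R]_D :=
  [set phi | phi \in unitmx /\
     forall x y, phi *m br x y = br (phi *m x) (phi *m y)].

Definition scaled_aut (R : realType) (D : nat)
    (br : {bilinear 'cV[R]_D -> 'cV[R]_D -> 'cV[R]_D}) : set 'M[R]_D :=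
  [set g | exists (c : R) (phi : 'M[R]_D),
     [/\ c != 0, lie_aut br phi & g = c *: phi]].

Definition form_class (R : realType) (D : nat)
    (br : {bilinear 'cV[R]_D -> 'cV[R]_D -> 'cV[R]_D}) (w : 'M[R]_D) :
    set 'M[R]_D :=
  [set form_act g w | g in scaled_aut br].

Definition symplectic_moduli (R : realType) (D : nat)
    (br : {bilinear 'cV[R]_D -> 'cV[R]_D -> 'cV[R]_D}) : set (set 'M[R]_D) :=
  [set form_class br w | w in symplectic_forms br].

Definition wedge_basis (R : realType) (D : nat) (i j : 'I_D) : 'M[R]_D :=
  delta_mx i j - delta_mx j i.

(* With D = N.+1 = d.*2, d = N.+1./2; only meaningful when N.+1 is even. *)
Definition omega0 (R : realType) (N : nat) : 'M[R]_N.+1 :=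
  \sum_(i < N.+1./2) wedge_basis R (inord i) (inord (N.+1./2 + i)).

Definition Per_e1 (R : realType) (N : nat) : set 'M[R]_N.+1 :=
  [set P | exists s : 'S_N, P = lift0_mx (perm_mx s)].

(* Main.v *)
Require Import Defs.
From mathcomp Require Import all_boot all_order all_algebra all_fingroup.
From mathcomp Require Import boolp classical_sets cardinality reals.
From mathcomp Require Import zify ring lra.

(** Let w be a closed 2-form of rank D on R e_1 |x L.  Closedness says that the
    restriction b of w to L satisfies J^T b = - b J; the remaining datum is the
    row a of e_1, a linear form on L.  Nondegeneracy of w bounds the corank of b
    by 1.  If c <> 0 and g is invertible and commutes with J, then the matrix
    (c 0; v g) is a scalar multiple of an automorphism
    ([block_scaled_aut]), so b may be replaced by any g^T b g with g in the
    centraliser of J.  The heart of the proof ([jordan_block_matching]) is that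
    b can be made a partial signed matching: every row has at most one nonzero
    entry, equal to 1 or -1.  A suitable v then cancels every entry of a except
    the one at the single index that b leaves unmatched, c makes this entry 1
    ([symplectic_reduction]), and what remains is a skew signed permutation
    matrix, which is a permuted canonical form
    ([skew_monomial_permuted_omega0]).  Since there are finitely many
    permutations, the moduli space is finite.

    The matching is found block by block.  A Gram block of b between two Jordan
    blocks A_i and A_j is an intertwiner X, A_i^T X = - X A_j.  The centraliser
    of a Jordan block is a commutative local ring whose residue field is R or C
    ([uniserial]).  Traces of A and A^2 show that an invertible intertwiner
    exists only between a block and its dual, the block of opposite eigenvalue
    ([dual_block_eq]); there, an explicit signed permutation matrix is one.  Any
    other invertible skew intertwiner on a block, or on a pair of dual blocks,
    differs from it by a factor h (1 + T) with h real and T nilpotent and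
    self-adjoint, and 1 + T has a square root that is a polynomial in T; this
    brings the pivot to its normal form ([self_dual_normal_form],
    [hyperbolic_normal_form]).  The orthogonal projection along the pivot
    commutes with J and carries the other blocks isomorphically onto a Jordan
    basis of the complement, so that the types of the blocks never change.

    When no Gram block of the remaining part is invertible, b kills the socle
    of the largest remaining block.  As the corank is at most 1, this socle is
    the radical of b and the block is real, of some size h + 1 and eigenvalue l.
    A Krull-Schmidt argument modulo the radical shows that at most one other
    block remains, of size h and eigenvalue - l
    ([degenerate_partner_unique]).  The normal form modulo the radical is then
    obtained as before, and lifted. *)

Set Implicit Arguments.
Unset Strict Implicit.
Unset Printing Implicit Defensive.

Import Order.TTheory GRing.Theory Num.Theory.

(** * Nilpotent matrices *)

Section Nilpotent.
Local Open Scope ring_scope.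
Variable F : fieldType.

Definition nilpotent_mx n (X : 'M[F]_n) : Prop := exists k, X ^+ k = 0.

Lemma nilpotent_mxD n (X Y : 'M[F]_n) : X *m Y = Y *m X ->
  nilpotent_mx X -> nilpotent_mx Y -> nilpotent_mx (X + Y).
Proof.
move=> cXY [k Xk] [l Yl]; exists (k + l)%N.
rewrite exprDn_comm //; apply: big1 => i _.
have [il | li] := leqP i l.
  have -> : X ^+ (k + l - i) = 0.
    by rewrite -(subnKC (n:=k + l - i) (m:=k)) ?exprD ?Xk ?mul0r // leq_subRL; lia.
  by rewrite mul0r mul0rn.
have -> : Y ^+ i = 0 by rewrite -(subnKC (ltnW li)) exprD Yl mul0r.
by rewrite mulr0 mul0rn.
Qed.

Lemma nilpotent_mxM n (X Y : 'M[F]_n) : X *m Y = Y *m X ->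
  nilpotent_mx X -> nilpotent_mx (X *m Y).
Proof.
by move=> cXY [k Xk]; exists k; rewrite (exprMn_comm k (cXY : GRing.comm X Y)) Xk mul0r.
Qed.

Lemma nilpotent_mxN n (X : 'M[F]_n) : nilpotent_mx X -> nilpotent_mx (- X).
Proof. by move=> [k Xk]; exists k; rewrite exprNn Xk mulr0. Qed.

Lemma nilpotent_mxZ n a (X : 'M[F]_n) : nilpotent_mx X -> nilpotent_mx (a *: X).
Proof.
move=> nX; rewrite -mul_scalar_mx -scalar_mxC.
by apply: nilpotent_mxM => //; rewrite scalar_mxC.
Qed.

Lemma nilpotent_mx_tr n (X : 'M[F]_n) : nilpotent_mx X -> nilpotent_mx X^T.
Proof.
move=> [k Xk]; exists k.
suff -> : X^T ^+ k = (X ^+ k)^T by rewrite Xk trmx0.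
elim: k {Xk} => [|k IH]; first by rewrite !expr0 trmx1.
by rewrite exprS exprSr IH; exact: esym (trmx_mul _ _).
Qed.

Lemma unitmx_1Dnilpotent n (X : 'M[F]_n) : nilpotent_mx X -> 1%:M + X \in unitmx.
Proof.
move=> /nilpotent_mxN [k Xk].
have /mulmx1_unit[] // : (1%:M + X) *m (\sum_(i < k) (- X) ^+ i) = 1%:M.
have := subrX1 (- X) k; rewrite Xk sub0r => /(congr1 -%R).
by rewrite opprK -mulNr opprB opprK.
Qed.

Lemma nilpotent_mx_nonunit n (X : 'M[F]_n) : (0 < n)%N -> nilpotent_mx X ->
  X \notin unitmx.
Proof.
move=> n0 [k Xk]; apply/negP => uX.
have : X ^+ k \in unitmx.
  elim: k {Xk} => [|k IH]; first by rewrite expr0 unitmx1.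
  by rewrite exprS; rewrite unitmx_mul uX.
by case: n n0 X Xk uX => // n _ X -> _; rewrite unitmxE det0 unitr0.
Qed.

End Nilpotent.

(** * Endomorphisms with a local centraliser *)

Section Uniserial.
Local Open Scope ring_scope.
Variable F : fieldType.

(** The properties of a Jordan block on which the proof rests.  The
    centraliser of A is a commutative local ring, with nilpotent maximal ideal
    and with residue field spanned by 1 and A; and every nonzero A-invariant
    subspace contains the vector e.  Only kernels occur as invariant subspaces
    below, so the last property is stated for kernels of matrices X. *)
Record uniserial n (A : 'M[F]_n) : Prop := Uniserial {
  uniserial_gt0 : (0 < n)%N;
  uniserial_comm : forall X Y, X *m A = A *m X -> Y *m A = A *m Y ->
    X *m Y = Y *m X;
  uniserial_local : forall X, X *m A = A *m X -> X \in unitmx \/ nilpotent_mx X;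
  uniserial_residue : forall X, X *m A = A *m X ->
    exists a c T, X = a%:M + c *: A + T /\ nilpotent_mx T;
  uniserial_socle : exists2 e : 'cV[F]_n, e != 0 &
    forall m (X : 'M[F]_(m, n)), (forall x : 'cV_n, X *m x = 0 -> X *m (A *m x) = 0) ->
      (exists2 x : 'cV_n, x != 0 & X *m x = 0) -> X *m e = 0 }.

Section Primary.
Variables (n : nat) (A : 'M[F]_n.+1) (p : {poly F}) (r : nat) (w : 'cV[F]_n.+1).
Hypothesis p_irr : irreducible_poly p.
Hypothesis p_dim : ((size p).-1 * r.+1)%N = n.+1.
Hypothesis pA0 : horner_mx A (p ^+ r.+1) = 0.
Hypothesis pAw : horner_mx A (p ^+ r) *m w != 0.

Let size_p_gt1 : (1 < size p)%N. Proof. by case: p_irr. Qed.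
Let p_neq0 : p != 0. Proof. by rewrite -size_poly_gt0 ltnW. Qed.

Lemma horner_mx_coprime_unit f : ~~ (p %| f) ->
  exists g, horner_mx A g *m horner_mx A f = 1%:M.
Proof.
move=> npf.
have cop : coprimep f (p ^+ r.+1).
  by apply: coprimep_expr; rewrite coprimep_sym irreducible_poly_coprime.
have /Bezout_eq1_coprimepP [[u v] /= uv1] := cop.
exists u.
have : horner_mx A (u * f + v * p ^+ r.+1) = 1 by rewrite uv1 rmorph1.
by rewrite rmorphD !rmorphM /= pA0 mulr0 addr0.
Qed.

(** As long as f = p^k g with k <= r, a factor p must divide g: otherwise
    g(A) is invertible and p^k already annihilates w. *)
Lemma horner_mx_annihilator f : horner_mx A f *m w = 0 -> p ^+ r.+1 %| f.
Proof.
move=> fw0.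
suff H k : (k <= r.+1)%N -> p ^+ k %| f by exact: H.
elim: k => [|k IH] lek; first by rewrite expr0 dvd1p.
have /dvdpP [g fE] := IH (ltnW lek).
have [pg | npg] := boolP (p %| g).
  by rewrite fE exprS dvdp_mul2r ?expf_neq0.
have [u ug] := horner_mx_coprime_unit npg.
case/negP: pAw; apply/eqP.
have kw0 : horner_mx A (p ^+ k) *m w = 0.
  have : horner_mx A u *m (horner_mx A f *m w) = 0 by rewrite fw0 mulmx0.
  by rewrite fE rmorphM /= -mulmxE !mulmxA ug mul1mx.
by rewrite -(subnK (n:=r) (m:=k)) // exprD rmorphM /= -mulmxE -mulmxA kw0 mulmx0.
Qed.

Lemma size_pX : size (p ^+ r.+1) = n.+2.
Proof.
by rewrite -(prednK (n:=size (p ^+ r.+1))) ?size_exp ?p_dim // size_poly_gt0 expf_neq0.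
Qed.

(** The first n + 1 iterates of w are independent, since a relation
    between them would be a nonzero polynomial of degree less than that of
    p^(r+1) annihilating w. *)
Lemma horner_mx_cyclic (x : 'cV[F]_n.+1) : exists f, x = horner_mx A f *m w.
Proof.
pose K : 'M[F]_n.+1 := \matrix_(i < n.+1) (A ^+ i *m w)^T.
have KE (u : 'rV_n.+1) : u *m K = (horner_mx A (rVpoly u) *m w)^T.
  rewrite /rVpoly poly_def linear_sum /= mulmx_suml linear_sum /= mulmx_sum_row.
  apply: eq_bigr => i _; rewrite rowK valK linearZ /= rmorphXn /= horner_mx_X.
  by rewrite -scalemxAl linearZ.
have freeK : row_free K.
  rewrite -kermx_eq0; apply/rowV0P => u /sub_kermxP.
  rewrite KE => /(congr1 trmx); rewrite trmxK trmx0 => /horner_mx_annihilator.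
  have [u0 | un0] := eqVneq (rVpoly u) 0.
    by move=> _; rewrite -[u]rVpolyK u0 linear0.
  move=> /(dvdp_leq un0); rewrite size_pX => /leq_trans/(_ (size_poly _ _)).
  by rewrite ltnn.
have uK : K \in unitmx by rewrite -row_free_unit.
exists (rVpoly (x^T *m invmx K)).
by apply: trmx_inj; rewrite -KE mulmxKV.
Qed.

(** An element of the centraliser is determined by its value at the cyclic
    vector w. *)
Lemma comm_horner_mx_ex X : X *m A = A *m X -> exists f, X = horner_mx A f.
Proof.
move=> cXA; have [f fE] := horner_mx_cyclic (X *m w); exists f.
have cXh g : X *m horner_mx A g = horner_mx A g *m X by exact: comm_mx_horner.
have cfh g : horner_mx A f *m horner_mx A g = horner_mx A g *m horner_mx A f.
  exact: comm_horner_mx2.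
apply/matrixP => i j.
have /(congr1 (fun v : 'cV_n.+1 =>
  v i 0)) : X *m delta_mx j 0 = horner_mx A f *m delta_mx j (0 : 'I_1).
  have [g ->] := horner_mx_cyclic (delta_mx j 0).
  by rewrite !mulmxA cXh cfh -!mulmxA fE.
by rewrite -!colE !mxE.
Qed.

Lemma horner_mx_dvd_nilpotent f : p %| f -> nilpotent_mx (horner_mx A f).
Proof.
by move=> /(dvdp_exp2r r.+1)/dvdpP [g fE]; exists r.+1;
  rewrite -rmorphXn fE rmorphM /= pA0 mulr0.
Qed.

(** R[A] is the local ring R[x]/(p^(r+1)), and the degree bound on p
    makes every residue modulo p of the form a + c x.  The socle vector is
    p^r(A) w: a nonzero x in an invariant subspace has a multiple killed by p
    but nonzero, which is p^r(A) w up to an invertible polynomial in A. *)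
Lemma primary_uniserial : (size p <= 3)%N -> uniserial A.
Proof.
move=> p3; split=> //.
- move=> X Y /comm_horner_mx_ex [f ->] /comm_horner_mx_ex [g ->].
  exact: comm_horner_mx2.
- move=> X /comm_horner_mx_ex [f ->]; have [pf | npf] := boolP (p %| f).
    by right; exact: horner_mx_dvd_nilpotent.
  by left; have [g /mulmx1_unit[]] := horner_mx_coprime_unit npf.
- move=> X /comm_horner_mx_ex [f ->].
  exists (f %% p)`_0, (f %% p)`_1, (horner_mx A (f %/ p * p)); split; last first.
    by apply: horner_mx_dvd_nilpotent; rewrite dvdp_mull.
  rewrite {1}(divp_eq f p) rmorphD /= addrC; congr (_ + _).
  have sz : (size (f %% p)%R <= 2)%N.
    by rewrite -ltnS (leq_trans _ p3) // ltn_modp.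
  have -> : horner_mx A (f %% p) = horner_mx A (((f %% p)`_0)%:P + (f %% p)`_1 *: 'X).
    congr (horner_mx A _); apply/polyP => i; rewrite coefD coefC coefZ coefX.
    case: i => [|[|i]]; rewrite ?mulr0 ?mulr1 ?addr0 ?add0r //.
    by rewrite nth_default // (leq_trans sz).
  by rewrite rmorphD /= horner_mx_C horner_mxZ horner_mx_X.
exists (horner_mx A (p ^+ r) *m w) => // m X Xker [x x0 Xx].
have Xh (y : 'cV_n.+1) f : X *m y = 0 -> X *m (horner_mx A f *m y) = 0.
  move=> Xy; elim/poly_ind: f => [|f c IH]; first by rewrite rmorph0 mul0mx mulmx0.
  rewrite rmorphD rmorphM /= horner_mx_X horner_mx_C mulmxDl mulmxDr.
  rewrite mul_scalar_mx -scalemxAr Xy scaler0 addr0.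
  have -> : horner_mx A f * A = A *m horner_mx A f.
    by apply/esym; exact: (comm_mx_horner f (erefl (A *m A))).
  by rewrite -mulmxA; exact: Xker.
have exm : exists m, horner_mx A (p ^+ m.+1) *m x == 0.
  by exists r; rewrite pA0 mul0mx.
pose k := ex_minn exm.
have [y0 py0] : horner_mx A (p ^+ k) *m x != 0 /\ horner_mx A p *m (horner_mx A (p ^+ k) *m x)
  = 0.
  rewrite /k; case: ex_minnP => k' /eqP pk min; split; last first.
    by rewrite mulmxA mulmxE -rmorphM -exprS.
  case: k' pk min => [|k'] _ min; first by rewrite expr0 rmorph1 mul1mx.
  by apply/negP => /min; rewrite ltnn.
move: y0 py0 (Xh _ (p ^+ k) Xx); set y := _ *m x => y0 py0 Xy.
have [f fE] := horner_mx_cyclic y.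
have : horner_mx A (p * f) *m w = 0 by rewrite rmorphM /= -mulmxE -mulmxA -fE.
move=> /horner_mx_annihilator; rewrite exprS dvdp_mul2l // => /dvdpP [g gE].
have npg : ~~ (p %| g).
  apply: contra y0 => /dvdpP [h hE]; rewrite fE gE hE -mulrA -exprS.
  by rewrite rmorphM /= pA0 mulr0 mul0mx.
have [u ug] := horner_mx_coprime_unit npg.
have -> : horner_mx A (p ^+ r) *m w = horner_mx A u *m y.
  by rewrite fE gE rmorphM /= -mulmxE !mulmxA ug mul1mx.
exact: Xh.
Qed.

Lemma primary_eigenvalue (l : F) (x : 'cV[F]_n.+1) :
  A *m x = l *: x -> x != 0 -> root p l.
Proof.
move=> Ax x0; have fx f : horner_mx A f *m x = f.[l] *: x.
  elim/poly_ind: f => [|f c IH]; first by rewrite rmorph0 mul0mx horner0 scale0r.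
  rewrite rmorphD rmorphM /= horner_mx_X horner_mx_C mulmxDl -mulmxA Ax.
  by rewrite -scalemxAr IH mul_scalar_mx scalerA hornerMXaddC scalerDl mulrC.
have /eqP := fx (p ^+ r.+1).
by rewrite pA0 mul0mx eq_sym scaler_eq0 (negPf x0) orbF horner_exp expf_eq0.
Qed.

End Primary.
End Uniserial.

(** * Signed permutation matrices and shifts *)

Section SignedPermutation.
Local Open Scope ring_scope.
Variable R : realFieldType.

Definition monomial_rows m n (M : 'M[R]_(m, n)) : Prop :=
  forall i, (forall j, M i j \in [:: 0; 1; -1]) /\
    (forall j k, M i j != 0 -> M i k != 0 -> j = k).

Definition sperm_mx n (c : 'I_n -> R) (f : 'I_n -> 'I_n) : 'M[R]_n :=
  \matrix_(i, j) (c i *+ (j == f i)).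

Lemma mul_sperm_mx n c f m (M : 'M[R]_(n, m)) i j :
  (sperm_mx c f *m M) i j = c i * M (f i) j.
Proof.
rewrite !mxE (bigD1 (f i)) //= !mxE eqxx mulr1n big1 ?addr0 // => k /negPf kf.
by rewrite mxE kf mulr0n mul0r.
Qed.

Lemma tr_sperm_mx n c f : involutive f -> (@sperm_mx n c f)^T = sperm_mx (c \o f) f.
Proof.
move=> fK; apply/matrixP => i j; rewrite !mxE.
by rewrite -(inj_eq (can_inj fK)) fK eq_sym /=; case: eqP => [->|].
Qed.

Lemma mulmx_sperm n c f m (M : 'M[R]_(m, n)) i j : involutive f ->
  (M *m @sperm_mx n c f) i j = M i (f j) * c (f j).
Proof.
move=> fK; rewrite -[M *m _]trmxK trmx_mul tr_sperm_mx // mxE mul_sperm_mx mxE /=.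
by rewrite mulrC.
Qed.

Lemma sperm_mx_unit n c f : involutive f -> (forall i, c i * c i = 1) ->
  @sperm_mx n c f \in unitmx.
Proof.
move=> fK cc; have /mulmx1_unit[] // : sperm_mx c f *m (sperm_mx c f)^T = 1%:M.
apply/matrixP => i j; rewrite tr_sperm_mx // mul_sperm_mx !mxE /= fK.
by rewrite eq_sym mulrnAr cc.
Qed.

Lemma sperm_mx_monomial n c f : (forall i, c i \in [:: 1; -1]) ->
  monomial_rows (@sperm_mx n c f).
Proof.
move=> c1 i; split=> [j | j k]; rewrite !mxE.
  by case: (j =P f i) => _; rewrite inE ?mulr0n ?eqxx // mulr1n c1 orbT.
by case: (j =P f i) => [->|_]; case: (k =P f i) => [->|_]; rewrite ?mulr0n ?eqxx.
Qed.

Definition shift_mx n s : 'M[R]_n := \matrix_(i, j) ((j == i + s :> nat)%N%:R).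

Lemma shift_mx0 n : shift_mx n 0 = 1%:M.
Proof. by apply/matrixP => i j; rewrite !mxE addn0 eq_sym. Qed.

Lemma shift_mxD n s t : shift_mx n s *m shift_mx n t = shift_mx n (s + t).
Proof.
apply/matrixP => i j; rewrite !mxE.
have [lt | ge] := ltnP (i + s) n.
  rewrite (bigD1 (Ordinal lt)) //= !mxE /= eqxx mul1r big1 ?addr0 ?addnA // => k kn.
  rewrite mxE; case: eqP => [e|]; last by rewrite mul0r.
  by case/eqP: kn; apply: val_inj.
rewrite big1 => [|k _]; last first.
  by rewrite mxE; case: eqP => [e|]; [have := ltn_ord k; lia | rewrite mul0r].
by case: eqP => // e; have := ltn_ord j; lia.
Qed.

Lemma shift_mxX n s k : shift_mx n s ^+ k = shift_mx n (s * k).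
Proof.
elim: k => [|k IH]; first by rewrite expr0 muln0 shift_mx0.
by rewrite exprS IH -mulmxE shift_mxD mulnS.
Qed.

Lemma shift_mx_ge n s : (n <= s)%N -> shift_mx n s = 0.
Proof.
move=> le; apply/matrixP => i j; rewrite !mxE; case: eqP => // e.
by have := ltn_ord j; lia.
Qed.

Lemma shift_mx_nilpotent n s : (0 < s)%N -> nilpotent_mx (shift_mx n s).
Proof.
by move=> s0; exists n; rewrite shift_mxX shift_mx_ge // leq_pmull.
Qed.

Lemma mxtrace_shift n s : (0 < s)%N -> \tr (shift_mx n s) = 0.
Proof. by move=> s0; apply: big1 => i _; rewrite mxE; case: eqP => //; lia. Qed.

End SignedPermutation.

(** * Real Jordan blocks *)

Section JordanBlocks.
Local Open Scope ring_scope.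
Variable R : realType.

Definition jblock_valid (B : jblock R) : Prop :=
  match B with
  | RealBlock n _ => (0 < n)%N
  | ComplexBlock n _ b => (0 < n)%N /\ 0 < b
  end.

Definition jblock_dual (B : jblock R) : jblock R :=
  match B with
  | RealBlock n l => RealBlock n (- l)
  | ComplexBlock n a b => ComplexBlock n (- a) b
  end.

Lemma real_jordan_blockE n (l : R) :
  real_jordan_block n l = l%:M + shift_mx R n 1.
Proof.
apply/matrixP => i j; rewrite !mxE addn1 -val_eqE /=.
case: eqP => [e|_]; last by rewrite add0r; case: eqP.
by case: eqP => [|_]; [lia | rewrite addr0].
Qed.

Lemma flip_subproof n (i : 'I_n.*2) : ((if odd i then i.-1 else i.+1) < n.*2)%N.
Proof. by have := ltn_ord i; case: ifP; lia. Qed.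
(** The other index of the 2 x 2 block containing i. *)
Definition flip n (i : 'I_n.*2) : 'I_n.*2 := Ordinal (flip_subproof i).

Lemma flipK n : involutive (@flip n).
Proof. by move=> i; apply: val_inj => /=; case: (boolP (odd i)) => /= o; case: ifP; lia. Qed.

(** The complex structure: block diagonal with blocks (0 1; -1 0). *)
Definition rot_mx n : 'M[R]_(n.*2) := sperm_mx (fun i => (-1) ^+ i) (@flip n).

Lemma complex_jordan_blockE n (a b : R) :
  complex_jordan_block n a b = a%:M + b *: rot_mx n + shift_mx R n.*2 2.
Proof.
apply/matrixP => i j; rewrite !mxE addn2 -!val_eqE /= -(signr_odd _ i).
have [e2|ne2] := eqVneq i./2 j./2.
  have [e|ne] := eqVneq (i : nat) j.
    have -> : (j == (if odd i then i.-1 else i.+1) :> nat) = false by case: ifP => o; lia.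
    have -> : (j == i.+2 :> nat) = false by lia.
    by rewrite mulr0n mulr0 !addr0.
  have -> : (j == i.+2 :> nat) = false by lia.
  rewrite addr0 add0r; case: (boolP (odd i)) => o.
    have -> : odd j = false by lia.
    have -> : (j == i.-1 :> nat) by lia.
    by rewrite expr1 mulr1n mulrN1.
  have -> : odd j by lia.
  have -> : (j == i.+1 :> nat) by lia.
  by rewrite expr0 mulr1n mulr1.
have -> : (i == j :> nat) = false by apply/eqP => e; case/eqP: ne2; rewrite e.
have -> : (j == (if odd i then i.-1 else i.+1) :> nat) = false by case: ifP => o; lia.
by rewrite mulr0n mulr0 !add0r; case: eqP.
Qed.

Lemma rot_mx_sqr n : rot_mx n *m rot_mx n = - 1%:M.
Proof.
apply/matrixP => i j; rewrite mul_sperm_mx !mxE flipK eq_sym.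
case: eqP => _; rewrite ?mulr0n ?mulr0 ?oppr0 // mulr1n /=.
rewrite -exprD -signr_odd oddD; case: (boolP (odd i)) => o.
  by have -> : odd i.-1 = false by lia.
by rewrite oddS o expr1.
Qed.

Lemma signr_parity i j : odd i = odd j -> (-1) ^+ i = (-1) ^+ j :> R.
Proof. by move=> e; rewrite -signr_odd e signr_odd. Qed.

Lemma rot_shift_mx n : rot_mx n *m shift_mx R n.*2 2 = shift_mx R n.*2 2 *m rot_mx n.
Proof.
apply/matrixP => i j; rewrite mul_sperm_mx mulmx_sperm; last exact: flipK.
rewrite !mxE /= !addn2 mulrC.
case: (boolP (odd i)) => oi; case: (boolP (odd j)) => oj.
- have -> : (j == i.-1.+2 :> nat) = false by lia.
  have -> : (j.-1 == i.+2 :> nat) = false by lia.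
  by rewrite !mul0r.
- have -> : (j == i.-1.+2 :> nat) = (j.+1 == i.+2 :> nat) by lia.
  by have -> : (-1) ^+ i = (-1) ^+ j.+1 :> R by apply: signr_parity; lia.
- have -> : (j == i.+3 :> nat) = (j.-1 == i.+2 :> nat) by lia.
  by have -> : (-1) ^+ i = (-1) ^+ j.-1 :> R by apply: signr_parity; lia.
- have -> : (j == i.+3 :> nat) = false by lia.
  have -> : (j.+1 == i.+2 :> nat) = false by lia.
  by rewrite !mul0r.
Qed.

Lemma real_jordan_block_uniserial n (l : R) : uniserial (real_jordan_block n.+1 l).
Proof.
set A := real_jordan_block _ _; pose p : {poly R} := 'X - l%:P.
have pA : horner_mx A p = shift_mx R n.+1 1.
  by rewrite rmorphB /= horner_mx_X horner_mx_C /A real_jordan_blockE [l%:M + _]addrC addrK.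
apply: (@primary_uniserial _ n A p n (delta_mx ord_max 0)).
- exact: irredp_XsubC.
- by rewrite size_XsubC mul1n.
- by rewrite rmorphXn /= pA shift_mxX shift_mx_ge // mul1n.
- rewrite rmorphXn /= pA shift_mxX mul1n; apply/eqP => /matrixP/(_ 0 0).
  by rewrite -colE !mxE add0n eqxx; apply/eqP; rewrite oner_neq0.
- by rewrite size_XsubC.
Qed.

(** With A = a + b J + N, the polynomial p = (x - a)^2 + b^2 takes the value
    N (N + 2 b J) at A.  The second factor is invertible, so p(A) behaves like
    the nilpotent N; and p is irreducible because it has no real root, which
    also excludes real eigenvectors. *)
Lemma complex_jordan_block_uniserial n (a b : R) : 0 < b ->
  uniserial (complex_jordan_block n.+1 a b) /\
  (forall l (x : 'cV_(n.+1.*2)), complex_jordan_block n.+1 a b *m x = l *: x -> x = 0).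
Proof.
move=> b0; set A := complex_jordan_block _ _ _.
pose p : {poly R} := ('X - a%:P) ^+ 2 + (b ^+ 2)%:P.
have sp : size p = 3%N.
  rewrite size_polyDl size_exp_XsubC // size_polyC expf_neq0 //.
  by rewrite gt_eqF.
have rp x : ~~ root p x.
  rewrite rootE /p hornerD horner_exp hornerXsubC hornerC gt_eqF //.
  by rewrite ltr_wpDl ?sqr_ge0 // exprn_gt0.
pose J : 'M[R]_((n.*2).+2) := rot_mx n.+1; pose N : 'M[R]_((n.*2).+2) := shift_mx R n.+1.*2 2.
have JJ : J *m J = - 1%:M := rot_mx_sqr n.+1.
have JN : J *m N = N *m J := rot_shift_mx n.+1.
move: JJ JN; rewrite !mulmxE => JJ JN.
have AE : (A : 'M[R]_((n.*2).+2)) = a%:M + (b *: J + N).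
  rewrite addrA; exact (complex_jordan_blockE n.+1 a b).
have bb : b *: J * (b *: J) = - (b ^+ 2)%:M.
  by rewrite -scalerAl -scalerAr JJ !scalerN scalerA scale_scalar_mx mulr1.
have pA : @horner_mx _ (n.*2).+1 A p = N * (N + (2 * b) *: J).
  rewrite rmorphD rmorphXn rmorphB /= horner_mx_X !horner_mx_C AE.
  rewrite [a%:M + _]addrC addrK expr2 mulrDl !mulrDr bb.
  rewrite -!scalerAl -!scalerAr JN mulrDl mul1r scalerDl.
  set x := b *: _; set y := N * N; set z := _%:M.
  by rewrite addrC -!addrA addrA subrr add0r addrA addrC.
have Nn k : N ^+ k = shift_mx R n.+1.*2 (2 * k) by exact: shift_mxX.
have cNM : GRing.comm N (N + (2 * b) *: J).
  by rewrite /GRing.comm; set c := 2 * b; rewrite mulrDr mulrDl -scalerAr -scalerAl JN.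
have uM : N + (2 * b) *: J \in unitmx.
  have b2 : 2 * b != 0 by rewrite mulf_neq0 ?gt_eqF.
  have -> : N + (2 * b) *: J = (1 - (2 * b)^-1 *: (N * J)) * ((2 * b) *: J).
    move: b2; set c := 2 * b => c0.
    rewrite mulrBl mul1r -scalerAl -scalerAr -mulrA JJ mulrN mulr1 !scalerN opprK.
    by rewrite scalerA mulVf // scale1r addrC.
  rewrite unitmx_mul; apply/andP; split.
    apply: unitmx_1Dnilpotent; apply: nilpotent_mxN; apply: nilpotent_mxZ.
    apply: nilpotent_mxM; first by rewrite mulmxE JN.
    exact: shift_mx_nilpotent.
  rewrite unitmxZ ?unitfE //; have /mulmx1_unit[] // : J *m (- J) = 1%:M.
  by rewrite mulmxN mulmxE JJ opprK.
have p_irr : irreducible_poly p by apply: cubic_irreducible rp; rewrite sp.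
have p_dim : ((size p).-1 * n.+1)%N = (n.*2).+2 by rewrite sp /=; lia.
have pA0 : @horner_mx _ (n.*2).+1 A (p ^+ n.+1) = 0.
  by rewrite rmorphXn /= pA exprMn_comm // Nn shift_mx_ge ?mul0r //; lia.
split; last first.
  move=> l x /(primary_eigenvalue pA0) Ax; apply/eqP; apply/negPn/negP => /Ax.
  by rewrite (negPf (rp l)).
apply: (@primary_uniserial _ (n.*2).+1 A p n (delta_mx ord_max 0)) => //; last by rewrite sp.
rewrite rmorphXn /= pA cNM exprMn_comm; last exact: commr_sym.
have uMn : (N + (2 * b) *: J) ^+ n \in unitmx by exact: unitrX.
apply/eqP => /(congr1 (mulmx (invmx ((N + (2 * b) *: J) ^+ n)))).
rewrite mulmx0 -mulmxE -mulmxA mulKmx // Nn -colE.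
move=> /matrixP/(_ (@Ordinal (n.*2).+2 1 isT) 0).
rewrite !mxE /=; case: eqP => [_ /eqP|]; first by rewrite oner_eq0.
by case; lia.
Qed.

Lemma jblock_uniserial (B : jblock R) : jblock_valid B -> uniserial (jblock_mx B).
Proof.
case: B => [[|n] l|[|n] a b] //=; first by move=> _; exact: real_jordan_block_uniserial.
  by case.
by case=> _ /(complex_jordan_block_uniserial n a) [].
Qed.

End JordanBlocks.

(** * Invertible intertwiners *)

Section Isomorphism.
Local Open Scope ring_scope.
Variable F : fieldType.

(** Invertibility for matrices whose two dimensions are only propositionally
    equal, as happens for intertwiners between blocks. *)
Definition mxiso m n (X : 'M[F]_(m, n)) : Prop :=
  exists Y, Y *m X = 1%:M /\ X *m Y = 1%:M.

Lemma mxiso_dim m n (X : 'M[F]_(m, n)) : mxiso X -> m = n.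
Proof.
move=> [Y [YX XY]]; apply/eqP; rewrite eqn_leq.
have := mxrankM_maxl X Y; have := mxrankM_maxl Y X.
rewrite YX XY !mxrank1 => nY mX.
by rewrite (leq_trans mX (rank_leq_col X)) (leq_trans nY (rank_leq_col Y)).
Qed.

Lemma mxiso_unit n (X : 'M[F]_n) : mxiso X <-> X \in unitmx.
Proof.
split=> [[Y [YX _]] | uX]; first by have [] := mulmx1_unit YX.
by exists (invmx X); rewrite mulVmx ?mulmxV.
Qed.

Lemma mxiso_tr m n (X : 'M[F]_(m, n)) : mxiso X -> mxiso X^T.
Proof.
by move=> [Y [YX XY]]; exists Y^T; rewrite -!trmx_mul YX XY !trmx1.
Qed.

Lemma mxisoN m n (X : 'M[F]_(m, n)) : mxiso X -> mxiso (- X).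
Proof.
by move=> [Y [YX XY]]; exists (- Y); rewrite !mulNmx !mulmxN !opprK.
Qed.

Lemma mxisoM m n p (X : 'M[F]_(m, n)) (Y : 'M[F]_(n, p)) :
  mxiso X -> mxiso Y -> mxiso (X *m Y).
Proof.
move=> [X' [X'X XX']] [Y' [Y'Y YY']]; exists (Y' *m X').
rewrite -!mulmxA (mulmxA X') X'X mul1mx Y'Y; split=> //.
by rewrite (mulmxA Y) YY' mul1mx.
Qed.

(** An invertible intertwiner conjugates B to - A^T. *)
Lemma mxtrace_dual m n (A : 'M[F]_m) (B : 'M[F]_n) (X : 'M[F]_(m, n)) :
  mxiso X -> A^T *m X = - (X *m B) ->
  \tr B = - \tr A /\ \tr (B *m B) = \tr (A *m A).
Proof.
move=> [Y [YX XY]] AX.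
have BE : B = - (Y *m A^T *m X) by rewrite -mulmxA AX mulmxN opprK mulmxA YX mul1mx.
split.
  by rewrite BE linearN /= mxtrace_mulC mulmxA XY mul1mx mxtrace_tr.
rewrite BE mulNmx mulmxN opprK !mulmxA -(mulmxA _ X Y) XY mulmx1.
by rewrite mxtrace_mulC !mulmxA XY mul1mx -trmx_mul mxtrace_tr.
Qed.

Lemma skew_unitmx_even n (X : 'M[F]_n) : 2%:R != 0 :> F ->
  X^T = - X -> X \in unitmx -> ~~ odd n.
Proof.
move=> F2 skX; rewrite unitmxE unitfE; apply: contra => on.
have : \det X = - \det X.
  by rewrite -{1}det_tr skX -scaleN1r detZ -signr_odd on expr1 mulN1r.
by move/eqP; rewrite -subr_eq0 opprK -mulr2n -mulr_natl mulf_eq0 (negPf F2).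
Qed.

Lemma unitmx_row_neq0 n (M : 'M[F]_n) i : M \in unitmx -> exists j, M i j != 0.
Proof.
move=> uM; apply/existsP; apply: contraTT uM => /existsPn Mi0.
rewrite -row_free_unit -kermx_eq0; apply/rowV0Pn; exists (delta_mx 0 i).
  apply/sub_kermxP; rewrite -rowE; apply/rowP => j; rewrite !mxE.
  by apply/eqP; have := Mi0 j; rewrite negbK.
by apply/eqP => /matrixP/(_ 0 i)/eqP; rewrite !mxE !eqxx oner_eq0.
Qed.

End Isomorphism.

(** * Dual Jordan blocks and their pairings *)

Section Duality.
Local Open Scope ring_scope.
Variable R : realType.

Lemma mxtrace_real_block n (l : R) :
  \tr (real_jordan_block n l) = l *+ n /\
  \tr (real_jordan_block n l *m real_jordan_block n l) = l ^+ 2 *+ n.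
Proof.
rewrite !real_jordan_blockE; split.
  by rewrite mxtraceD mxtrace_shift // mxtrace_scalar addr0.
rewrite mulmxDl !mulmxDr !mul_scalar_mx mul_mx_scalar shift_mxD !mxtraceD !mxtraceZ.
by rewrite !mxtrace_shift // mxtrace_scalar !mulr0 !addr0 mulrnAr expr2.
Qed.

Lemma mxtrace_rot n : \tr (rot_mx R n) = 0.
Proof.
apply: big1 => i _; rewrite mxE -val_eqE /=.
by have -> : (i == (if odd i then i.-1 else i.+1) :> nat) = false by case: ifP; lia.
Qed.

Lemma mxtrace_rot_shift n : \tr (rot_mx R n *m shift_mx R n.*2 2) = 0.
Proof.
apply: big1 => i _; rewrite mul_sperm_mx mxE /=.
have -> : (i == (if odd i then i.-1 else i.+1) + 2 :> nat)%N = false by case: ifP; lia.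
by rewrite mulr0.
Qed.

Lemma mxtrace_complex_block n (a b : R) :
  \tr (complex_jordan_block n a b) = a *+ n.*2 /\
  \tr (complex_jordan_block n a b *m complex_jordan_block n a b) =
    (a ^+ 2 - b ^+ 2) *+ n.*2.
Proof.
rewrite !complex_jordan_blockE; split.
  by rewrite !mxtraceD mxtraceZ mxtrace_shift // mxtrace_rot mxtrace_scalar mulr0 !addr0.
rewrite !(mulmxDl, mulmxDr) !mul_scalar_mx !mul_mx_scalar -!scalemxAl -!scalemxAr.
rewrite rot_mx_sqr shift_mxD -rot_shift_mx !mxtraceD !mxtraceZ !mxtrace_shift //.
rewrite mxtrace_rot mxtrace_rot_shift linearN /= !mxtrace_scalar !mulr0 !addr0 !add0r.
by rewrite !mulrN !mulrnAr mulr1 -!expr2 mulrnBl.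
Qed.

(** The trace recovers the real part of the eigenvalue, and the trace of the
    square then recovers the imaginary part; it also separates real blocks from
    complex ones of the same dimension. *)
Lemma dual_block_eq (B C : jblock R) (X : 'M[R]_(jblock_dim B, jblock_dim C)) :
  jblock_valid B -> jblock_valid C -> mxiso X ->
  (jblock_mx B)^T *m X = - (X *m jblock_mx C) -> C = jblock_dual B.
Proof.
move=> vB vC iX AX; have dE := mxiso_dim iX; have [t1 t2] := mxtrace_dual iX AX.
have Fsub (x y : R) : 0 < y -> x - y = x -> False by lra.
have Finj (x y z : R) : x - y = x - z -> z = y by lra.
case: B C vB vC X iX AX dE t1 t2 => [n l|n a b] [m l'|m a' b'] /= vB vC X _ _ dE.
- case: (mxtrace_real_block n l) (mxtrace_real_block m l') => -> _ [-> _].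
  by move: vB; rewrite dE -mulNrn => vB /(pmulrnI vB) -> _.
- case: (mxtrace_real_block n l) (mxtrace_complex_block m a' b') => -> -> [-> ->].
  case: vC => m0 b0; move: vB; rewrite dE => vB.
  rewrite -mulNrn => /(pmulrnI vB) -> /(pmulrnI vB).
  rewrite sqrrN => e.
  by case: (Fsub (l ^+ 2) (b' ^+ 2)) => //; rewrite exprn_gt0.
- case: (mxtrace_complex_block n a b) (mxtrace_real_block m l') => -> -> [-> ->].
  case: vB => m0 b0; move: vC; rewrite -dE => vC.
  rewrite -mulNrn => /(pmulrnI vC) -> /(pmulrnI vC).
  rewrite sqrrN => e.
  by case: (Fsub (a ^+ 2) (b ^+ 2)) => //; rewrite exprn_gt0.
- have {X}e : n = m by apply: double_inj.
  case: (mxtrace_complex_block n a b) (mxtrace_complex_block m a' b') => -> -> [-> ->].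
  case: vB vC => n0 b0 [m0 b'0]; rewrite -{}e.
  have n2 : (0 < n.*2)%N by rewrite double_gt0.
  rewrite -mulNrn => /(pmulrnI n2) -> /(pmulrnI n2).
  rewrite sqrrN => e.
  have /eqP : b ^+ 2 = b' ^+ 2 := Finj _ _ _ e.
  by rewrite eqrXn2 ?ltW // => /eqP ->.
Qed.

Lemma oppr_sign k : - (-1) ^+ k = (-1) ^+ k.+1 :> R.
Proof. by rewrite exprS mulN1r. Qed.

Definition real_pairing n : 'M[R]_n := sperm_mx (fun i => (-1) ^+ i) (@rev_ord n).

Lemma real_pairing_dual n (l : R) :
  (real_jordan_block n l)^T *m real_pairing n =
  - (real_pairing n *m real_jordan_block n (- l)).
Proof.
rewrite !real_jordan_blockE linearD /= tr_scalar_mx mulmxDl mulmxDr.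
rewrite mul_scalar_mx mul_mx_scalar scaleNr opprD opprK; congr (_ + _).
apply/matrixP => i j; rewrite mulmx_sperm; last exact: rev_ordK.
rewrite [RHS]mxE mul_sperm_mx !mxE /= mulrC -mulNr.
have -> : (j == n - i.+1 + 1 :> nat)%N = (i == n - j.+1 + 1 :> nat)%N.
  by have := ltn_ord i; have := ltn_ord j; lia.
case: eqP => e; rewrite ?mulr0 // !mulr1 oppr_sign.
by apply: signr_parity; have := ltn_ord i; have := ltn_ord j; lia.
Qed.

(** The antidiagonal of identity 2 x 2 blocks with alternating signs. *)
Definition complex_pairing n : 'M[R]_(n.*2) :=
  sperm_mx (fun i => (-1) ^+ i./2) (fun i => rev_ord (flip i)).

Lemma rev_flipK n : involutive (fun i : 'I_(n.*2) => rev_ord (flip i)).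
Proof.
move=> i; apply: val_inj => /=; have := ltn_ord i.
by case: (boolP (odd i)) => o; case: ifP; lia.
Qed.

Lemma rot_complex_pairing n :
  rot_mx R n *m complex_pairing n = complex_pairing n *m rot_mx R n.
Proof.
apply/matrixP => i j; rewrite !mul_sperm_mx !mxE flipK.
have -> : flip (rev_ord (flip i)) = rev_ord i.
  apply: val_inj => /=; have := ltn_ord i.
  by case: (boolP (odd i)) => o; case: ifP; lia.
have -> : (flip i)./2 = i./2 by rewrite /=; case: ifP; lia.
rewrite mulrC !mulrnAl mulrnAr; congr (_ * _ *+ _).
by apply: signr_parity; rewrite /=; have := ltn_ord i; case: ifP; lia.
Qed.

Lemma complex_pairing_dual n (a b : R) :
  (complex_jordan_block n a b)^T *m complex_pairing n =
  - (complex_pairing n *m complex_jordan_block n (- a) b).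
Proof.
have rT : (rot_mx R n)^T = - rot_mx R n.
  rewrite tr_sperm_mx; last exact: flipK.
  apply/matrixP => i j; rewrite !mxE -mulNrn /= oppr_sign; congr (_ *+ _).
  by apply: signr_parity; case: ifP => o; lia.
have trD (M N : 'M[R]_(n.*2)) : (M + N)^T = M^T + N^T by exact: linearD.
rewrite !complex_jordan_blockE !trD tr_scalar_mx [(b *: _)^T]linearZ /= rT.
rewrite mulmxDl mulmxDl !mulmxDr mul_scalar_mx mul_mx_scalar scaleNr !opprD opprK.
congr (_ + _ + _).
  by rewrite scalerN mulNmx -scalemxAl -scalemxAr rot_complex_pairing.
apply/matrixP => i j; rewrite mulmx_sperm; last exact: rev_flipK.
rewrite [RHS]mxE mul_sperm_mx !mxE mulrC -mulNr.
have -> : (j == rev_ord (flip i) + 2 :> nat)%N = (i == rev_ord (flip j) + 2 :> nat)%N.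
  by rewrite /=; have := ltn_ord i; have := ltn_ord j; do 2!case: ifP; lia.
case: eqP => e; rewrite ?mulr0 // !mulr1 oppr_sign.
by apply: signr_parity; move: e; rewrite /=; have := ltn_ord i; have := ltn_ord j; case: ifP;
  lia.
Qed.

Lemma sign_mem k : (-1) ^+ k \in [:: 1; -1 : R].
Proof. by rewrite -signr_odd; case: odd; rewrite !inE eqxx ?orbT. Qed.

Lemma sqr_sign k : (-1) ^+ k * (-1) ^+ k = 1 :> R.
Proof. by rewrite -exprD addnn -signr_odd odd_double. Qed.

Lemma real_pairing_props n :
  [/\ real_pairing n \in unitmx, monomial_rows (real_pairing n),
      monomial_rows (real_pairing n)^T &
      (real_pairing n)^T = (-1) ^+ n.+1 *: real_pairing n].
Proof.
have rK : involutive (@rev_ord n) by exact: rev_ordK.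
split.
- by apply: sperm_mx_unit => // i; exact: sqr_sign.
- by apply: sperm_mx_monomial => i; exact: sign_mem.
- by rewrite tr_sperm_mx //; apply: sperm_mx_monomial => i; exact: sign_mem.
rewrite tr_sperm_mx //; apply/matrixP => i j; rewrite !mxE mulrnAr /= -exprD.
by congr (_ *+ _); apply: signr_parity; have := ltn_ord i; lia.
Qed.

Lemma complex_pairing_props n :
  [/\ complex_pairing n \in unitmx, monomial_rows (complex_pairing n),
      monomial_rows (complex_pairing n)^T &
      (complex_pairing n)^T = (-1) ^+ n.+1 *: complex_pairing n].
Proof.
have rK := @rev_flipK n.
split.
- by apply: sperm_mx_unit => // i; exact: sqr_sign.
- by apply: sperm_mx_monomial => i; exact: sign_mem.
- by rewrite tr_sperm_mx //; apply: sperm_mx_monomial => i; exact: sign_mem.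
rewrite tr_sperm_mx //; apply/matrixP => i j; rewrite !mxE mulrnAr /= -exprD.
by congr (_ *+ _); apply: signr_parity; have := ltn_ord i; case: ifP => o; lia.
Qed.

Lemma dual_pairing (B : jblock R) :
  exists X : 'M[R]_(jblock_dim B, jblock_dim (jblock_dual B)),
    [/\ mxiso X, monomial_rows X, monomial_rows X^T &
        (jblock_mx B)^T *m X = - (X *m jblock_mx (jblock_dual B))].
Proof.
case: B => [n l|n a b] /=.
  have [uX mX mXt _] := real_pairing_props n.
  by exists (real_pairing n); split=> //; [exact/mxiso_unit | exact: real_pairing_dual].
have [uX mX mXt _] := complex_pairing_props n.
by exists (complex_pairing n); split=> //; [exact/mxiso_unit | exact: complex_pairing_dual].
Qed.

(** The pairing of a block with its dual is symmetric or skew according to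
    its size.  For a real block of odd size no skew invertible intertwiner
    exists by parity of the dimension; for a complex block of odd size, composing
    with the complex structure turns the symmetric pairing into a skew one. *)
Lemma self_pairing (B : jblock R) (X : 'M[R]_(jblock_dim B)) :
  jblock_valid B -> X^T = - X -> X \in unitmx ->
  (jblock_mx B)^T *m X = - (X *m jblock_mx B) ->
  exists Y : 'M[R]_(jblock_dim B),
    [/\ Y^T = - Y, Y \in unitmx, monomial_rows Y &
        (jblock_mx B)^T *m Y = - (Y *m jblock_mx B)].
Proof.
move=> vB skX uX AX.
have := dual_block_eq vB vB (proj2 (mxiso_unit X) uX) AX.
have F2 : 2%:R != 0 :> R by rewrite pnatr_eq0.
have := skew_unitmx_even F2 skX uX.
case: B X vB skX uX AX => [n l|n a b] /= X vB skX uX AX en.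
  case=> lN; have l0 : l = 0 by lra.
  have [uY mY _ tY] := real_pairing_props n; exists (real_pairing n); split=> //.
    by rewrite tY -signr_odd /= en expr1 scaleN1r.
  by have := real_pairing_dual n l; rewrite l0 oppr0.
case=> aN; have a0 : a = 0 by lra.
have := complex_pairing_dual n a b; rewrite a0 oppr0 => dY.
have [uY mY _ tY] := complex_pairing_props n.
have [on | on] := boolP (odd n); last first.
  exists (complex_pairing n); split=> //.
  by rewrite tY -signr_odd /= on expr1 scaleN1r.
have JE : complex_pairing n *m rot_mx R n =
    sperm_mx (fun i => (-1) ^+ (i./2 + i)) (@rev_ord n.*2).
  rewrite -rot_complex_pairing; apply/matrixP => i j.
  rewrite mul_sperm_mx !mxE flipK mulrnAr -exprD; congr (_ *+ _).
  by apply: signr_parity; rewrite /=; case: ifP; lia.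
exists (complex_pairing n *m rot_mx R n); split.
- rewrite JE tr_sperm_mx; last exact: rev_ordK.
  apply/matrixP => i j; rewrite !mxE -mulNrn oppr_sign; congr (_ *+ _).
  by apply: signr_parity; rewrite /=; have := ltn_ord i; lia.
- rewrite JE; apply: sperm_mx_unit => [|i]; [exact: rev_ordK | exact: sqr_sign].
- by rewrite JE; apply: sperm_mx_monomial => i; exact: sign_mem.
rewrite mulmxA dY mulNmx -!mulmxA; congr (- (_ *m _)).
rewrite !complex_jordan_blockE mulmxDl mulmxDl !mulmxDr mul_scalar_mx mul_mx_scalar.
by rewrite -scalemxAl -scalemxAr rot_shift_mx.
Qed.

End Duality.

(** * Square roots of unipotent matrices *)

Section SquareRoot.
Local Open Scope ring_scope.
Variable F : fieldType.
Hypothesis F2 : 2%:R != 0 :> F.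

(** Truncations of the binomial series of the square root of 1 + X, found one
    coefficient at a time. *)
Lemma poly_sqrt_1DX k :
  exists r : {poly F}, ('X^(k.+1) %| (1 + 'X * r) ^+ 2 - (1 + 'X))%R.
Proof.
elim: k => [|k [r /dvdpP[s sE]]].
  by exists 0; rewrite mulr0 addr0 expr1n opprD addrA subrr add0r dvdpNr.
pose c : F := s`_0 / 2%:R.
exists (r - c *: 'X^k).
have cE : c%:P *+ 2 = (s`_0)%:P :> {poly F}.
  by rewrite -polyCMn -mulr_natr /c divfK.
have -> : (1 + 'X * (r - c *: 'X^k)) ^+ 2 - (1 + 'X) =
   (s - (s`_0)%:P) * 'X^(k.+1) - 'X^(k.+2) * ((s`_0)%:P * r - (c%:P ^+ 2) * 'X^k).
  rewrite mulrBl -sE -cE -mul_polyC !exprSr.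
  by move: 'X ('X^k) (c%:P) => x y d; ring.
have /factor_theorem [q ->] : root (s - (s`_0)%:P) 0.
  by rewrite rootE hornerD hornerN hornerC horner_coef0 subrr.
by rewrite subr0 -mulrA -exprS; apply: dvdp_sub; [exact: dvdp_mull | exact: dvdp_mulr].
Qed.

Lemma nilpotent_sqrt n (T : 'M[F]_n) : nilpotent_mx T ->
  exists Q : 'M[F]_n,
  [/\ (1%:M + T *m Q) *m (1%:M + T *m Q) = 1%:M + T,
      forall C, C *m T = T *m C -> C *m Q = Q *m C &
      forall M : 'M[F]_n, T^T *m M = M *m T -> Q^T *m M = M *m Q].
Proof.
case: n T => [|n] T [k Tk]; first by exists 0; split=> *; apply/matrixP => [[]].
have [r /dvdpP[s sE]] := poly_sqrt_1DX k.
exists (horner_mx T r); split.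
- have := congr1 (horner_mx T) sE.
  rewrite rmorphB rmorphXn !rmorphD !rmorphM !rmorph1 /= rmorphXn /= horner_mx_X.
  by rewrite [T ^+ k.+1]exprS Tk !mulr0 => /eqP; rewrite subr_eq0 expr2 => /eqP.
- by move=> C; exact: comm_mx_horner.
move=> M TM; elim/poly_ind: r {sE} => [|r c IH].
  by rewrite rmorph0 trmx0 mul0mx mulmx0.
rewrite rmorphD rmorphM /= horner_mx_X horner_mx_C linearD /= trmx_mul tr_scalar_mx.
rewrite mulmxDl mulmxDr mul_scalar_mx mul_mx_scalar; congr (_ + _).
have -> : horner_mx T r * T = T *m horner_mx T r.
  by apply/esym; exact: (comm_mx_horner r (erefl (T *m T))).
by rewrite -[LHS]mulmxA IH !mulmxA TM.
Qed.

(** If T is self-adjoint for M, then so is the square root S = 1 + T Q of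
    1 + T, being a polynomial in T; hence S^T M S = M S^2. *)
Lemma congruence_root n (M T : 'M[F]_n) : nilpotent_mx T -> T^T *m M = M *m T ->
  exists Q : 'M[F]_n,
  [/\ 1%:M + T *m Q \in unitmx,
      (1%:M + T *m Q)^T *m M *m (1%:M + T *m Q) = M *m (1%:M + T) &
      forall C, C *m T = T *m C -> C *m Q = Q *m C].
Proof.
move=> nT TM; have [Q [QQ cQ aQ]] := nilpotent_sqrt nT; exists Q; split=> //.
  by have := unitmx_1Dnilpotent nT; rewrite -QQ unitmx_mul andbb.
have -> : (1%:M + T *m Q)^T *m M = M *m (1%:M + T *m Q).
  rewrite linearD /= trmx1 mulmxDl mulmxDr mul1mx mulmx1 trmx_mul -mulmxA TM.
  by rewrite mulmxA aQ // -mulmxA (cQ T).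
by rewrite -mulmxA QQ.
Qed.

End SquareRoot.

(** * Normal forms of nondegenerate pivots *)

Section PivotNormalForms.
Local Open Scope ring_scope.
Variable R : realType.

Lemma two_neq0 : 2%:R != 0 :> R. Proof. by rewrite pnatr_eq0. Qed.

Lemma monomial_rowsN m n (M : 'M[R]_(m, n)) : monomial_rows M -> monomial_rows (- M).
Proof.
move=> mM i; have [M1 M2] := mM i; split=> [j|j k]; rewrite !mxE; last first.
  by rewrite !oppr_eq0; exact: M2.
by have := M1 j; rewrite !inE => /or3P[] /eqP->; rewrite ?oppr0 ?opprK ?eqxx ?orbT.
Qed.

(** Write X = Y H with Y the standard pairing.  Then H commutes with the
    block and is self-adjoint for Y, whereas the block is anti-self-adjoint.
    Comparing H = a + c A + T with its adjoint a - c A + T' shows that c A is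
    nilpotent.  So H is a times a unipotent matrix, and the square root of the
    latter, rescaled by the square root of |a|, transforms X into Y or - Y. *)
Lemma self_dual_normal_form (B : jblock R) (X : 'M[R]_(jblock_dim B)) :
  jblock_valid B -> X^T = - X -> X \in unitmx ->
  (jblock_mx B)^T *m X = - (X *m jblock_mx B) ->
  exists g : 'M[R]_(jblock_dim B),
  [/\ g \in unitmx, g *m jblock_mx B = jblock_mx B *m g &
      monomial_rows (g^T *m X *m g)].
Proof.
move=> vB skX uX AX; have [Y [skY uY mY AY]] := self_pairing vB skX uX AX.
have [d0 _ _ res _] := jblock_uniserial vB.
move: (jblock_mx B) AX AY res; move: (jblock_dim B) d0 X Y skX uX skY uY mY.
move=> n n0 X Y skX uX skY uY mY A AX AY res.
have [H YH] : exists H, Y *m H = X.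
  by exists (invmx Y *m X); rewrite mulmxA mulmxV // mul1mx.
have HY : H^T *m Y = Y *m H.
  by rewrite YH -[LHS]trmxK trmx_mul trmxK skY mulNmx YH linearN /= skX opprK.
have cHA : H *m A = A *m H.
  apply: (can_inj (mulKmx uY)); rewrite !mulmxA YH -[LHS]opprK -AX.
  by rewrite -{1}YH !mulmxA AY mulNmx opprK.
have [a [c [T [HE nT]]]] := res H cHA.
(* The adjoint of T for the form Y. *)
pose T' := invmx Y *m T^T *m Y.
have nT' : nilpotent_mx T'.
  have [k Tk] := nilpotent_mx_tr nT; exists k.
  suff -> : T' ^+ k = invmx Y *m (T^T ^+ k) *m Y by rewrite Tk mulmx0 mul0mx.
  elim: k {Tk} => [|k IH]; first by rewrite !expr0 mulmx1 mulVmx.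
  by rewrite !exprS IH -!mulmxE !mulmxA mulmxK.
have TE : T = H - a%:M - c *: A by rewrite HE -addrA -opprD addrC addKr.
have T'E : T' = H - a%:M + c *: A.
  have trB (P V : 'M[R]_n) : (P - V)^T = P^T - V^T by exact: linearB.
  rewrite /T' TE !trB tr_scalar_mx [(c *: A)^T]linearZ /= mulmxBr mulmxBr !mulmxBl.
  rewrite -(mulmxA _ H^T) HY mulKmx // mul_mx_scalar -scalemxAl mulVmx // scalemx1.
  by rewrite -scalemxAr -scalemxAl -mulmxA AY mulmxN mulKmx // scalerN opprK.
have cTA : T *m A = A *m T.
  by rewrite TE !(mulmxBl, mulmxBr) cHA mul_scalar_mx mul_mx_scalar -scalemxAl -scalemxAr.
have cTH : T *m H = H *m T.
  by rewrite TE !(mulmxBl, mulmxBr) mul_scalar_mx mul_mx_scalar -scalemxAl -scalemxAr cHA.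
have cTT' : T *m T' = T' *m T.
  by rewrite T'E !(mulmxDl, mulmxDr) !mulNmx !mulmxN cTH mul_scalar_mx mul_mx_scalar
    -scalemxAl -scalemxAr cTA.
pose T1 := c *: A + T.
have nT1 : nilpotent_mx T1.
  have cA : c *: A = (2%:R)^-1 *: (T' - T).
    by rewrite T'E TE opprB addrC addrA subrK -mulr2n -scaler_nat scalerA mulVf ?two_neq0
      ?scale1r.
  apply: nilpotent_mxD => //; first by rewrite -scalemxAl -scalemxAr cTA.
  rewrite cA; apply: nilpotent_mxZ; apply: nilpotent_mxD => //; last exact: nilpotent_mxN.
  by rewrite mulmxN mulNmx cTT'.
have HE1 : H = a%:M + T1 by rewrite HE addrA.
have a0 : a != 0.
  apply: contraTneq uX => a0; rewrite -YH unitmx_mul uY /= HE1 a0 raddf0 add0r.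
  exact: nilpotent_mx_nonunit.
pose T2 := a^-1 *: T1.
have T1Y : T1^T *m Y = Y *m T1.
  have -> : T1 = H - a%:M by rewrite HE1 addrC addKr.
  by rewrite linearB /= tr_scalar_mx mulmxBl mulmxBr HY mul_scalar_mx mul_mx_scalar.
have T2Y : T2^T *m Y = Y *m T2 by rewrite /T2 linearZ /= -scalemxAl -scalemxAr T1Y.
have [Q [uS SYS cQ]] := congruence_root two_neq0 (nilpotent_mxZ a^-1 nT1) T2Y.
move: uS SYS cQ; rewrite -/T2; set S := 1%:M + _ => uS SYS cQ.
have cAT2 : A *m T2 = T2 *m A.
  by rewrite /T2 -scalemxAl -scalemxAr mulmxDl mulmxDr -scalemxAl -scalemxAr cTA.
have cSA : S *m A = A *m S.
  rewrite mulmxDl mulmxDr mul1mx mulmx1; congr (_ + _).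
  by rewrite mulmxA cAT2 -!mulmxA cQ.
have XE : X = a *: (S^T *m Y *m S).
  by rewrite SYS scalemxAr scalerDr scalemx1 /T2 scalerA divff // scale1r -HE1 YH.
have s0 : Num.sqrt `|a| != 0 by rewrite sqrtr_eq0 -ltNge normr_gt0.
pose Z := Num.sqrt `|a| *: S.
have uZ : Z \in unitmx by rewrite unitmxZ // unitfE.
have XZ : X = Num.sg a *: (Z^T *m Y *m Z).
  rewrite XE {1}[a]numEsg /Z [(_ *: S)^T]linearZ /= -!scalemxAl -scalemxAr !scalerA.
  by rewrite -mulrA -expr2 sqr_sqrtr.
exists (invmx Z); split.
- by rewrite unitmx_inv.
- apply: (can_inj (mulKmx uZ)); rewrite !mulmxA mulmxV // mul1mx.
  by rewrite -scalemxAl cSA scalemxAr mulmxK.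
have -> : (invmx Z)^T *m X *m invmx Z = Num.sg a *: Y.
  rewrite XZ -scalemxAr -scalemxAl !mulmxA -trmx_mul mulmxV // trmx1 mul1mx.
  by rewrite mulmxK.
have [a_lt0|a_gt0|/eqP] := ltrgtP a 0; last by rewrite (negPf a0).
  by rewrite ltr0_sg // scaleN1r; exact: monomial_rowsN.
by rewrite gtr0_sg // scale1r.
Qed.

Section Hyperbolic.
Variables (d d' : nat) (A1 : 'M[R]_d) (A2 : 'M[R]_d').
Variables (U : 'M[R]_d) (X : 'M[R]_(d, d')) (W : 'M[R]_d').
Hypothesis uA1 : uniserial A1.
Hypotheses (skU : U^T = - U) (skW : W^T = - W) (iX : mxiso X).
Hypothesis AU : A1^T *m U = - (U *m A1).
Hypothesis AX : A1^T *m X = - (X *m A2).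
Hypothesis AW : A2^T *m W = - (W *m A2).
Hypothesis nW : W \notin unitmx.

(** The matrix with blocks U, X, - X^T, W is the product of the hyperbolic
    matrix with off-diagonal block X and of 1 + T, where T is off-diagonal with
    T^2 = diag (Y Z, Z Y).  As W is not invertible, neither is
    Y Z, which lies in a local centraliser; so T is nilpotent. *)
Lemma hyperbolic_root :
  exists (Y : 'M[R]_(d, d')) (Z : 'M[R]_(d', d)) (Q : 'M[R]_(d + d')),
  let T := block_mx 0 Y Z 0 in let S := 1%:M + T *m Q in
  [/\ S \in unitmx,
      S^T *m block_mx 0 X (- X^T) 0 *m S = block_mx U X (- X^T) W,
      A1 *m Y = Y *m A2, ~ mxiso Y &
      block_mx A1 0 0 A2 *m T = T *m block_mx A1 0 0 A2 /\
      block_mx A1 0 0 A2 *m Q = Q *m block_mx A1 0 0 A2].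
Proof.
have [Xi [XiX XXi]] := iX.
have dd : d = d' := mxiso_dim iX.
pose Y := - (Xi^T *m W); pose Z := Xi *m U.
have XtXi : Xi^T *m X^T = 1%:M by rewrite -trmx_mul XXi trmx1.
have XiXt : X^T *m Xi^T = 1%:M by rewrite -trmx_mul XiX trmx1.
have AXi : A2 *m Xi = - (Xi *m A1^T).
  by rewrite -[X in X *m _]mul1mx -XiX -!mulmxA (mulmxA X) -[X *m A2]opprK -AX mulNmx mulmxN
    -!mulmxA XXi mulmx1.
have AXit : A1 *m Xi^T = - (Xi^T *m A2^T).
  by rewrite -trmx_mul AXi linearN /= trmx_mul trmxK opprK.
have AY : A1 *m Y = Y *m A2.
  by rewrite /Y mulmxN mulNmx mulmxA AXit mulNmx -!mulmxA AW mulmxN opprK.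
have AZ : A2 *m Z = Z *m A1 by rewrite /Z mulmxA AXi mulNmx -!mulmxA AU mulmxN opprK.
have nYZ : nilpotent_mx (Y *m Z).
  have cYZ : Y *m Z *m A1 = A1 *m (Y *m Z) by rewrite -mulmxA -AZ !mulmxA AY.
  case: (uniserial_local uA1 cYZ) => // uYZ; case/negP: nW.
  rewrite -row_free_unit /row_free eqn_leq rank_leq_row -{1}dd.
  have := mxrank_unit uYZ; rewrite /Y mulNmx mxrank_opp -mulmxA => <-.
  by rewrite (leq_trans (mxrankM_maxr _ _)) // mxrankM_maxl.
pose T := block_mx 0 Y Z 0.
have nT : nilpotent_mx T.
  have [k YZk] := nYZ; exists (2 * k.+1)%N.
  have TT : T ^+ 2 = block_mx (Y *m Z) 0 0 (Z *m Y).
    rewrite expr2 -mulmxE mulmx_block; congr block_mx;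
      by rewrite ?mul0mx ?mulmx0 ?add0r ?addr0.
  have TTX j : (T ^+ 2) ^+ j = block_mx ((Y *m Z) ^+ j) 0 0 ((Z *m Y) ^+ j).
    elim: j => [|j IH]; first by rewrite !expr0 -scalar_mx_block.
    rewrite exprS IH TT -mulmxE mulmx_block !exprS -!mulmxE; congr block_mx;
      by rewrite ?mul0mx ?mulmx0 ?add0r ?addr0.
  have ZYX j : (Z *m Y) ^+ j.+1 = Z *m (Y *m Z) ^+ j *m Y.
    elim: j => [|j IH]; first by rewrite expr1 expr0 mulmx1.
    by rewrite exprS IH -mulmxE exprS -mulmxE !mulmxA.
  by rewrite exprM TTX exprS YZk mulr0 ZYX YZk mulmx0 mul0mx -[RHS]block_mx0.
pose M0 := block_mx 0 X (- X^T) 0.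
have M0T : M0 *m T = block_mx U 0 0 W.
  rewrite mulmx_block /Y /Z !mulmx0 !mul0mx !add0r !addr0 mulmxA XXi mul1mx.
  by rewrite mulNmx mulmxN opprK mulmxA XiXt mul1mx.
have skM0 : M0^T = - M0.
  by rewrite tr_block_mx !trmx0 linearN /= trmxK opp_block_mx !oppr0 opprK.
have TM0 : T^T *m M0 = M0 *m T.
  rewrite -[LHS]trmxK trmx_mul trmxK skM0 mulNmx M0T linearN /= tr_block_mx.
  by rewrite !trmx0 skU skW opp_block_mx !oppr0 !opprK.
have [Q [uS SMS cQ]] := congruence_root two_neq0 nT TM0.
exists Y, Z, Q => /=; rewrite -/T -/M0; split=> //.
- by rewrite SMS mulmxDr mulmx1 M0T add_block_mx !add0r !addr0.
- move=> iY; case/negP: nW; apply/mxiso_unit.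
  have -> : W = X^T *m (- Y) by rewrite opprK mulmxA XiXt mul1mx.
  by apply: mxisoM; [exact: mxiso_tr | exact: mxisoN].
have cT : block_mx A1 0 0 A2 *m T = T *m block_mx A1 0 0 A2.
  by rewrite !mulmx_block !mulmx0 !mul0mx !add0r !addr0 AY AZ.
by split=> //; exact: cQ.
Qed.

End Hyperbolic.

(** The last clause, on the upper rows of g, is what is needed to lift g
    from the quotient by the radical to the whole space. *)
Lemma hyperbolic_normal_form (B C : jblock R) (U : 'M[R]_(jblock_dim B))
    (X : 'M[R]_(jblock_dim B, jblock_dim C)) (W : 'M[R]_(jblock_dim C)) :
  let A := block_mx (jblock_mx B) 0 0 (jblock_mx C) in
  let M := block_mx U X (- X^T) W in
  jblock_valid B -> jblock_valid C -> U^T = - U -> W^T = - W -> mxiso X ->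
  A^T *m M = - (M *m A) -> W \notin unitmx ->
  exists (g : 'M[R]_(jblock_dim B + jblock_dim C))
         (Y : 'M[R]_(jblock_dim B, jblock_dim C)),
  [/\ g \in unitmx, g *m A = A *m g, M \in unitmx,
      g^T *m M *m g = block_mx 0 Y (- Y^T) 0 &
      [/\ monomial_rows Y, monomial_rows Y^T &
      exists (Z : 'M[R]_(jblock_dim B, jblock_dim C))
             (P : 'M[R]_(jblock_dim B + jblock_dim C)),
      [/\ jblock_mx B *m Z = Z *m jblock_mx C, ~ mxiso Z, P *m A = A *m P &
          usubmx g = row_mx 1%:M 0 + row_mx 0 Z *m P]]].
Proof.
move=> A M vB vC skU skW iX AM nW.
move: (AM); rewrite tr_block_mx !trmx0 !mulmx_block opp_block_mx.
rewrite !mulmx0 !mul0mx !add0r !addr0 => /eq_block_mx [AU AX _ AW].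
have CE := dual_block_eq vB vC iX AX; subst C.
have [Y [iY mY mYt AY]] := dual_pairing B.
have [Y0 [Z0 [Q /= [uS SMS cY0 nY0 [cT cQ]]]]] :=
  hyperbolic_root (jblock_uniserial vB) skU skW iX AU AX AW nW.
move: uS SMS cT; set T := block_mx 0 _ _ 0; set S := 1%:M + _ => uS SMS cT.
have [Xi [XiX XXi]] := iX.
have [h Xh ih] : exists2 h, X *m h = Y & mxiso h.
  exists (Xi *m Y); first by rewrite mulmxA XXi mul1mx.
  by apply: mxisoM => //; exists X.
have ch : h *m jblock_mx (jblock_dual B) = jblock_mx (jblock_dual B) *m h.
  have : X *m (h *m jblock_mx (jblock_dual B)) = X *m (jblock_mx (jblock_dual B) *m h).
    have XC : X *m jblock_mx (jblock_dual B) = - ((jblock_mx B)^T *m X) by rewrite AX opprK.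
    by rewrite !mulmxA Xh XC mulNmx -mulmxA Xh AY opprK.
  by move=> /(congr1 (mulmx Xi)); rewrite !mulmxA XiX !mul1mx.
have [hi [hih hhi]] := ih.
pose D := block_mx (1%:M : 'M_(jblock_dim B)) 0 0 h.
have uD : D \in unitmx.
  have /mulmx1_unit[] // : D *m block_mx 1%:M 0 0 hi = 1%:M.
  by rewrite mulmx_block !mulmx0 !mul0mx !add0r !addr0 mulmx1 hhi -scalar_mx_block.
have cD : D *m A = A *m D.
  by rewrite !mulmx_block !mulmx0 !mul0mx !add0r !addr0 mulmx1 mul1mx ch.
have cS : S *m A = A *m S.
  by rewrite mulmxDl mulmxDr mul1mx mulmx1 mulmxA cT -!mulmxA cQ.
have cSi : invmx S *m A = A *m invmx S.
  by apply: (can_inj (mulKmx uS)); rewrite !mulmxA cS mulmxV // mul1mx mulmxK.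
have gMg : (invmx S *m D)^T *m M *m (invmx S *m D) = block_mx 0 Y (- Y^T) 0.
  rewrite /M -SMS trmx_mul !mulmxA mulmxK // -(mulmxA D^T) -trmx_mul mulmxV // trmx1 mulmx1.
  rewrite tr_block_mx !trmx0 trmx1 !mulmx_block !mulmx0 !mul0mx !add0r !addr0 mulmx1 mul1mx Xh.
  by rewrite mulmx1 mul0mx mulmxN -trmx_mul Xh.
exists (invmx S *m D), Y; split=> //.
- by rewrite unitmx_mul unitmx_inv uS.
- by rewrite -mulmxA cD !mulmxA cSi.
- rewrite /M -SMS !unitmx_mul unitmx_tr uS !andbT /=.
  have /mulmx1_unit[] // : block_mx 0 X (- X^T) 0 *m block_mx 0 (- Xi^T) Xi 0 = 1%:M.
  rewrite mulmx_block !mulmx0 !mul0mx !add0r !addr0 XXi mulNmx mulmxN opprK.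
  by rewrite -trmx_mul XiX trmx1 -scalar_mx_block.
split=> //; exists Y0, (- (Q *m invmx S *m D)); split=> //.
  by rewrite mulNmx mulmxN -!mulmxA cD (mulmxA _ A) cSi !mulmxA cQ.
have SiE : invmx S = 1%:M - T *m Q *m invmx S.
  by apply: (can_inj (mulmxK uS)); rewrite mulmxBl mulVmx // mulmxKV // mul1mx addrK.
rewrite -mul_usub_mx {1}SiE linearB /= -!mul_usub_mx /T block_mxEv col_mxKu.
rewrite [1%:M]scalar_mx_block block_mxEv col_mxKu mulmxBl /D mul_row_block.
rewrite !mulmx0 !mul0mx addr0 addr0 mulmx1 mulmxN; congr (_ - _).
by rewrite -!mulmxA.
Qed.


End PivotNormalForms.

(** * Jordan bases and orthogonal splitting *)

Section AnticommutingInverse.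
Local Open Scope ring_scope.
(** Inverting an intertwiner exchanges the two sides. *)
Lemma anticomm_invmx (F : fieldType) n (M B C : 'M[F]_n) : M \in unitmx ->
  M *m B = - (C *m M) -> B *m invmx M = - (invmx M *m C).
Proof.
move=> uM MB; apply: (can_inj (mulKmx uM)).
by rewrite mulmxA MB mulNmx mulmxK // mulmxN mulKVmx.
Qed.

End AnticommutingInverse.

Section Frames.
Local Open Scope ring_scope.
Variables (R : realType) (N m : nat) (A w : 'M[R]_N) (b : 'I_m -> jblock R).
Hypotheses (skw : w^T = - w) (Aw : A^T *m w = - (w *m A)).
Hypothesis vb : forall i, jblock_valid (b i).

Local Notation basis := (forall i, 'M[R]_(N, jblock_dim (b i))).

(** A Jordan basis cut into the families E i, one for each block.  That they
    span is expressed by the absence of a common left annihilator, a condition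
    that survives the base changes below without inverting anything. *)
Definition jordan_frame (E : basis) : Prop :=
  (forall i, A *m E i = E i *m jblock_mx (b i)) /\
  (forall u : 'rV[R]_N, (forall i, u *m E i = 0) -> u = 0).

Definition gram (E : basis) i j := (E i)^T *m w *m E j.

(** The block i lies outside the set S of blocks still to be treated, and is
    matched with a block j that lies outside S too and may be i itself. *)
Definition settled (S : {set 'I_m}) (E : basis) i : Prop :=
  exists j, [/\ j \notin S, forall k, k != j -> gram E i k = 0 &
                monomial_rows (gram E i j)].

Definition partial_matching (S : {set 'I_m}) (E : basis) : Prop :=
  jordan_frame E /\ forall i, i \notin S -> settled S E i.

Lemma gram_tr E i j : (gram E i j)^T = - gram E j i.
Proof. by rewrite /gram !trmx_mul trmxK skw mulNmx mulmxN mulmxA. Qed.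

Lemma gram_eq0C E i j : gram E i j = 0 -> gram E j i = 0.
Proof. by move=> g0; rewrite -[LHS]opprK -gram_tr g0 trmx0 oppr0. Qed.

Lemma gram_dual E i j : jordan_frame E ->
  (jblock_mx (b i))^T *m gram E i j = - (gram E i j *m jblock_mx (b j)).
Proof.
move=> [AE _]; rewrite /gram !mulmxA -trmx_mul -AE trmx_mul -(mulmxA (E i)^T A^T) Aw.
by rewrite mulmxN mulNmx -!mulmxA AE.
Qed.

Lemma settled_gram0 S E i k : settled S E i -> k \in S -> gram E i k = 0.
Proof.
by move=> [j [jS g0 _]] kS; apply: g0; apply: contraNneq jS => <-.
Qed.

(** A base change that leaves the settled blocks alone, keeps the others
    orthogonal to them and matches the blocks of P among themselves settles P. *)
Lemma partial_matching_update (S P : {set 'I_m}) E (E' : basis) :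
  partial_matching S E -> P \subset S -> jordan_frame E' ->
  (forall i, i \notin S -> E' i = E i) ->
  (forall i k, i \notin S -> k \in S -> (E i)^T *m w *m E' k = 0) ->
  (forall i, i \in P -> exists j, [/\ j \in P, forall k, k != j -> gram E' i k = 0 &
      monomial_rows (gram E' i j)]) ->
  partial_matching (S :\: P) E'.
Proof.
move=> [_ stE] PS frE' EE' g0 stP; split=> // i.
rewrite inE negb_and negbK => /orP[/stP[j [jP gj mj]] | iS].
  by exists j; split=> //; rewrite inE jP.
have [j [jS gj mj]] := stE i iS; exists j; split.
- by rewrite inE (negPf jS) andbF.
- move=> k kj; rewrite /gram EE' //; have [kS|kS] := boolP (k \in S); first exact: g0.
  by rewrite EE' //; exact: gj.
by rewrite /gram !EE'.
Qed.

Section Projection.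
Variables (d : nat) (EP : 'M[R]_(N, d)) (AP : 'M[R]_d).
Hypothesis AEP : A *m EP = EP *m AP.
Hypothesis uM : EP^T *m w *m EP \in unitmx.

Let M := EP^T *m w *m EP.
(** The projection onto the w-orthogonal complement of the image of EP,
    along this image. *)
Definition orthoproj := 1%:M - EP *m invmx (EP^T *m w *m EP) *m (EP^T *m w).

Lemma orthoproj_comm : A *m orthoproj = orthoproj *m A.
Proof.
have EA : EP^T *m w *m A = - (AP^T *m (EP^T *m w)).
  by rewrite -mulmxA -[w *m A]opprK -Aw mulmxN !mulmxA -!trmx_mul AEP.
have MA : AP *m invmx M = - (invmx M *m AP^T).
  apply: anticomm_invmx => //.
  by rewrite /M -(mulmxA (EP^T *m w)) -AEP mulmxA EA mulNmx -!mulmxA.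
rewrite /orthoproj -/M mulmxBr mulmxBl mulmx1 mul1mx; congr (_ - _).
by rewrite -[RHS]mulmxA EA !mulmxA AEP -!mulmxA (mulmxA AP) MA !mulNmx !mulmxN -!mulmxA.
Qed.

Lemma ortho_orthoproj : EP^T *m w *m orthoproj = 0.
Proof. by rewrite /orthoproj mulmxBr mulmx1 !mulmxA mulmxV // mul1mx subrr. Qed.

Lemma orthoproj_id n (E : 'M[R]_(N, n)) : EP^T *m w *m E = 0 -> orthoproj *m E = E.
Proof. by move=> E0; rewrite /orthoproj mulmxBl mul1mx -(mulmxA _ (EP^T *m w)) E0 mulmx0
  subr0. Qed.

Lemma orthoproj_row (u : 'rV[R]_N) : u *m EP = 0 -> u *m orthoproj = u.
Proof. by move=> u0; rewrite /orthoproj mulmxBr mulmx1 !mulmxA u0 !mul0mx subr0. Qed.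

End Projection.

(** An invertible diagonal Gram block is normalised and split off by
    orthogonal projection. *)
Lemma split_self_dual S E i : partial_matching S E -> i \in S ->
  gram E i i \in unitmx -> exists E' : basis, partial_matching (S :\ i) E'.
Proof.
move=> mE iS uX; have [[AE fE] stE] := mE.
have skX : (gram E i i)^T = - gram E i i by exact: gram_tr.
have [g [ug cg mg]] := self_dual_normal_form (vb i) skX uX (gram_dual _ _ (proj1 mE)).
pose P := orthoproj (E i).
exists (dfwith (fun k => P *m E k) (E i *m g)).
set E' := dfwith _ _.
have E'i : E' i = E i *m g by exact: dfwith_in.
have E'k k : k != i -> E' k = P *m E k by move=> ki; apply: dfwith_out; rewrite eq_sym.
have oP : (E i)^T *m w *m P = 0 by exact: ortho_orthoproj.
apply: (partial_matching_update mE).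
- by rewrite finset.sub1set.
- split=> [k | u uE'].
    have [-> | ki] := eqVneq k i; first by rewrite E'i mulmxA AE -!mulmxA cg.
    by rewrite E'k // !mulmxA (orthoproj_comm (AE i) uX) -!mulmxA AE.
  have ui : u *m E i = 0.
    by have := uE' i; rewrite E'i mulmxA => /(congr1 (mulmxr (invmx g)));
      rewrite /= mulmxK // mul0mx.
  apply: fE => k; have [-> // | ki] := eqVneq k i.
  by have := uE' k; rewrite E'k // mulmxA orthoproj_row.
- move=> k kS; rewrite E'k; last by apply: contraNneq kS => ->.
  apply: orthoproj_id; apply: gram_eq0C.
  exact: (settled_gram0 (stE k kS)).
- move=> k l kS lS; have ki0 := settled_gram0 (stE k kS) iS.
  have [-> | li] := eqVneq l i; first by rewrite E'i mulmxA -/(gram E k i) ki0 mul0mx.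
  rewrite E'k // /P /orthoproj mulmxBl mul1mx mulmxBr !mulmxA -/(gram E k i) ki0.
  by rewrite !mul0mx subr0 -/(gram E k l) (settled_gram0 (stE k kS)).
move=> k; rewrite inE => /eqP ->; exists i; split; first by rewrite inE.
  move=> l li; rewrite /gram E'i E'k // trmx_mul -(mulmxA g^T) -mulmxA.
  by rewrite (mulmxA _ P) oP mul0mx mulmx0.
by rewrite /gram E'i trmx_mul; move: mg; rewrite /gram !mulmxA.
Qed.

Lemma gram_row_mx E i j :
  (row_mx (E i) (E j))^T *m w *m row_mx (E i) (E j) =
  block_mx (gram E i i) (gram E i j) (- (gram E i j)^T) (gram E j j).
Proof. by rewrite gram_tr opprK tr_row_mx mul_col_mx mul_col_row. Qed.

(** The same for a pair of blocks with an invertible Gram block, seen as a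
    single pivot of twice the size. *)
Lemma split_dual_pair S E i j : partial_matching S E -> i \in S -> j \in S ->
  i != j -> mxiso (gram E i j) -> gram E j j \notin unitmx ->
  exists E' : basis, partial_matching (S :\: [set i; j]) E'.
Proof.
move=> mE iS jS ij iX nW; have [[AE fE] stE] := mE.
pose EP := row_mx (E i) (E j).
pose AP := block_mx (jblock_mx (b i)) 0 0 (jblock_mx (b j)).
have AEP : A *m EP = EP *m AP.
  by rewrite mul_mx_row mul_row_block !mulmx0 addr0 add0r !AE.
have AM : AP^T *m (EP^T *m w *m EP) = - (EP^T *m w *m EP *m AP).
  rewrite !mulmxA -trmx_mul -AEP trmx_mul -(mulmxA EP^T A^T) Aw.
  by rewrite mulmxN mulNmx -!mulmxA AEP.
move: (AM); rewrite gram_row_mx => AM'.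
have [g [Y [ug cg uM gMg [mY mYt _]]]] := hyperbolic_normal_form (vb i) (vb j)
  (gram_tr E i i) (gram_tr E j j) iX AM' nW.
rewrite -gram_row_mx -/EP -/AP in uM gMg cg.
pose P := orthoproj EP; pose G := EP *m g.
have oP : EP^T *m w *m P = 0 by exact: ortho_orthoproj.
have AG : A *m G = G *m AP by rewrite /G mulmxA AEP -!mulmxA cg.
have GE : G = row_mx (lsubmx G) (rsubmx G) by rewrite hsubmxK.
have GwG : (row_mx (lsubmx G) (rsubmx G))^T *m w *m row_mx (lsubmx G) (rsubmx G) =
    block_mx 0 Y (- Y^T) 0.
  by rewrite hsubmxK /G trmx_mul -gMg !mulmxA.
have GwP : G^T *m w *m P = 0 by rewrite /G trmx_mul -!mulmxA (mulmxA EP^T) oP mulmx0.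
move: GwG; rewrite tr_row_mx mul_col_mx mul_col_row => /eq_block_mx [gii gij gji gjj].
move: GwP; rewrite GE tr_row_mx !mul_col_mx -[0]vsubmxK => /eq_col_mx [].
rewrite !linear0 => giP gjP.
move: AG; rewrite GE mul_mx_row mul_row_block !mulmx0 addr0 add0r => /eq_row_mx [AGi AGj].
exists (dfwith (dfwith (fun k => P *m E k) (lsubmx G)) (rsubmx G)).
set E' := dfwith _ _.
have E'j : E' j = rsubmx G by exact: dfwith_in.
have E'i : E' i = lsubmx G by rewrite /E' dfwith_out 1?eq_sym // dfwith_in.
have E'k k : k != i -> k != j -> E' k = P *m E k.
  by move=> ki kj; rewrite /E' !dfwith_out // eq_sym.
have frow k : k \notin S -> (E k)^T *m w *m EP = 0.
  move=> kS; rewrite mul_mx_row -/(gram E k i) -/(gram E k j).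
  by rewrite !(settled_gram0 (stE k kS)) // row_mx0.
have frowG k : k \notin S -> (E k)^T *m w *m lsubmx G = 0 /\ (E k)^T *m w *m rsubmx G = 0.
  move=> kS; have : (E k)^T *m w *m G = 0 by rewrite mulmxA frow // mul0mx.
  by rewrite {1}GE mul_mx_row -[0]hsubmxK !linear0 => /eq_row_mx.
apply: (partial_matching_update mE).
- by apply/fintype.subsetP => k; rewrite !inE => /orP[] /eqP ->.
- split=> [k | u uE'].
    have [-> | ki] := eqVneq k i; first by rewrite E'i.
    have [-> | kj] := eqVneq k j; first by rewrite E'j.
    by rewrite E'k // !mulmxA (orthoproj_comm AEP uM) -!mulmxA AE.
  have uG : u *m G = 0 by rewrite GE mul_mx_row -E'i -E'j !uE' row_mx0.
  have uEP : u *m EP = 0.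
    by move: uG => /(congr1 (mulmxr (invmx g))); rewrite /= mulmxA mulmxK // mul0mx.
  move: (uEP); rewrite mul_mx_row -[0]hsubmxK !linear0 => /eq_row_mx [ui uj].
  apply: fE => k; have [-> // | ki] := eqVneq k i; have [-> // | kj] := eqVneq k j.
  by have := uE' k; rewrite E'k // mulmxA orthoproj_row.
- move=> k kS; rewrite E'k; [|by apply: contraNneq kS => ->..].
  apply: orthoproj_id.
  by apply: trmx_inj; rewrite !trmx_mul trmxK skw mulNmx mulmxN mulmxA frow // oppr0 trmx0.
- move=> k l kS lS.
  have [-> | li] := eqVneq l i; first by rewrite E'i; case: (frowG k kS).
  have [-> | lj] := eqVneq l j; first by rewrite E'j; case: (frowG k kS).
  rewrite E'k // /P /orthoproj mulmxBl mul1mx mulmxBr !mulmxA frow //.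
  by rewrite !mul0mx subr0 -/(gram E k l) (settled_gram0 (stE k kS)).
move=> k; rewrite !inE => /orP[] /eqP ->.
  exists j; split; first by rewrite !inE eqxx orbT.
    move=> l lj; rewrite /gram E'i; have [-> | li] := eqVneq l i; first by rewrite E'i.
    by rewrite E'k // mulmxA giP mul0mx.
  by rewrite /gram E'i E'j gij.
exists i; split; first by rewrite !inE eqxx.
  move=> l li; rewrite /gram E'j; have [-> | lj] := eqVneq l j; first by rewrite E'j.
  by rewrite E'k // mulmxA gjP mul0mx.
by rewrite /gram E'i E'j gji; exact: monomial_rowsN.
Qed.

End Frames.

(** * Normal forms in the presence of a radical *)

Section Degenerate.
Local Open Scope ring_scope.
Variable R : realType.

Definition first_row h : 'rV[R]_h := \row_j ((j == 0 :> nat)%N%:R).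

(** Dividing a real block by its socle leaves the real block of the same
    eigenvalue and of size one less. *)
Lemma real_jordan_block_recl h (l : R) :
  real_jordan_block (1 + h) l =
  block_mx l%:M (first_row h) 0 (real_jordan_block h l).
Proof.
apply/matrixP => i j; rewrite -(splitK i) -(splitK j).
case: (split i) => i'; case: (split j) => j' /=;
  rewrite ?block_mxEul ?block_mxEur ?block_mxEdl ?block_mxEdr !mxE -?val_eqE /=.
- by rewrite !ord1.
- by rewrite ord1 /= add1n eqSS; case: eqP.
- by rewrite ord1.
- by rewrite eqSS.
Qed.

Lemma real_block_eigenvector n (l k : R) (x : 'cV[R]_n.+1) :
  real_jordan_block n.+1 l *m x = k *: x -> x != 0 ->
  l = k /\ exists c, x = c *: delta_mx 0 0.
Proof.
rewrite real_jordan_blockE mulmxDl mul_scalar_mx => Ax x0.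
have Nx : shift_mx R n.+1 1 *m x = (k - l) *: x by rewrite scalerBl -Ax addrC addKr.
have NX j : shift_mx R n.+1 1 ^+ j *m x = (k - l) ^+ j *: x.
  elim: j => [|j IH]; first by rewrite !expr0 mul1mx scale1r.
  by rewrite exprS -mulmxE -mulmxA IH -scalemxAr Nx scalerA -exprSr.
have kl : l = k.
  have := NX n.+1; rewrite shift_mxX shift_mx_ge ?mul1n // mul0mx => /esym/eqP.
  by rewrite scaler_eq0 (negPf x0) orbF expf_eq0 subr_eq0 => /andP[_ /eqP].
split=> //; exists (x 0 0); apply/matrixP => i j; rewrite ord1 !mxE eqxx andbT.
case: (unliftP 0 i) => [i'|] ->; last by rewrite eqxx mulr1.
have : (shift_mx R n.+1 1 *m x) (inord i') 0 = 0.
  by rewrite Nx kl subrr scale0r mxE.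
rewrite mxE (bigD1 (lift 0 i')) //= big1 ?addr0 => [|m mi]; last first.
  rewrite mxE inordK ?addn1 //; last by rewrite ltnS ltnW.
  by case: eqP => [e|]; rewrite ?mul0r //; case/eqP: mi; apply: val_inj.
rewrite mxE inordK ?addn1 ?lift0 ?eqxx ?mul1r; last by rewrite ltnS ltnW.
by move=> ->; rewrite mulr0.
Qed.

Lemma shift_row_solve h (u : 'rV[R]_h) : (forall i : 'I_h, i = 0 :> nat -> u 0 i = 0) ->
  exists r : 'rV[R]_h, r *m shift_mx R h 1 = u.
Proof.
case: h u => [|h] u u0; first by exists 0; apply/matrixP => i [].
exists (\row_j if (j < h)%N then u 0 (inord j.+1) else 0).
apply/matrixP => i j; rewrite ord1 mxE.
case: (unliftP 0 j) => [j'|] ->.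
  rewrite (bigD1 (widen_ord (leqnSn h) j')) //= !mxE /= ltn_ord addn1 eqxx mulr1.
  rewrite big1 ?addr0 => [|m mi].
    by congr (u _ _); apply: val_inj; rewrite /= inordK // ltnS.
  rewrite !mxE /= addn1 /bump /= add1n eqSS; case: eqP => [e|]; last by rewrite mulr0.
  by case/eqP: mi; apply: val_inj.
rewrite u0 // big1 // => m _; rewrite !mxE /= addn1.
by rewrite mulr0.
Qed.

(** Matrices commuting with a real block preserve its eigenline. *)
Lemma comm_shift_col0 h (l : R) (S : 'M[R]_h.+1) :
  S *m real_jordan_block h.+1 l = real_jordan_block h.+1 l *m S ->
  S *m delta_mx 0 0 = (S 0 0) *: delta_mx 0 (0 : 'I_1).
Proof.
move=> cS; have Ae : real_jordan_block h.+1 l *m delta_mx 0 0 = l *: delta_mx 0 (0 : 'I_1).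
  rewrite real_jordan_blockE mulmxDl mul_scalar_mx -[RHS]addr0; congr (_ + _).
  by apply/matrixP => i j; rewrite -colE !mxE addn1.
have [/eqP Se0 | Sn0] := boolP (S *m delta_mx 0 (0 : 'I_1) == 0).
  rewrite Se0; suff -> : S 0 0 = 0 by rewrite scale0r.
  by have := congr1 (fun M : 'cV_h.+1 => M 0 0) Se0; rewrite -colE !mxE.
have [_ [c Sc]] : l = l /\ exists c, S *m delta_mx 0 0 = c *: delta_mx 0 (0 : 'I_1).
  apply: (real_block_eigenvector (k:=l)) => //.
  by rewrite mulmxA -cS -mulmxA Ae -scalemxAr.
rewrite Sc; congr (_ *: _).
have := congr1 (fun M : 'cV_h.+1 => M 0 0) Sc; rewrite -colE !mxE !eqxx mulr1.
by move=> <-.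
Qed.

(** The eigenvalue on the socle tells units from nilpotents. *)
Lemma comm_shift_nilpotent h (l : R) (S : 'M[R]_h.+1) :
  S *m real_jordan_block h.+1 l = real_jordan_block h.+1 l *m S ->
  (S \in unitmx -> S 0 0 != 0) /\ (S \notin unitmx -> S 0 0 = 0).
Proof.
move=> cS; have Se := comm_shift_col0 cS; split=> [uS | nS].
  apply: contraTneq (uS) => S00; move: Se; rewrite S00 scale0r => /(congr1 (mulmx (invmx S))).
  rewrite mulKmx // mulmx0 => /matrixP/(_ 0 0); rewrite !mxE !eqxx => /eqP.
  by rewrite oner_eq0.
case: (uniserial_local (real_jordan_block_uniserial h l) cS) => [uS | [k Sk]].
  by rewrite uS in nS.
have SX j : S ^+ j *m delta_mx 0 (0 : 'I_1) = (S 0 0) ^+ j *: delta_mx 0 0.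
  elim: j => [|j IH]; first by rewrite !expr0 mul1mx scale1r.
  by rewrite exprS -mulmxE -mulmxA IH -scalemxAr Se scalerA -exprSr.
have := SX k; rewrite Sk mul0mx => /matrixP/(_ 0 0); rewrite !mxE !eqxx mulr1 => /esym/eqP.
by rewrite expf_eq0 => /andP[_ /eqP].
Qed.

(** The obstruction to lifting an endomorphism g of the quotient of a module
    by a line to an endomorphism that acts on the line by c. *)
Lemma lift_comm n (l c : R) (a r : 'rV[R]_n) (A g : 'M[R]_n) :
  g *m A = A *m g -> r *m (A - l%:M) = a *m g - c *: a ->
  block_mx c%:M r 0 g *m block_mx l%:M a 0 A =
  (block_mx l%:M a 0 A *m block_mx c%:M r 0 g : 'M_(1 + n)).
Proof.
move=> cg ra; rewrite !mulmx_block !mulmx0 !mul0mx !add0r !addr0 cg.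
congr block_mx; first by rewrite -!scalar_mxM mulrC.
have rA : r *m A = l *: r + (a *m g - c *: a).
  by rewrite -ra mulmxBr mul_mx_scalar addrC subrK.
by rewrite !mul_scalar_mx rA addrCA [c *: a + _]addrC subrK.
Qed.

Lemma monomial_row_mx0 m n p (M : 'M[R]_(m, n)) :
  monomial_rows M -> monomial_rows (row_mx (0 : 'M_(m, p)) M).
Proof.
move=> mM i; have [m1 m2] := mM i; split=> [j | j k].
  rewrite -(splitK j); case: (split j) => j' /=; rewrite ?row_mxEl ?row_mxEr //.
  by rewrite mxE inE eqxx.
rewrite -(splitK j) -(splitK k); case: (split j) => j'; case: (split k) => k' /=;
  rewrite ?row_mxEl ?row_mxEr.
- by rewrite mxE eqxx.
- by rewrite mxE eqxx.
- by move=> _; rewrite mxE eqxx.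
by move=> nj nk; rewrite (m2 _ _ nj nk).
Qed.

Lemma monomial_col_mx0 m n p (M : 'M[R]_(m, n)) :
  monomial_rows M -> monomial_rows (col_mx (0 : 'M_(p, n)) M).
Proof.
move=> mM i; rewrite -(splitK i); case: (split i) => i' /=.
  split=> [j | j k]; rewrite !col_mxEu ?mxE ?inE ?eqxx //.
have [m1 m2] := mM i'; split=> [j | j k]; rewrite !col_mxEd; [exact: m1 | exact: m2].
Qed.

Lemma not_mxiso_kernel m n (X : 'M[R]_(m, n)) : (m <= n)%N -> ~ mxiso X ->
  exists2 x : 'cV_n, x != 0 & X *m x = 0.
Proof.
move=> mn nX; have [freeX | nfX] := boolP (row_free X^T).
  case: nX; move: (freeX); rewrite /row_free => /eqP rX.
  have e : m = n by apply/eqP; rewrite eqn_leq mn -{1}rX rank_leq_col.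
  by subst m; apply/mxiso_unit; rewrite -unitmx_tr -row_free_unit.
move: nfX; rewrite -kermx_eq0 => /rowV0Pn [u /sub_kermxP uX u0].
exists u^T; first by rewrite -trmx0 (inj_eq trmx_inj).
by apply: trmx_inj; rewrite trmx_mul trmxK uX trmx0.
Qed.

(** A block whose Gram matrix has one-dimensional radical.  A complex block
    has no invariant line.  In a real block the radical is the eigenline, so
    the form comes from the quotient, where it is nondegenerate; the normalising
    matrix lifts because it preserves the eigenline of the quotient. *)
Lemma degenerate_block_normal_form (B : jblock R) (G : 'M[R]_(jblock_dim B))
    (e : 'cV[R]_(jblock_dim B)) :
  jblock_valid B -> G^T = - G -> (jblock_mx B)^T *m G = - (G *m jblock_mx B) ->
  e != 0 -> (forall x : 'cV_(jblock_dim B), G *m x = 0 <-> exists c, x = c *: e) ->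
  exists g : 'M[R]_(jblock_dim B),
  [/\ g \in unitmx, g *m jblock_mx B = jblock_mx B *m g &
      monomial_rows (g^T *m G *m g)].
Proof.
move=> vB skG AG e0 kerG.
have Ge : G *m e = 0 by apply/kerG; exists 1; rewrite scale1r.
have [k Ae] : exists k, jblock_mx B *m e = k *: e.
  apply/kerG; rewrite mulmxA -[G *m _]opprK -AG mulNmx -mulmxA Ge.
  by rewrite mulmx0 oppr0.
case: B G e vB skG AG e0 kerG Ge Ae => [[|h] l|[|n] a b] //= G e vB skG AG e0 kerG Ge Ae;
  last first.
- by case: vB => _ /(complex_jordan_block_uniserial n a) [_ /(_ _ _ Ae)] e0';
  rewrite e0' eqxx in e0.
- by case: vB.
have [_ [c ec]] := real_block_eigenvector Ae e0.
have c0 : c != 0 by apply: contraNneq e0 => c0; rewrite ec c0 scale0r.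
have G0 : G *m delta_mx 0 (0 : 'I_1) = 0.
  by apply/eqP; have /eqP := Ge; rewrite ec -scalemxAr scaler_eq0 (negPf c0).
have kerG' (x : 'cV_h.+1) : G *m x = 0 -> exists c', x = c' *: delta_mx 0 0.
  move=> Gx; have [c' ->] := proj1 (kerG x) Gx; by exists (c' * c); rewrite ec scalerA.
move: G skG AG G0 kerG' {e e0 ec kerG Ge Ae vB}; rewrite -[h.+1]/(1 + h)%N => G skG AG G0 kerG.
have [U GE] : exists U, G = block_mx 0 0 0 U.
  exists (drsubmx G).
  have c00 : lsubmx G = 0.
    move: G0; rewrite -colE => /matrixP G0; apply/matrixP => i j.
    rewrite !mxE; have := G0 i 0; rewrite !mxE => <-.
    by congr (G _ _); apply: val_inj; rewrite ord1.
  have r00 : usubmx G = 0.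
    by rewrite -[LHS]trmxK trmx_usub skG linearN /= c00 oppr0 trmx0.
  rewrite -[LHS](submxK G); congr block_mx.
  - by rewrite /ulsubmx r00 linear0.
  - by rewrite /ursubmx r00 linear0.
  - by rewrite -[dlsubmx _]trmxK trmx_dlsub skG /ursubmx linearN /= r00 oppr0 linear0 trmx0.
have tr_blk : G^T = block_mx 0 0 0 U^T by rewrite GE tr_block_mx !trmx0.
have skU : U^T = - U.
  by move: tr_blk; rewrite skG GE opp_block_mx => /eq_block_mx [].
move: (AG); rewrite real_jordan_block_recl GE tr_block_mx !mulmx_block opp_block_mx.
rewrite !mulmx0 !mul0mx !add0r => /eq_block_mx [_ _ _ AU].
have uU : U \in unitmx.
  apply/mxiso_unit; apply: contrapT => /(not_mxiso_kernel (leqnn h)) [x x0 Ux].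
  have [c' /matrixP xc] : exists c', (col_mx 0 x : 'cV_(1 + h)) = c' *: delta_mx 0 0.
    by apply: kerG; rewrite GE mul_block_col !mul0mx Ux !addr0 col_mx0.
  case/eqP: x0; apply/matrixP => i j; rewrite ord1 mxE.
  have := xc (rshift 1 i) 0; rewrite col_mxEd => ->.
  by rewrite !mxE /= mulr0.
case: h U uU AU skU G GE {skG G0 kerG tr_blk AG} => [|h] U uU AU skU G GE.
  exists 1%:M; split; rewrite ?unitmx1 ?mul1mx ?mulmx1 //.
  move=> i; split=> [j | j j']; last by rewrite !ord1.
  rewrite trmx1 mul1mx ?GE; have -> : U = 0 by apply/matrixP => -[].
  by rewrite block_mx0 mxE inE eqxx.
have vH : jblock_valid (RealBlock h.+1 l) by [].
have [g [ug cg mg]] := self_dual_normal_form vH skU uU AU.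
have [g00 _] := comm_shift_nilpotent cg.
have gc := comm_shift_col0 cg.
have [r rE] : exists r : 'rV_h.+1, r *m shift_mx R h.+1 1 = first_row h.+1 *m g - g 0 0 *:
  first_row h.+1.
  apply: shift_row_solve => i i0; have -> : i = 0 by apply: val_inj.
  rewrite !mxE (bigD1 0) //= !mxE eqxx mul1r mulr1 big1 ?addr0 ?subrr // => j j0.
  by rewrite mxE; have /negPf -> : (j != 0 :> nat) by []; rewrite mul0r.
have rE' : r *m (real_jordan_block h.+1 l - l%:M) = first_row h.+1 *m g - g 0 0 *: first_row
  h.+1.
  by rewrite real_jordan_blockE addrAC subrr add0r.
exists (block_mx (g 0 0)%:M r 0 g : 'M_(1 + h.+1)); split.
- by rewrite unitmxE det_ublock unitrM det_scalar1 unitfE g00 // -unitmxE.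
- by have := lift_comm cg rE'; rewrite -real_jordan_block_recl.
rewrite tr_block_mx !mulmx_block !(mulmx0, mul0mx) !(add0r, addr0) !(mulmx0, mul0mx) trmx0
  !mul0mx !add0r.
by rewrite block_mxEv row_mx0; apply/monomial_col_mx0/monomial_row_mx0.
Qed.

(** If l <> 0, then - l and l are distinct eigenvalues and the system is
    invertible.  If l = 0, then Z commutes with a nilpotent block and is not
    invertible, so that its first row vanishes at the first index; this is the
    solvability condition for a shift. *)
Lemma shift_lift_row h (l : R) (Z : 'M[R]_h) :
  real_jordan_block h l *m Z = Z *m real_jordan_block h (- l) -> ~ mxiso Z ->
  exists r : 'rV[R]_h, r *m (real_jordan_block h (- l) - l%:M) = first_row h *m Z.
Proof.
move=> cZ nZ; have [l0 | l0] := eqVneq l 0; last first.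
  exists (first_row h *m Z *m invmx (real_jordan_block h (- l) - l%:M)).
  rewrite mulmxKV //; have l2 : - (l *+ 2) != 0 by rewrite oppr_eq0 mulrn_eq0.
  have -> : real_jordan_block h (- l) - l%:M = (- (l *+ 2)) *: (1%:M + (- (l *+ 2))^-1 *:
    shift_mx R h 1).
    rewrite real_jordan_blockE addrAC scalerDr scalerA mulfV // scale1r scalemx1.
    by congr (_ + _); rewrite -raddfB /= mulr2n opprD.
  rewrite unitmxZ ?unitfE //; apply/unitmx_1Dnilpotent/nilpotent_mxZ.
  exact: shift_mx_nilpotent.
case: h Z cZ nZ => [|h] Z; first by exists 0; apply/matrixP => i [].
rewrite l0 oppr0 => cZ nZ.
have [_ Z00] := comm_shift_nilpotent (esym cZ).
rewrite real_jordan_blockE addrAC subrr add0r; apply: shift_row_solve => i i0.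
have -> : i = 0 by apply: val_inj.
rewrite !mxE (bigD1 0) //= !mxE eqxx mul1r Z00; last by apply/negP => /mxiso_unit.
rewrite add0r big1 // => j j0; rewrite mxE.
by have /negPf -> : (j != 0 :> nat) by []; rewrite mul0r.
Qed.

(** The radical is the socle v of the larger block B, and modulo v the two
    blocks are dual to each other: their pairing is injective and the dimensions
    agree.  The
    hyperbolic normal form g of the quotient lifts: its upper rows differ from
    the identity by rows of a noninvertible intertwiner, to which
    [shift_lift_row] applies. *)
Lemma degenerate_pair_normal_form N (A w : 'M[R]_N) (B C : jblock R)
    (EB : 'M[R]_(N, jblock_dim B)) (EC : 'M[R]_(N, jblock_dim C))
    (e : 'cV[R]_(jblock_dim B)) k :
  w^T = - w -> A^T *m w = - (w *m A) -> jblock_valid B -> jblock_valid C ->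
  A *m EB = EB *m jblock_mx B -> A *m EC = EC *m jblock_mx C ->
  e != 0 -> jblock_mx B *m e = k *: e -> w *m (EB *m e) = 0 ->
  (jblock_dim C).+1 = jblock_dim B ->
  (forall x : 'cV_(jblock_dim C), EB^T *m w *m EC *m x = 0 -> x = 0) ->
  EC^T *m w *m EC \notin unitmx ->
  exists (EB' : 'M[R]_(N, jblock_dim B)) (EC' : 'M[R]_(N, jblock_dim C)),
  [/\ A *m EB' = EB' *m jblock_mx B /\ A *m EC' = EC' *m jblock_mx C,
      forall u : 'rV_N, u *m EB' = 0 -> u *m EC' = 0 -> u *m EB = 0 /\ u *m EC = 0,
      forall n (V : 'M_(n, N)), V *m w *m EB = 0 -> V *m w *m EC = 0 ->
        V *m w *m EB' = 0 /\ V *m w *m EC' = 0,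
      EB'^T *m w *m EB' = 0 /\ EC'^T *m w *m EC' = 0 &
      monomial_rows (EB'^T *m w *m EC') /\ monomial_rows (EC'^T *m w *m EB')].
Proof.
move=> skw Aw vB vC AB AC e0 Ae wEe dBC injX nW.
case: B EB e vB AB e0 Ae wEe dBC injX => [[|h] l|[|n] a b] EB e vB;
  rewrite /= in EB e vB * => AB e0 Ae wEe dBC injX; [by [] | | by case: vB | ]; last first.
  by case: vB => _ /(complex_jordan_block_uniserial n a) [_ /(_ _ _ Ae)] e0';
    rewrite e0' eqxx in e0.
have [_ [c ec]] := real_block_eigenvector Ae e0.
have c0 : c != 0 by apply: contraNneq e0 => c0; rewrite ec c0 scale0r.
have wv : w *m (EB *m delta_mx 0 (0 : 'I_1)) = 0.
  by apply/eqP; have /eqP := wEe; rewrite ec -!scalemxAr scaler_eq0 (negPf c0).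
have {}dBC : h = jblock_dim C by apply/esym/succn_inj.
move: EB AB wv injX {Ae e0 ec wEe e c0 vB}; rewrite -[h.+1]/(1 + h)%N => EB AB wv injX.
pose v := lsubmx EB; pose E' := rsubmx EB.
have EBE : EB = row_mx v E' by rewrite hsubmxK.
have {}wv : w *m v = 0.
  rewrite -[RHS]wv; congr (_ *m _); apply/matrixP => i j; rewrite -colE !mxE.
  by congr (EB _ _); apply: val_inj; rewrite ord1.
have vw : v^T *m w = 0 by rewrite -[w]opprK -skw mulmxN -trmx_mul wv trmx0 oppr0.
move: AB; rewrite real_jordan_block_recl EBE mul_mx_row mul_row_block !mulmx0 addr0.
rewrite mul_mx_scalar => /eq_row_mx [Av AE'].
pose X := E'^T *m w *m EC.
have XE : EB^T *m w *m EC = col_mx 0 X by rewrite EBE tr_row_mx !mul_col_mx vw mul0mx.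
have iX : mxiso X.
  apply: contrapT => nX; have [] := not_mxiso_kernel _ nX; first by rewrite dBC.
  move=> x x0 Xx; case/eqP: x0; apply: injX.
  by rewrite XE mul_col_mx mul0mx Xx col_mx0.
have AX : (jblock_mx (RealBlock h l))^T *m X = - (X *m jblock_mx C).
  have JE : (jblock_mx (RealBlock h l))^T *m E'^T = (A *m E')^T - (v *m first_row h)^T.
    by rewrite AE' -linearB /= addrC addKr trmx_mul.
  rewrite /X !mulmxA JE !mulmxBl !trmx_mul -!mulmxA (mulmxA A^T) Aw (mulmxA v^T) vw.
  by rewrite mul0mx mulmx0 subr0 -AC mulNmx mulmxN !mulmxA.
have vH : jblock_valid (RealBlock h l) by rewrite /= dBC;
  exact: (uniserial_gt0 (jblock_uniserial vC)).
have CE := dual_block_eq vH vC iX AX; subst C; rewrite /= in EC AC injX nW vC dBC X XE iX AX *.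
pose E2 := row_mx E' EC.
pose A2 := block_mx (real_jordan_block h l) 0 0 (real_jordan_block h (- l)).
pose a2 := row_mx (first_row h) (0 : 'rV_h).
have AE2 : A *m E2 = v *m a2 + E2 *m A2.
  rewrite mul_mx_row AE' AC mul_mx_row mul_row_block !mulmx0 addr0 add0r add_row_mx.
  by rewrite ?mulmx0 ?add0r.
have M2E : E2^T *m w *m E2 = block_mx (E'^T *m w *m E') X (- X^T) (EC^T *m w *m EC).
  rewrite tr_row_mx mul_col_mx mul_col_row; congr block_mx.
  by rewrite !trmx_mul trmxK skw mulNmx mulmxN opprK mulmxA.
have AM : A2^T *m (E2^T *m w *m E2) = - (E2^T *m w *m E2 *m A2).
  have -> : E2^T *m w *m E2 *m A2 = E2^T *m w *m (A *m E2).
    by rewrite AE2 mulmxDr (mulmxA _ v) -(mulmxA _ w v) wv mulmx0 mul0mx add0r !mulmxA.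
  have -> : A2^T *m (E2^T *m w *m E2) = (A *m E2)^T *m w *m E2.
    rewrite AE2 linearD /= !mulmxDl !trmx_mul -(mulmxA _ v^T) vw mulmx0 mul0mx add0r.
    by rewrite !mulmxA.
  by rewrite trmx_mul -(mulmxA _ A^T) Aw mulmxN mulNmx -!mulmxA.
have skE n (E : 'M_(N, n)) : (E^T *m w *m E)^T = - (E^T *m w *m E).
  by rewrite !trmx_mul trmxK skw mulNmx mulmxN mulmxA.
rewrite M2E in AM.
have [g [Y [ug cg _ gMg [mY mYt [Z [P [cZ nZ cP gE]]]]]]] :=
  @hyperbolic_normal_form R (RealBlock h l) (RealBlock h (- l)) _ _ _ vH vC
    (skE _ E') (skE _ EC) iX AM nW.
rewrite /= -M2E -/A2 in ug cg gMg gE cP.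
have [s sE] := shift_lift_row cZ nZ.
have a2g : a2 *m g = a2 + row_mx 0 (first_row h *m Z) *m P.
  have a2E n (M : 'M_(h + h, n)) : a2 *m M = first_row h *m usubmx M.
    by rewrite -{1}[M]vsubmxK mul_row_col mul0mx addr0.
  rewrite a2E gE mulmxDr mul_mx_row mulmx1 mulmx0; congr (_ + _).
  by rewrite mulmxA mul_mx_row mulmx0.
have [r rE] : exists r, r *m (A2 - l%:M) = a2 *m g - 1 *: a2.
  exists (row_mx 0 s *m P).
  rewrite a2g scale1r [RHS]addrC addKr -mulmxA.
  have -> : P *m (A2 - l%:M) = (A2 - l%:M) *m P.
    by rewrite mulmxBr mulmxBl cP mul_mx_scalar mul_scalar_mx.
  rewrite mulmxA; congr (_ *m _).
  rewrite scalar_mx_block opp_block_mx add_block_mx mul_row_block !mul0mx !add0r.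
  by rewrite ?mulmx0 ?oppr0 ?addr0 ?mulmx0 sE.
pose F2 := v *m r + E2 *m g.
have AF2 : A *m F2 = v *m a2 + F2 *m A2.
  have rA : r *m A2 = l *: r + (a2 *m g - a2).
    by rewrite -[X in _ - X]scale1r -rE mulmxBr mul_mx_scalar addrC subrK.
  rewrite /F2 mulmxDr mulmxDl !mulmxA Av AE2 mulmxDl -(mulmxA E2) -cg -(mulmxA v r) rA.
  rewrite !mulmxDr mulmxN -scalemxAl -scalemxAr !mulmxA.
  set x := l *: _; set y := v *m a2 *m g; set z := v *m a2; set t := E2 *m _ *m _.
  rewrite addrA [RHS]addrA; congr (_ + _).
  by rewrite [x + (y - z)]addrA [RHS]addrC subrK.
have F2E : F2 = row_mx (lsubmx F2) (rsubmx F2) by rewrite hsubmxK.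
move: (AF2); rewrite F2E mul_mx_row mul_mx_row mul_row_block !mulmx0 addr0 add0r.
rewrite add_row_mx add0r => /eq_row_mx [AFl AFr].
have wF2 : w *m F2 = w *m E2 *m g by rewrite mulmxDr !mulmxA wv mul0mx add0r.
have F2M : F2^T *m w *m F2 = block_mx 0 Y (- Y^T) 0.
  rewrite -mulmxA wF2 /F2 [(_ + _)^T]linearD /= mulmxDl !trmx_mul !mulmxA.
  by rewrite -(mulmxA r^T) vw mulmx0 !mul0mx add0r -gMg !mulmxA.
move: F2M; rewrite {1 2}F2E tr_row_mx mul_col_mx mul_col_row => /eq_block_mx [Fll Flr Frl Frr].
exists (row_mx v (lsubmx F2) : 'M_(N, 1 + h)), (rsubmx F2).
have vwM n (M : 'M_(N, n)) : v^T *m w *m M = 0 by rewrite vw mul0mx.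
have wvM n (M : 'M_(n, N)) : M *m w *m v = 0 by rewrite -mulmxA wv mulmx0.
split.
- by rewrite mul_mx_row mul_row_block !mulmx0 addr0 mul_mx_scalar Av AFl.
- move=> u; rewrite mul_mx_row -[0]hsubmxK !linear0 => /eq_row_mx [uv uFl] uFr.
  have : u *m F2 = 0 by rewrite F2E mul_mx_row uFl uFr row_mx0.
  rewrite mulmxDr mulmxA uv mul0mx add0r mulmxA => /(congr1 (mulmxr (invmx g))).
  rewrite /= mulmxK // mul0mx mul_mx_row -[0]hsubmxK !linear0 => /eq_row_mx [uE uC].
  by rewrite mul_mx_row uv uE row_mx0.
- move=> n V; rewrite mul_mx_row -[0]hsubmxK !linear0 => /eq_row_mx [_ VE'] VC.
  have : V *m w *m F2 = 0.
    by rewrite -mulmxA wF2 !mulmxA mul_mx_row VE' VC row_mx0 mul0mx.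
  rewrite {1}F2E mul_mx_row -[0]hsubmxK !linear0 => /eq_row_mx [VFl VFr].
  by rewrite mul_mx_row wvM VFl VFr row_mx0.
- by rewrite tr_row_mx !mul_col_mx vw mul0mx mul_mx_row wvM Fll row_mx0 col_mx0.
rewrite tr_row_mx !mul_col_mx vwM Flr mul_mx_row wvM Frl; split.
  exact: monomial_col_mx0.
by apply: monomial_row_mx0; exact: monomial_rowsN.
Qed.

End Degenerate.

(** * The Krull-Schmidt argument modulo the radical *)

Section LocalRing.
Local Open Scope ring_scope.
Variable F : fieldType.

(** If D Q is a unit, then Q D is not nilpotent, hence a unit in the local
    centraliser of C^T. *)
Lemma mxiso_of_unit_factor n d (A : 'M[F]_n) (C : 'M[F]_d)
    (D : 'M[F]_(n, d)) (Q : 'M[F]_(d, n)) :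
  uniserial A -> uniserial C -> A *m D = - (D *m C^T) ->
  C^T *m Q = - (Q *m A) -> D *m Q \in unitmx -> mxiso Q.
Proof.
move=> uA uC AD CQ uDQ.
have cQD : (Q *m D)^T *m C = C *m (Q *m D)^T.
  apply: trmx_inj; rewrite !trmx_mul !trmxK.
  by rewrite !mulmxA CQ mulNmx -(mulmxA Q) AD mulmxN opprK mulmxA.
have DQX k : (D *m Q) ^+ k.+1 = D *m (Q *m D) ^+ k *m Q.
  elim: k => [|k IH]; first by rewrite expr1 expr0 mulmx1.
  by rewrite exprS IH -mulmxE exprS -mulmxE !mulmxA.
case: (uniserial_local uC cQD) => [uQD | /nilpotent_mx_tr]; last first.
  rewrite trmxK => -[k QDk].
  have nDQ : nilpotent_mx (D *m Q) by exists k.+1; rewrite DQX QDk mulmx0 mul0mx.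
  by have := nilpotent_mx_nonunit (uniserial_gt0 uA) nDQ; rewrite uDQ.
rewrite unitmx_tr in uQD.
have QR : Q *m (D *m invmx (Q *m D)) = 1%:M by rewrite mulmxA mulmxV.
have LQ : invmx (D *m Q) *m D *m Q = 1%:M by rewrite -mulmxA mulVmx.
exists (D *m invmx (Q *m D)); split=> //.
suff <- : invmx (D *m Q) *m D = D *m invmx (Q *m D) by [].
by rewrite -[LHS]mulmx1 -QR (mulmxA _ Q) LQ mul1mx.
Qed.

Lemma sum_nonunit_nilpotent n (A : 'M[F]_n) (I : finType) (P : pred I)
    (T : I -> 'M[F]_n) :
  uniserial A -> (forall i, P i -> T i *m A = A *m T i /\ T i \notin unitmx) ->
  nilpotent_mx (\sum_(i | P i) T i).
Proof.
move=> uA TP.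
suff [] : nilpotent_mx (\sum_(i | P i) T i) /\
    (\sum_(i | P i) T i) *m A = A *m (\sum_(i | P i) T i) by [].
apply: (big_ind (fun M => nilpotent_mx M /\ M *m A = A *m M)).
- by split; [exists 1%N; rewrite expr1 | rewrite mul0mx mulmx0].
- move=> M M' [nM cM] [nM' cM']; split; last by rewrite mulmxDl mulmxDr cM cM'.
  by apply: nilpotent_mxD => //; exact: (uniserial_comm uA).
move=> i /TP [cT nT]; split=> //.
by case: (uniserial_local uA cT) nT => // ->.
Qed.

End LocalRing.

Section KrullSchmidt.
Local Open Scope ring_scope.
Variables (R : realType) (N m : nat) (A w : 'M[R]_N) (b : 'I_m -> jblock R).
Hypotheses (skw : w^T = - w) (Aw : A^T *m w = - (w *m A)).
Hypothesis vb : forall i, jblock_valid (b i).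

Local Notation basis := (forall i, 'M[R]_(N, jblock_dim (b i))).

(** Let v = EB e span the radical of w, and let G be a pseudo-inverse of w:
    U G w = U as soon as U v = 0.  The rows F x are coordinates along the block
    x.  Expanding F x E y = F x G w E y over the blocks, with B replaced by its
    quotient by v, writes the identity (for y = x) or zero (for y <> x) as a sum
    of products of intertwiners, because G intertwines modulo v.  In the local
    centraliser of block x a sum is invertible only if a term is, and a term
    is invertible only if its Gram factor is; so the factor with the quotient of
    B is the invertible one.  Two different x and y would both be isomorphic to
    the dual of this quotient, and the expansion of zero would then have
    exactly one invertible term. *)
Lemma degenerate_partner_unique (E : basis)
    (F : forall i, 'M[R]_(jblock_dim (b i), N)) (S : {set 'I_m}) j
    (B : jblock R) (EB : 'M[R]_(N, jblock_dim B)) (FB : 'M[R]_(jblock_dim B, N))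
    (e : 'cV[R]_(jblock_dim B)) k :
  (forall i, A *m E i = E i *m jblock_mx (b i)) ->
  (forall i, i != j -> F i *m A = jblock_mx (b i) *m F i) ->
  (forall i, i != j -> F i *m E i = 1%:M) ->
  (forall i l, i != j -> l != j -> i != l -> F i *m E l = 0) ->
  (forall i, i != j -> F i *m EB = 0) ->
  A *m EB = EB *m jblock_mx B -> FB *m A = jblock_mx B *m FB ->
  FB *m EB = 1%:M -> \sum_(i | i != j) E i *m F i + EB *m FB = 1%:M ->
  jblock_valid B -> e != 0 -> jblock_mx B *m e = k *: e -> w *m (EB *m e) = 0 ->
  (kermx w <= (EB *m e)^T)%MS ->
  (forall x y, x \in S -> y \in S -> ~ mxiso (gram w E x y)) ->
  (forall x y, x \notin S -> y \in S -> gram w E x y = 0) ->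
  (forall x, x \in S -> x != j ->
     (jblock_dim (b x)).+1 = jblock_dim B /\
     (forall y : 'cV_(jblock_dim (b x)), EB^T *m w *m E x *m y = 0 -> y = 0)) /\
  (forall x y, x \in S -> y \in S -> x != j -> y != j -> x = y).
Proof.
move=> AE FA FE1 FE0 FEB AB FBA FBEB sum1 vB e0 Ae wEe kerw niso g0.
case: B EB FB e vB AB FBA FBEB sum1 FEB e0 Ae wEe kerw => [[|h] l|[|n] a c] EB FB e vB;
  rewrite /= in EB FB e vB * => AB FBA FBEB sum1 FEB e0 Ae wEe kerw;
    [by [] | | by case: vB | ]; last first.
  by case: vB => _ /(complex_jordan_block_uniserial n a) [_ /(_ _ _ Ae)] e0';
    rewrite e0' eqxx in e0.
have [_ [c ec]] := real_block_eigenvector Ae e0.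
have c0 : c != 0 by apply: contraNneq e0 => c0; rewrite ec c0 scale0r.
have wv0 : w *m (EB *m delta_mx 0 (0 : 'I_1)) = 0.
  by apply/eqP; have /eqP := wEe; rewrite ec -!scalemxAr scaler_eq0 (negPf c0).
have kerv : (kermx w <= (EB *m delta_mx 0 (0 : 'I_1))^T)%MS.
  by apply: (submx_trans kerw); rewrite ec -scalemxAr linearZ /= scalemx_sub.
move: EB FB AB FBA FBEB sum1 FEB wv0 kerv {Ae e0 ec wEe kerw e c0 vB}.
rewrite -[h.+1]/(1 + h)%N => EB FB AB FBA FBEB sum1 FEB wv kerv.
pose v := lsubmx EB; pose E' := rsubmx EB; pose F' := dsubmx FB.
have vE : EB *m delta_mx 0 (0 : 'I_1) = v.
  apply/matrixP => i i'; rewrite -colE !mxE.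
  by congr (EB _ _); apply: val_inj; rewrite ord1.
rewrite vE in wv kerv.
have EBE : EB = row_mx v E' by rewrite hsubmxK.
have vw : v^T *m w = 0 by rewrite -[w]opprK -skw mulmxN -trmx_mul wv trmx0 oppr0.
have [Av AE'] : A *m v = l *: v /\ A *m E' = v *m first_row R h + E' *m real_jordan_block h l.
  move: AB; rewrite real_jordan_block_recl {1 2}EBE mul_mx_row mul_row_block !mulmx0 addr0.
  by rewrite mul_mx_scalar => /eq_row_mx.
have F'A : F' *m A = real_jordan_block h l *m F'.
  move: FBA; rewrite real_jordan_block_recl -{1 2}[FB]vsubmxK mul_col_mx mul_block_col.
  by rewrite mul0mx add0r => /eq_col_mx [].
have F'v : F' *m v = 0.
  move: FBEB; rewrite -[FB]vsubmxK EBE mul_col_row scalar_mx_block => /eq_block_mx [_ _ + _].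
  by [].
have Fv i : i != j -> F i *m v = 0.
  by move=> /FEB; rewrite EBE mul_mx_row -[0]hsubmxK !linear0 => /eq_row_mx [].
have sum1' : \sum_(i | i != j) (F i)^T *m (E i)^T *m w + F'^T *m E'^T *m w = w.
  move/(congr1 (fun M => M^T *m w)): sum1; rewrite trmx1 mul1mx => sT; rewrite -[RHS]sT.
  rewrite [(_ + _)^T]linearD /= mulmxDl linear_sum /= mulmx_suml; congr (_ + _).
    by apply: eq_bigr => i _; rewrite trmx_mul.
  rewrite -[FB]vsubmxK EBE mul_row_col linearD /= !trmx_mul mulmxDl.
  by rewrite -(mulmxA _ v^T) vw mulmx0 add0r.
have [G GE] : exists G : 'M[R]_N, forall p (U : 'M_(p, N)), U *m v = 0 -> U *m G *m w = U.
  exists (pinvmx w) => p U Uv; apply: mulmxKpV.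
  rewrite submxE; apply/eqP.
  have : (w *m (cokermx w) = 0) by exact: mulmx_coker.
  move=> wc; have : ((cokermx w)^T <= kermx w)%MS.
    apply/sub_kermxP/trmx_inj; by rewrite trmx_mul trmxK skw mulNmx wc oppr0 trmx0.
  move=> /submx_trans/(_ kerv)/submxP [z zE].
  by rewrite -[cokermx w]trmxK zE trmx_mul trmxK mulmxA Uv mul0mx.
have kerU p (U : 'M_(p, N)) : U *m w = 0 -> exists z, U = z *m v^T.
  by move=> /sub_kermxP /submx_trans/(_ kerv)/submxP.
have dualD x d (P : 'M[R]_(d, N)) (C : 'M_d) : x != j -> P *m v = 0 -> P *m A = C *m P ->
    jblock_mx (b x) *m (F x *m G *m P^T) = - (F x *m G *m P^T *m C^T).
  move=> xj Pv PA.
  have [z zE] : exists z, F x *m A *m G + F x *m G *m A^T = z *m v^T.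
    apply: kerU; rewrite mulmxDl GE; last by rewrite -mulmxA Av -scalemxAr Fv // scaler0.
    by rewrite -(mulmxA _ A^T) Aw mulmxN mulmxA GE ?Fv // subrr.
  have : z *m v^T *m P^T = 0 by rewrite -mulmxA -trmx_mul Pv trmx0 mulmx0.
  rewrite -zE mulmxDl -(mulmxA _ A^T) -trmx_mul PA trmx_mul FA // !mulmxA.
  by move=> /eqP; rewrite addr_eq0 => /eqP.
have dualQ x y : (jblock_mx (b x))^T *m gram w E x y = - (gram w E x y *m jblock_mx (b y)).
  rewrite /gram !mulmxA -trmx_mul -AE trmx_mul -(mulmxA (E x)^T A^T) Aw.
  by rewrite mulmxN mulNmx -!mulmxA AE.
pose Q' x := E'^T *m w *m E x.
have dualQ' x : (real_jordan_block h l)^T *m Q' x = - (Q' x *m jblock_mx (b x)).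
  have JE : (real_jordan_block h l)^T *m E'^T = (A *m E')^T - (v *m first_row R h)^T.
    by rewrite AE' -linearB /= addrC addKr trmx_mul.
  rewrite /Q' !mulmxA JE !mulmxBl !trmx_mul -!mulmxA (mulmxA A^T) Aw (mulmxA v^T) vw.
  by rewrite mul0mx mulmx0 subr0 -AE mulNmx mulmxN !mulmxA.
have sumid x y : x != j ->
    F x *m E y = \sum_(i | i != j) (F x *m G *m (F i)^T) *m gram w E i y
                 + (F x *m G *m F'^T) *m Q' y.
  move=> xj; rewrite -{1}(GE _ (F x) (Fv x xj)) -{1}sum1' mulmxDr mulmxDl.
  rewrite mulmx_sumr mulmx_suml; congr (_ + _).
    by apply: eq_bigr => i _; rewrite /gram !mulmxA.
  by rewrite /Q' !mulmxA.
have uni x := jblock_uniserial (vb x).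
have uD x : x \in S -> x != j -> (F x *m G *m F'^T) *m Q' x \in unitmx.
  move=> xS xj; have := sumid x x xj; rewrite FE1 // => /eqP.
  rewrite addrC -subr_eq => /eqP <-; apply/unitmx_1Dnilpotent/nilpotent_mxN.
  apply: (sum_nonunit_nilpotent (uni x)) => i ij.
  have dD := dualD x _ _ _ xj (Fv i ij) (FA i ij).
  rewrite /=; split; first by rewrite -(mulmxA _ (gram w E i x)) -[gram w E i x *m _]opprK
    -dualQ mulmxN [RHS]mulmxA dD mulNmx !mulmxA.
  apply/negP => uDQ; have [iS | iS] := boolP (i \in S); last first.
    move: uDQ; rewrite g0 // mulmx0; apply/negP.
    by apply: (nilpotent_mx_nonunit (uniserial_gt0 (uni x))); exists 1%N; rewrite expr1.
  apply: (niso i x) => //.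
  exact: (mxiso_of_unit_factor (uni x) (uni i) dD (dualQ i x) uDQ).
have isoQ' x : x \in S -> x != j -> mxiso (Q' x).
  move=> xS xj; have uDx := uD x xS xj.
  have dD' := dualD x _ _ _ xj F'v F'A.
  case: (posnP h) => [h0 | h_gt0]; last first.
    have uh : uniserial (real_jordan_block h l).
      by apply: (@jblock_uniserial _ (RealBlock h l)).
    exact: (mxiso_of_unit_factor (uni x) uh dD' (dualQ' x) uDx).
  have : (F x *m G *m F'^T) *m Q' x = 0.
    apply/matrixP => i i'; rewrite !mxE big1 // => -[q qh] _.
    by exfalso; move: (qh); rewrite h0.
  move=> D0; move: uDx; rewrite D0 => /negP[]; apply/negP.
  by apply: (nilpotent_mx_nonunit (uniserial_gt0 (uni x))); exists 1%N; rewrite expr1.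
split=> [x xS xj | x y xS yS xj yj].
  have iQ := isoQ' x xS xj; split; first by rewrite -(mxiso_dim iQ).
  move=> y; rewrite EBE tr_row_mx !mul_col_mx vw !mul0mx.
  move=> /(congr1 (@dsubmx _ 1 h _)); rewrite col_mxKd linear0;
  rewrite -/(Q' x); have [Y [YQ _]] := iQ.
  by move=> /(congr1 (mulmx Y)); rewrite mulmxA YQ mul1mx mulmx0.
apply/eqP; apply/negPn/negP => xy.
have [Qi [QiQ QQi]] := isoQ' x xS xj.
(* Th identifies the blocks y and x through the quotient of B. *)
have [Th [ThE iTh cTh]] : exists Th, [/\ Q' x *m Th = Q' y, mxiso Th &
    jblock_mx (b x) *m Th = Th *m jblock_mx (b y)].
  exists (Qi *m Q' y); split; first by rewrite mulmxA QQi mul1mx.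
    by apply: mxisoM; [exists (Q' x) | exact: isoQ'].
  have -> : jblock_mx (b x) *m (Qi *m Q' y) = Qi *m (Q' x *m jblock_mx (b x)) *m (Qi *m Q' y).
    by rewrite (mulmxA Qi (Q' x)) QiQ mul1mx.
  rewrite -[Q' x *m _]opprK -dualQ' mulmxN mulNmx (mulmxA Qi (_^T)).
  rewrite -(mulmxA _ (Q' x)) (mulmxA (Q' x) Qi) QQi mul1mx -(mulmxA Qi) dualQ' mulmxN opprK.
  exact: mulmxA.
have yx : y != x by rewrite eq_sym.
have := sumid y x yj; rewrite (FE0 y x) // => /(congr1 (mulmxr Th)) /=.
rewrite mul0mx mulmxDl -(mulmxA _ (Q' x)) ThE mulmx_suml => /esym/eqP.
rewrite addr_eq0 => /eqP sumE.
have nS : nilpotent_mx (\sum_(i | i != j) (F y *m G *m (F i)^T) *m gram w E i x *m Th).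
  apply: (sum_nonunit_nilpotent (uni y)) => i ij.
  have dD := dualD y _ _ _ yj (Fv i ij) (FA i ij).
  have dQ : (jblock_mx (b i))^T *m (gram w E i x *m Th) =
      - (gram w E i x *m Th *m jblock_mx (b y)).
    by rewrite mulmxA dualQ mulNmx -!mulmxA cTh.
  rewrite /= -(mulmxA _ (gram w E i x)); split.
    by rewrite -(mulmxA _ (gram w E i x *m Th)) -[gram w E i x *m Th *m _]opprK -dQ mulmxN
      [RHS]mulmxA dD mulNmx !mulmxA.
  apply/negP => uDQ; have [iS | iS] := boolP (i \in S); last first.
    move: uDQ; rewrite g0 // mul0mx mulmx0; apply/negP.
    by apply: (nilpotent_mx_nonunit (uniserial_gt0 (uni y))); exists 1%N; rewrite expr1.
  apply: (niso i x) => //.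
  have iQT := mxiso_of_unit_factor (uni y) (uni i) dD dQ uDQ.
  have [Ti [TiT TTi]] := iTh.
  rewrite -[gram w E i x]mulmx1 -TTi mulmxA; apply: mxisoM => //.
  by exists Th.
have := nilpotent_mx_nonunit (uniserial_gt0 (uni y)) (nilpotent_mxN nS).
by rewrite sumE opprK uD.
Qed.

End KrullSchmidt.

(** * Existence of a matching Jordan basis *)

Section Matching.
Local Open Scope ring_scope.
Variables (R : realType) (N m : nat) (A w : 'M[R]_N) (b : 'I_m -> jblock R).
Hypotheses (skw : w^T = - w) (Aw : A^T *m w = - (w *m A)).
Hypothesis vb : forall i, jblock_valid (b i).
Hypothesis N_dim : N = (\sum_i jblock_dim (b i))%N.
Hypothesis corank_w : (N <= (\rank w).+1)%N.

Local Notation basis := (forall i, 'M[R]_(N, jblock_dim (b i))).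

Lemma jordan_frame_dual (E : basis) : jordan_frame A E ->
  exists F : forall i, 'M[R]_(jblock_dim (b i), N),
  [/\ \sum_i E i *m F i = 1%:M, forall i, F i *m E i = 1%:M,
      forall i k, i != k -> F i *m E k = 0 &
      forall i, F i *m A = jblock_mx (b i) *m F i].
Proof.
move=> [AE fE]; pose B := \mxrow_i E i.
have /row_freeP [G BG] : row_free B.
  rewrite -kermx_eq0; apply/rowV0P => u /sub_kermxP; rewrite mul_mxrow => uB.
  by apply: fE => i; rewrite -(mxrowK (fun i => u *m E i)) uB submxrow0.
have GB : G *m B = 1%:M.
  by move: B G BG; rewrite -N_dim => B G; exact: mulmx1C.
have FE i k : submxcol G i *m E k =
    submxblock (\mxdiag_i (1%:M : 'M[R]_(jblock_dim (b i)))) i k.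
  by rewrite mxdiagZ submxblockEh -GB /B mul_mxrow mxrowK submxcol_mul.
have FE1 i : submxcol G i *m E i = 1%:M by rewrite FE submxblock_diag.
have FE0 i k : i != k -> submxcol G i *m E k = 0.
  by move=> ik; rewrite FE /mxdiag mxblockK (negPf ik).
have sum1 : \sum_i E i *m submxcol G i = 1%:M.
  by rewrite -mul_mxrow_mxcol submxcolK BG.
exists (fun i => submxcol G i); split=> // i.
rewrite -[LHS]mulmx1 -[RHS]mulmx1 -sum1 !mulmx_sumr; apply: eq_bigr => k _.
rewrite !mulmxA -(mulmxA _ A) AE mulmxA -(mulmxA (jblock_mx _)).
have [-> | ik] := eqVneq i k; first by rewrite FE1 mul1mx mulmx1.
by rewrite FE0 // mulmx0 !mul0mx.
Qed.

(** An intertwiner that is not an isomorphism and whose source is at least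
    as large as its target has a kernel, hence kills the socle of the source.
    For the largest remaining block j this applies to all its Gram blocks, and
    the socle of j spans the radical of w. *)
Lemma degenerate_step (S : {set 'I_m}) (E : basis) i0 :
  partial_matching A w S E -> i0 \in S ->
  (forall i j, i \in S -> j \in S -> ~ mxiso (gram w E i j)) ->
  exists E' : basis, partial_matching A w finset.set0 E'.
Proof.
move=> mE i0S niso; have [frE stE] := mE; have [AE fE] := frE.
have [F [sum1 FE1 FE0 FA]] := jordan_frame_dual frE.
have [j jS jmax] : exists2 j, j \in S &
    forall i, i \in S -> (jblock_dim (b i) <= jblock_dim (b j))%N.
  by case: (arg_maxnP (fun i => jblock_dim (b i)) i0S) => j jS jmax; exists j.
have g0 x y : x \notin S -> y \in S -> gram w E x y = 0.
  by move=> xS yS; exact: (settled_gram0 (stE x xS)).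
have [e e0 soc] := uniserial_socle (jblock_uniserial (vb j)).
have ge i : gram w E i j *m e = 0.
  have [iS | iS] := boolP (i \in S); last by rewrite g0 // mul0mx.
  apply: soc; last exact: not_mxiso_kernel (jmax i iS) (niso i j iS jS).
  by move=> x gx; rewrite mulmxA -[gram w E i j *m _]opprK -(gram_dual Aw i j frE) mulNmx
    -mulmxA gx mulmx0 oppr0.
pose v := E j *m e.
have v0 : v != 0.
  by apply: contraNneq e0 => v0; rewrite -[e]mul1mx -(FE1 j) -mulmxA -/v v0 mulmx0.
have wv : w *m v = 0.
  apply: trmx_inj; rewrite trmx0; apply: fE => i; apply: trmx_inj.
  by rewrite trmx_mul trmxK trmx0 /v !mulmxA ge.
have vw : v^T *m w = 0 by apply: trmx_inj; rewrite trmx_mul trmxK skw mulNmx wv oppr0 trmx0.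
(* The corank bound makes the line of v the whole radical. *)
have kerw : (kermx w <= v^T)%MS.
  have vk : (v^T <= kermx w)%MS by apply/sub_kermxP.
  rewrite -(mxrank_leqif_sup vk) eqn_leq mxrankS //= mxrank_ker.
  have : (0 < \rank v^T)%N by rewrite lt0n mxrank_eq0 -trmx0 (inj_eq trmx_inj).
  by apply: leq_trans; rewrite leq_subLR addn1.
have [k Ae] : exists k, jblock_mx (b j) *m e = k *: e.
  have : ((A *m v)^T <= v^T)%MS.
    apply: submx_trans kerw; apply/sub_kermxP.
    by rewrite trmx_mul -mulmxA Aw mulmxN mulmxA vw mul0mx oppr0.
  move=> /sub_rVP [k kE]; exists k.
  have Av : A *m v = k *: v by apply: trmx_inj; rewrite kE linearZ.
  by rewrite -[LHS]mul1mx -(FE1 j) -mulmxA (mulmxA (E j)) -AE -mulmxA -/v Av -scalemxAr mulmxA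
    FE1 mul1mx.
have [part uniq] : (forall x, x \in S -> x != j ->
     (jblock_dim (b x)).+1 = jblock_dim (b j) /\
     (forall y : 'cV_(jblock_dim (b x)), (E j)^T *m w *m E x *m y = 0 -> y = 0)) /\
  (forall x y, x \in S -> y \in S -> x != j -> y != j -> x = y).
  apply: (degenerate_partner_unique skw Aw vb AE _ _ _ _ (AE j) (FA j) (FE1 j) _
     (vb j) e0 Ae wv kerw niso g0) => //.
  - by move=> i l _ _ il; exact: FE0.
  - by move=> i ij; exact: FE0.
  - by rewrite -sum1 [RHS](bigD1 j) //= addrC.
have [/existsP [x /andP [xS xj]] | noS] := boolP [exists x, (x \in S) && (x != j)].
  have [dxj injx] := part x xS xj.
  have nW : (E x)^T *m w *m E x \notin unitmx.
    by apply/negP => /mxiso_unit; exact: niso.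
  have [Ej [Ex [[AEj AEx] fjx wjx [gjj gxx] [mjx mxj]]]] := degenerate_pair_normal_form
    skw Aw (vb j) (vb x) (AE j) (AE x) e0 Ae wv dxj injx nW.
  have SE y : y \in S -> y != j -> y = x by move=> yS yj; exact: uniq.
  exists (dfwith (dfwith E Ej) Ex); set E' := dfwith _ _.
  have E'x : E' x = Ex by exact: dfwith_in.
  have E'j : E' j = Ej by rewrite /E' dfwith_out // dfwith_in.
  have E'k y : y != j -> y != x -> E' y = E y.
    by move=> yj yx; rewrite /E' !dfwith_out // eq_sym.
  have E'S y : y \notin S -> E' y = E y.
    by move=> yS; apply: E'k; apply: contraNneq yS => ->.
  have wS y : y \notin S -> (E y)^T *m w *m Ej = 0 /\ (E y)^T *m w *m Ex = 0.
    by move=> yS; apply: wjx; exact: g0.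
  have SC y : y != j -> y != x -> y \notin S.
    by move=> yj yx; apply/negP => /SE /(_ yj) /eqP; rewrite (negPf yx).
  have wC n (V : 'M_(N, n)) y : (E y)^T *m w *m V = 0 -> V^T *m w *m E y = 0.
    by move=> VE; apply: trmx_inj; rewrite !trmx_mul trmxK skw mulNmx mulmxN mulmxA VE oppr0
      trmx0.
  rewrite -(finset.setDv S); apply: (partial_matching_update mE) => //.
  - split=> [y | u uE'].
      have [-> | yj] := eqVneq y j; first by rewrite E'j.
      have [-> | yx] := eqVneq y x; first by rewrite E'x.
      by rewrite E'k.
    have [uj ux] : u *m E j = 0 /\ u *m E x = 0 by apply: fjx; rewrite -?E'j -?E'x.
    apply: fE => y; have [-> // | yj] := eqVneq y j; have [-> // | yx] := eqVneq y x.
    by rewrite -(E'k y).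
  - move=> y z yS zS; have [-> | zj] := eqVneq z j; first by rewrite E'j; case: (wS y yS).
    by rewrite (SE z) // E'x; case: (wS y yS).
  move=> y yS; have [-> | yj] := eqVneq y j.
    exists x; split=> // [z zx | ]; last by rewrite /gram E'j E'x.
    have [-> | zj] := eqVneq z j; first by rewrite /gram E'j.
    by rewrite /gram E'j E'k //; apply: wC; case: (wS z (SC z zj zx)).
  rewrite (SE y yS yj); exists j; split=> // [z zj | ]; last by rewrite /gram E'j E'x.
  have [-> | zx] := eqVneq z x; first by rewrite /gram E'x.
  by rewrite /gram E'x E'k //; apply: wC; case: (wS z (SC z zj zx)).
have SE y : y \in S -> y = j.
  by move=> yS; apply/eqP/negPn/negP => yj; case/existsP: noS; exists y; rewrite yS.
have kerg (x : 'cV_(jblock_dim (b j))) : gram w E j j *m x = 0 <-> exists c, x = c *: e.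
  split=> [gx | [c ->]]; last by rewrite -scalemxAr ge scaler0.
  have : ((E j *m x)^T <= kermx w)%MS.
    apply/sub_kermxP; apply: fE => i; apply: trmx_inj; rewrite trmx0 !trmx_mul !trmxK skw.
    rewrite mulNmx mulmxN !mulmxA -/(gram w E i j).
    have [/SE -> | iS] := boolP (i \in S); first by rewrite gx oppr0.
    by rewrite g0 // mul0mx oppr0.
  move=> /submx_trans/(_ kerw)/sub_rVP [c cE]; exists c.
  have Ex : E j *m x = c *: v by apply: trmx_inj; rewrite cE linearZ.
  by rewrite -[x]mul1mx -(FE1 j) -mulmxA Ex -scalemxAr mulmxA FE1 mul1mx.
have [g [ug cg mg]] := degenerate_block_normal_form (vb j) (gram_tr skw E j j)
  (gram_dual Aw j j frE) e0 kerg.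
exists (dfwith E (E j *m g)); set E' := dfwith _ _.
have E'j : E' j = E j *m g by exact: dfwith_in.
have E'k y : y != j -> E' y = E y.
  by move=> yj; rewrite /E' dfwith_out // eq_sym.
have jC y : y != j -> y \notin S by apply: contraNN => /SE ->.
rewrite -(finset.setDv S); apply: (partial_matching_update mE) => //.
- split=> [y | u uE'].
    have [-> | yj] := eqVneq y j; first by rewrite E'j mulmxA AE -!mulmxA cg.
    by rewrite E'k.
  apply: fE => y; have [-> | yj] := eqVneq y j; last by rewrite -E'k.
  have := uE' j; rewrite E'j mulmxA => /(congr1 (mulmxr (invmx g))).
  by rewrite /= mulmxK // mul0mx.
- by move=> y yS; apply: E'k; apply: contraNneq yS => ->.
- by move=> y z yS /SE ->; rewrite E'j mulmxA -/(gram w E y j) g0 // mul0mx.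
move=> y /SE ->; exists j; split=> // [z zj | ].
  rewrite /gram E'j E'k // trmx_mul -2!(mulmxA g^T) -/(gram w E j z).
  by rewrite (gram_eq0C skw (g0 z j (jC z zj) jS)) mulmx0.
by rewrite /gram E'j trmx_mul !mulmxA; move: mg; rewrite /gram !mulmxA.
Qed.

Lemma matching_frame (S : {set 'I_m}) (E : basis) : partial_matching A w S E ->
  exists E' : basis, partial_matching A w finset.set0 E'.
Proof.
have [n] := ubnP #|S|; elim: n S E => // n IH S E Sn mE.
have [S0 | [i0 i0S]] := set_0Vmem S; first by exists E; rewrite -S0.
(* Each pivot settles at least one block. *)
have smaller (P : {set 'I_m}) i : i \in P -> i \in S -> (#|S :\: P| < n)%N.
  move=> iP iS; apply: leq_trans (_ : #|S :\ i| < n)%N.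
    by rewrite ltnS subset_leq_card // finset.setDS // finset.sub1set.
  by move: Sn; rewrite (cardsD1 i S) iS.
have [[i [iS ui]] | nself] := pselect (exists i, i \in S /\ gram w E i i \in unitmx).
  have [E' mE'] := split_self_dual skw Aw vb mE iS ui.
  by apply: (IH _ E' _ mE'); apply: (smaller _ i) => //; rewrite inE.
have nu i : i \in S -> gram w E i i \notin unitmx.
  by move=> iS; apply/negP => ui; apply: nself; exists i.
have [[i [j [iS jS gij]]] | npair] :=
  pselect (exists i j, [/\ i \in S, j \in S & mxiso (gram w E i j)]).
  have ij : i != j.
    by apply: contraTneq (nu i iS) => e; move: gij; rewrite -e negbK => /mxiso_unit.
  have [E' mE'] := split_dual_pair skw Aw vb mE iS jS ij gij (nu j jS).
  by apply: (IH _ E' _ mE'); apply: (smaller _ i) => //; rewrite !inE eqxx.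
by apply: (degenerate_step mE i0S) => i j iS jS gij; apply: npair; exists i, j.
Qed.

End Matching.

Section JordanMatching.
Local Open Scope ring_scope.
Variable R : realType.

Lemma monomial_mxrow N m (w : 'M[R]_N) (b : 'I_m -> jblock R)
    (E : forall i, 'M[R]_(N, jblock_dim (b i))) :
  (forall i, settled w finset.set0 E i) ->
  monomial_rows ((\mxrow_i E i)^T *m w *m \mxrow_i E i).
Proof.
move=> stE; have -> : (\mxrow_i E i)^T *m w *m \mxrow_i E i = \mxblock_(i, j) gram w E i j.
  by rewrite tr_mxrow mxcol_mul mul_mxcol_mxrow.
move=> x; have [j [_ g0 mj]] := stE (tagnat.sig1 x).
have [m1 m2] := mj (tagnat.sig2 x).
have supp y : (\mxblock_(i, j) gram w E i j) x y != 0 ->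
    exists y', y = @tagnat.Rank _ (fun i => jblock_dim (b i)) j y' /\
      (\mxblock_(i, j) gram w E i j) x y = gram w E (tagnat.sig1 x) j (tagnat.sig2 x) y'.
  rewrite mxE; have [e | ne] := eqVneq (tagnat.sig1 y) j; last by rewrite (g0 _ ne) mxE eqxx.
  move: (tagnat.sig1 y) e (tagnat.sig2 y) (tagnat.sig2K y) => z ->.
  by move=> y' <- _; exists y'.
split=> [y | y z ny nz].
  have [/eqP -> | /supp [y' [_ ->]]] := boolP ((\mxblock_(i, j) gram w E i j) x y == 0).
    by rewrite inE eqxx.
  exact: m1.
have [y' [yE ye]] := supp y ny; have [z' [zE ze]] := supp z nz.
by rewrite yE zE (m2 y' z') -?ye -?ze.
Qed.

(** The Jordan basis of the standard basis vectors is the starting point, with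
    no block settled; the final basis is the matrix g. *)
Lemma jordan_block_matching (Bs : seq (jblock R)) (w : 'M[R]_(jblocks_dim Bs)) :
  (forall k, jblock_valid (tnth (in_tuple Bs) k)) -> w^T = - w ->
  (jblocks_mx Bs)^T *m w = - (w *m jblocks_mx Bs) ->
  (jblocks_dim Bs <= (\rank w).+1)%N ->
  exists g : 'M[R]_(jblocks_dim Bs),
  [/\ g \in unitmx, g *m jblocks_mx Bs = jblocks_mx Bs *m g &
      monomial_rows (g^T *m w *m g)].
Proof.
move=> vB skw Aw rkw; pose b k := tnth (in_tuple Bs) k.
pose I1 : 'M[R]_(jblocks_dim Bs) := 1%:M.
pose E0 (k : 'I_(size Bs)) : 'M_(jblocks_dim Bs, jblock_dim (b k)) := submxrow I1 k.
have E0E : \mxrow_k E0 k = 1%:M by exact: submxrowK.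
have mE0 : partial_matching (jblocks_mx Bs) w [set: 'I_(size Bs)] E0.
  split; last by move=> i; rewrite inE.
  split=> [k | u uE0]; last first.
    rewrite -[u]mulmx1 -E0E mul_mxrow -[RHS](mxrow0 (q_ := fun k => jblock_dim (b k))).
    by apply: eq_mxrow => k; exact: uE0.
  rewrite mul_submxrow mulmx1 -[jblocks_mx Bs]mul1mx -E0E.
  by rewrite mul_mxrow_mxdiag mxrowK.
have [E [[AE fE] stE]] := matching_frame skw Aw vB erefl rkw mE0.
exists (\mxrow_k E k); split.
- rewrite -row_free_unit -kermx_eq0; apply/rowV0P => u /sub_kermxP; rewrite mul_mxrow => uB.
  by apply: fE => i; rewrite -(mxrowK (fun i => u *m E i)) uB submxrow0.
- by rewrite mul_mxrow mul_mxrow_mxdiag; apply: eq_mxrow => k; rewrite AE.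
by apply: monomial_mxrow => i; apply: stE; rewrite inE.
Qed.

End JordanMatching.

(** * Signed matchings as permuted canonical forms *)

Section PermutedCanonicalForm.
Local Open Scope ring_scope.
Variable R : realType.

Lemma omega0E N d (i j : 'I_N.+1) : N.+1 = d.*2 ->
  omega0 R N i j = (j == i + d :> nat)%N%:R - (i == j + d :> nat)%N%:R.
Proof.
move=> Nd; have d2 : N.+1./2 = d by rewrite Nd doubleK.
rewrite /omega0 summxE.
under eq_bigr do rewrite !mxE.
rewrite sumrB d2.
have half (a b : 'I_N.+1) :
    \sum_(t < d) ((a == inord t) && (b == inord (d + t)))%:R = (b == a + d :> nat)%N%:R :> R.
  have ht (t : 'I_d) : (t < N.+1)%N /\ (d + t < N.+1)%N by have := ltn_ord t; lia.
  have [ad | da] := ltnP a d.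
    rewrite (bigD1 (Ordinal ad)) //= big1 ?addr0 => [|t ta]; last first.
      have [t1 _] := ht t; rewrite -val_eqE /= inordK //.
      have /negPf -> : (a != t :> nat) by apply: contra ta => /eqP e; apply/eqP/val_inj.
      by [].
    by have [t1 t2] := ht (Ordinal ad); rewrite -!val_eqE /= !inordK // eqxx addnC.
  rewrite big1 => [|t _]; last first.
    have [t1 _] := ht t; rewrite -val_eqE /= inordK //.
    by have /negPf -> : (a != t :> nat) by have := ltn_ord t; lia.
  by have /negPf -> : (b != a + d :> nat)%N by have := ltn_ord b; lia.
rewrite half; congr (_ - _); rewrite -half; apply: eq_bigr => t _.
by rewrite andbC.
Qed.

Lemma form_act_perm N (s : 'S_N) (M : 'M[R]_N.+1) i j :
  form_act (lift0_mx (perm_mx s)) M i j = M (lift0_perm s i) (lift0_perm s j).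
Proof.
rewrite /form_act lift0_mx_perm; set t := lift0_perm s.
have -> : invmx (perm_mx t) = perm_mx t^-1%g :> 'M[R]_N.+1 by rewrite perm_mxV.
by rewrite tr_perm_mx invgK -row_permE -col_permE !mxE.
Qed.

(** Permutations fixing 0 are the lifts of permutations of the other
    indices. *)
Lemma lift0_perm_of N (t : 'S_N.+1) : t 0 = 0 -> exists s : 'S_N, lift0_perm s = t.
Proof.
move=> t0.
have tl j : exists k, t (lift 0 j) = lift 0 k.
  case: (unliftP 0 (t (lift 0 j))) => [k ->|e]; first by exists k.
  by have /perm_inj/(congr1 val) := etrans e (esym t0).
have [f fE] := choice tl.
have f_inj : injective f.
  move=> i j fij; apply: (@lift_inj _ 0); apply: (@perm_inj _ t).
  by rewrite !fE fij.
exists (perm f_inj); apply/permP => i; rewrite /lift0_perm.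
case: (unliftP 0 i) => [j|] ->; last by rewrite lift_perm_id t0.
by rewrite lift_perm_lift permE fE.
Qed.

(** K pairs each index i with a unique index tau i, and exactly one index of
    each pair, an element of A, carries the sign +1.  Sending the elements of A
    to 0, ..., d - 1 in increasing order, and the partner of the k-th one to
    d + k, transports K to the canonical form.  The index 0 belongs to A and is
    its least element, so it stays fixed. *)
Lemma skew_monomial_permuted_omega0 N (K : 'M[R]_N.+1) (m : 'I_N.+1) :
  K^T = - K -> monomial_rows K -> K \in unitmx -> K 0 m = 1 ->
  exists s : 'S_N, K = form_act (lift0_mx (perm_mx s)) (omega0 R N).
Proof.
move=> skK mK uK K0m.
have skE i j : K j i = - K i j by have := congr1 (fun M : 'M_N.+1 => M i j) skK; rewrite !mxE.
have exT i : exists j, K i j != 0 := unitmx_row_neq0 i uK.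
have [tau tauP] := choice exT.
have tauU i j : K i j != 0 -> j = tau i.
  by move=> Kij; have [_ H] := mK i; exact: H.
have tauK i : tau (tau i) = i.
  by apply/esym/tauU; rewrite skE oppr_eq0.
pose A := [set i | K i (tau i) == 1].
have KA i : i \notin A -> K i (tau i) = -1.
  rewrite inE => Ki1; have [H _] := mK i; have := H (tau i).
  by rewrite !inE (negPf (tauP i)) (negPf Ki1) => /eqP.
have tauA i : (tau i \in A) = (i \notin A).
  have [iA | iA] := boolP (i \in A).
    rewrite inE tauK skE; move: iA; rewrite inE => /eqP ->.
    by apply/eqP => e; have := ltr01 (R:=R); rewrite -e; lra.
  by rewrite inE tauK skE KA // opprK eqxx.
pose d := #|A|.
have Nd : N.+1 = d.*2.
  have AC : ~: A = tau @: A.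
    apply/setP => i; rewrite inE; apply/idP/imsetP => [iA | [k kA ->]]; last first.
      by rewrite tauA kA.
    by exists (tau i); rewrite ?tauA // tauK.
  have := cardsC A; rewrite AC card_imset ?card_ord; last exact: can_inj tauK.
  by rewrite addnn.
pose idx i := index i (enum A).
have idxd i : i \in A -> (idx i < d)%N by rewrite /d cardE index_mem mem_enum.
have idx_inj i j : i \in A -> j \in A -> idx i = idx j -> i = j.
  move=> iA jA ij; rewrite -[i](nth_index i (s := enum A)) ?mem_enum //.
  by rewrite -/(idx i) ij nth_index ?mem_enum.
pose f0 i := if i \in A then idx i else (d + idx (tau i))%N.
have f0_lt i : (f0 i < N.+1)%N.
  rewrite /f0; case: ifP => [/idxd | /negbT]; first by lia.
  by rewrite -tauA => /idxd; lia.
pose f i : 'I_N.+1 := Ordinal (f0_lt i).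
have f0A i : i \in A -> f0 i = idx i by rewrite /f0 => ->.
have f0C i : i \in A -> f0 (tau i) = (d + idx i)%N.
  by move=> iA; rewrite /f0 tauA iA /= tauK.
have f_inj : injective f.
  move=> i j /(congr1 val) /= fij.
  have [iA | iA] := boolP (i \in A); have [jA | jA] := boolP (j \in A).
  - by apply: idx_inj => //; rewrite -!f0A.
  - rewrite -tauA in jA; move: fij; rewrite f0A // -{1}[j]tauK f0C // => e.
    by have := idxd i iA; rewrite e; lia.
  - rewrite -tauA in iA; move: fij; rewrite [RHS]f0A // -{1}[i]tauK f0C // => e.
    by have := idxd j jA; rewrite -e; lia.
  rewrite -!tauA in iA jA; move: fij; rewrite -[i]tauK -[j]tauK !f0C // => /addnI e.
  by rewrite (idx_inj _ _ iA jA e).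
have A0 : 0 \in A.
  by rewrite inE -(tauU 0 m) K0m // oner_neq0.
have f00 : f 0 = 0.
  apply: val_inj; rewrite /= f0A // /idx /enum_mem -enumT enum_ordSl /=.
  by rewrite (_ : ord0 \in mem A) //= eqxx.
have [s sE] : exists s : 'S_N, lift0_perm s = perm f_inj.
  by apply: lift0_perm_of; rewrite permE.
have om i j : i \in A -> omega0 R N (f i) (f j) = K i j.
  move=> iA; rewrite (omega0E _ _ Nd) /= (f0A i iA).
  have id := idxd i iA.
  have -> : (idx i == f0 j + d :> nat)%N = false by lia.
  rewrite subr0 addnC -f0C //.
  have [-> | jt] := eqVneq j (tau i).
    by rewrite eqxx; move: iA; rewrite inE => /eqP ->.
  have -> : (f0 j == f0 (tau i)) = false.
    by apply/eqP => e; case/eqP: jt; apply/(@f_inj j)/val_inj.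
  by apply/esym/eqP; apply: contraNT jt => /tauU ->.
have skO i j : omega0 R N i j = - omega0 R N j i.
  by rewrite !(omega0E _ _ Nd) opprB.
exists s; apply/matrixP => i j; rewrite form_act_perm sE !permE.
have [iA | iA] := boolP (i \in A); first by rewrite om.
have [jA | jA] := boolP (j \in A); first by rewrite skO om // -skE.
have -> : K i j = 0.
  by apply/eqP; apply: contraNT jA => /tauU ->; rewrite tauA.
rewrite (omega0E _ _ Nd) /= /f0 (negPf iA) (negPf jA).
have := idxd (tau i); have := idxd (tau j); rewrite !tauA => /(_ jA) jd /(_ iA) id.
have -> : (d + idx (tau j) == d + idx (tau i) + d :> nat)%N = false by lia.
have -> : (d + idx (tau i) == d + idx (tau j) + d :> nat)%N = false by lia.
by rewrite subr0.
Qed.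

End PermutedCanonicalForm.

(** * Multiples of automorphisms *)

Section ScaledAutomorphisms.
Local Open Scope ring_scope.
Local Open Scope classical_set_scope.
Variables (R : realType) (N : nat).
Variable br : {bilinear 'cV[R]_N.+1 -> 'cV[R]_N.+1 -> 'cV[R]_N.+1}.

Lemma lie_autM g h : lie_aut br g -> lie_aut br h -> lie_aut br (g *m h).
Proof.
move=> [ug ag] [uh ah]; split; first by rewrite unitmx_mul ug.
by move=> x y; rewrite -mulmxA ah ag !mulmxA.
Qed.

Lemma lie_autV g : lie_aut br g -> lie_aut br (invmx g).
Proof.
move=> [ug ag]; split; first by rewrite unitmx_inv.
by move=> x y; apply: (can_inj (mulKmx ug)); rewrite ag !mulKVmx.
Qed.

Lemma scaled_aut_unit g : scaled_aut br g -> g \in unitmx.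
Proof. by move=> [c [p [c0 [up _] ->]]]; rewrite unitmxZ ?unitfE. Qed.

Lemma scaled_autM g h : scaled_aut br g -> scaled_aut br h -> scaled_aut br (g *m h).
Proof.
move=> [c [p [c0 ap ->]]] [d [q [d0 aq ->]]].
exists (c * d), (p *m q); split; first by rewrite mulf_neq0.
  exact: lie_autM.
by rewrite -scalemxAl -scalemxAr scalerA.
Qed.

Lemma scaled_autV g : scaled_aut br g -> scaled_aut br (invmx g).
Proof.
move=> [c [p [c0 ap ->]]]; exists c^-1, (invmx p); split; first by rewrite invr_eq0.
  exact: lie_autV.
have up : p \in unitmx by case: ap.
by rewrite invmxZ // unitmxZ ?unitfE.
Qed.

Lemma form_actM g h (w : 'M[R]_N.+1) : g \in unitmx -> h \in unitmx ->
  form_act (g *m h) w = form_act g (form_act h w).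
Proof.
move=> ug uh; rewrite /form_act; have -> : invmx (g *m h) = invmx h *m invmx g by exact: invrM.
by rewrite trmx_mul !mulmxA.
Qed.

Lemma form_class_act g w : scaled_aut br g ->
  form_class br (form_act g w) = form_class br w.
Proof.
move=> ag; have ug := scaled_aut_unit ag; apply/seteqP; split=> _ [k ak <-].
  exists (k *m g); first exact: scaled_autM.
  by rewrite form_actM // scaled_aut_unit.
exists (k *m invmx g); first by apply: scaled_autM => //; exact: scaled_autV.
by rewrite -form_actM ?mulmxKV // unitmx_mul unitmx_inv ug (scaled_aut_unit ak).
Qed.

Lemma form_class_congr g w : scaled_aut br g ->
  form_class br (g^T *m w *m g) = form_class br w.
Proof.
move=> ag; have ug := scaled_aut_unit ag.
rewrite -[RHS](form_class_act _ (scaled_autV ag)).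
by rewrite /form_act invmxK.
Qed.

Variable J : 'M[R]_N.
Hypothesis br_lie : lie_algebra br.
Hypothesis br_J : is_semidirect br J.

Lemma e1E : e1 R N = col_mx 1%:M 0 :> 'cV[R]_(1 + N).
Proof.
apply/matrixP => i j; rewrite -(splitK i); case: (split i) => k /=.
  by rewrite col_mxEu !mxE !ord1.
by rewrite col_mxEd !mxE ord1.
Qed.

Lemma cV_recl (x : 'cV[R]_(1 + N)) : x = x 0 0 *: e1 R N + inL (dsubmx x).
Proof.
have : x = x 0 0 *: (col_mx 1%:M 0 : 'cV[R]_(1 + N)) + (col_mx 0 (dsubmx x) : 'cV[R]_(1 + N)).
  rewrite scale_col_mx add_col_mx scaler0 add0r addr0 scalemx1.
  rewrite -{1}[x]vsubmxK; congr col_mx; rewrite [LHS]mx11_scalar mxE; congr (_%:M).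
  by congr (x _ _); apply: val_inj.
by rewrite -e1E.
Qed.

Lemma br_antisym x y : br x y = - br y x.
Proof.
have [alt _] := br_lie; have := alt (x + y).
rewrite linearDl !linearDr !alt add0r addr0 => /eqP.
by rewrite addr_eq0 => /eqP.
Qed.

Lemma inL_lincomb (a c : R) (u v : 'cV[R]_N) :
  inL (a *: u - c *: v) = a *: inL u - c *: inL v.
Proof.
apply/matrixP => i j; rewrite !mxE; case: splitP => k _; rewrite !mxE //.
by rewrite !mulr0 subr0.
Qed.

Lemma br_coord (x y : 'cV[R]_(1 + N)) :
  br x y = inL (x 0 0 *: (J *m dsubmx y) - y 0 0 *: (J *m dsubmx x)).
Proof.
have [bLL bEL] := br_J; have [alt _] := br_lie.
rewrite {1}(cV_recl x) {1}(cV_recl y).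
rewrite linearDl !linearDr !linearZl_LR !linearZr_LR /= alt bLL bEL.
rewrite [br (inL _) _]br_antisym bEL !scaler0 add0r addr0 scalerN.
by rewrite inL_lincomb.
Qed.

(** The components of the bracket along u are x_0 y_0 J u in both terms and
    cancel. *)
Lemma block_lie_aut (u : 'cV[R]_N) (C : 'M[R]_N) : C \in unitmx ->
  C *m J = J *m C -> lie_aut br (block_mx 1%:M 0 u C : 'M_(1 + N)).
Proof.
move=> uC cCJ; split.
  have : (block_mx 1%:M 0 u C : 'M_(1 + N)) \in unitmx.
    by rewrite unitmxE det_lblock det1 mul1r -unitmxE.
  by [].
set p := block_mx _ _ _ _.
have p0 (x : 'cV[R]_(1 + N)) : (p *m x) 0 0 = x 0 0.
  rewrite -[x]vsubmxK mul_block_col mul1mx mul0mx addr0.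
  have -> : (0 : 'I_(1 + N)) = lshift N 0 by apply: val_inj.
  by rewrite !col_mxEu.
have pd (x : 'cV[R]_(1 + N)) : dsubmx (p *m x) = x 0 0 *: u + C *m dsubmx x.
  rewrite -{1}[x]vsubmxK mul_block_col col_mxKd; congr (_ + _).
  rewrite [usubmx x]mx11_scalar mul_mx_scalar mxE; congr (_ *: _).
  by congr (x _ _); apply: val_inj.
have pL v : p *m inL v = inL (C *m v).
  by rewrite /inL mul_block_col !mulmx0 mul0mx !add0r.
move=> x y; rewrite !br_coord pL !p0 !pd; congr inL.
rewrite mulmxBr -!scalemxAr !mulmxDr !scalerDr -!scalemxAr !mulmxA cCJ !scalerA.
by rewrite opprD addrACA [y 0 0 * x 0 0]mulrC subrr add0r.
Qed.

Lemma block_scaled_aut (c : R) (v : 'cV[R]_N) (B : 'M[R]_N) : c != 0 ->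
  B \in unitmx -> B *m J = J *m B ->
  scaled_aut br (block_mx c%:M 0 v B : 'M_(1 + N)).
Proof.
move=> c0 uB cBJ.
exists c, (block_mx 1%:M 0 (c^-1 *: v) (c^-1 *: B) : 'M_(1 + N)); split=> //.
  apply: block_lie_aut; first by rewrite unitmxZ // unitfE invr_eq0.
  by rewrite -scalemxAl -scalemxAr cBJ.
by rewrite (@scale_block_mx R 1 N 1 N) scaler0 !scalerA mulfV // !scale1r scalemx1.
Qed.

Lemma form_val_inL (w : 'M[R]_(1 + N)) (u v : 'cV[R]_N) :
  form_val w (inL u) (inL v) = (u^T *m drsubmx w *m v) 0 0.
Proof.
rewrite /form_val /inL -{1}[w]submxK tr_col_mx trmx0 mul_row_block !mul0mx !add0r.
by rewrite mul_row_col mulmx0 add0r.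
Qed.

Lemma closed_form_dual (w : 'M[R]_(1 + N)) : w^T = - w -> closed_form br w ->
  J^T *m drsubmx w = - (drsubmx w *m J).
Proof.
move=> skw cw; have [bLL bEL] := br_J.
have skd : (drsubmx w)^T = - drsubmx w.
  by rewrite trmx_drsub skw; apply/matrixP => i j; rewrite !mxE.
suff sym : (drsubmx w *m J)^T = drsubmx w *m J.
  by rewrite -[in RHS]sym trmx_mul skd mulmxN opprK.
apply/matrixP => i j.
have := cw (e1 R N) (inL (delta_mx i 0)) (inL (delta_mx j 0)).
rewrite bLL bEL [br (inL _) _]br_antisym bEL.
have -> : form_val w (e1 R N) 0 = 0 by rewrite /form_val mulmx0 mxE.
have -> : form_val w (inL (delta_mx i 0)) (- inL (J *m delta_mx j 0)) =
  - form_val w (inL (delta_mx i 0)) (inL (J *m delta_mx j 0)).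
  by rewrite /form_val mulmxN mxE.
rewrite add0r !form_val_inL !mulmxA !trmx_delta -!(mulmxA (delta_mx _ _)) -!rowE -!colE.
by move=> /eqP; rewrite subr_eq0 => /eqP; rewrite !mxE.
Qed.

End ScaledAutomorphisms.

(** * Reduction of the symplectic form *)

Section NormalForm.
Local Open Scope ring_scope.
Variable R : realType.

Lemma all_flatten_map (T : eqType) (U : Type) (p : pred U) (f : T -> seq U) s :
  (forall x, x \in s -> all p (f x)) -> all p (flatten (map f s)).
Proof.
elim: s => //= x s IH H; rewrite all_cat H ?mem_head // IH // => y ys.
by apply: H; rewrite inE ys orbT.
Qed.

Lemma jordan_ordered_valid (Bs : seq (jblock R)) : jordan_ordered Bs ->
  forall k, jblock_valid (tnth (in_tuple Bs) k).
Proof.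
move=> [zs [rs [ims [cs [vz [_ vr] [_ vi] [_ vc] BsE]]]]].
suff /all_tnthP all_valid : all (fun B => `[< jblock_valid B >]) (in_tuple Bs).
  by move=> k; apply/asboolP; exact: all_valid.
have sizes s n : block_sizes s -> n \in s -> (0 < n)%N.
  by move=> /andP[/allP s0 _] /s0.
rewrite /= BsE !all_cat all_map; apply/and4P; split.
- by apply/allP => n nz; apply/asboolP; exact: (sizes zs).
- apply: all_flatten_map => g /vr [_ s1 s2] /=.
  rewrite /real_group all_cat !all_map; apply/andP.
  by split; apply/allP => n ng; apply/asboolP; [exact: (sizes g.2.1) | exact: (sizes g.2.2)].
- apply: all_flatten_map => g /vi [g0 s1] /=.
  rewrite /imag_group all_map.
  by apply/allP => n ng; apply/asboolP; split=> //; exact: (sizes g.2).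
apply: all_flatten_map => g /vc [_ g0 s1 s2] /=.
rewrite /complex_group all_cat !all_map; apply/andP.
by split; apply/allP => n ng; apply/asboolP; split=> //;
  [exact: (sizes g.2.1) | exact: (sizes g.2.2)].
Qed.

Lemma skew_matrix_blocks N (w : 'M[R]_(1 + N)) : w^T = - w ->
  w = block_mx 0 (ursubmx w) (- (ursubmx w)^T) (drsubmx w) /\
  (drsubmx w)^T = - drsubmx w.
Proof.
move=> skw; have skE i j : w j i = - w i j.
  by have := congr1 (fun M : 'M_(1 + N) => M i j) skw; rewrite !mxE.
split; last by apply/matrixP => i j; rewrite !mxE skE.
rewrite -[LHS]submxK; congr block_mx; apply/matrixP => i j; rewrite !mxE ?ord1.
  by have := skE (lshift N 0) (lshift N 0); lra.
exact: skE.
Qed.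

Lemma rank_drsubmx N (w : 'M[R]_(1 + N)) : w \in unitmx ->
  (N <= (\rank (drsubmx w)).+1)%N.
Proof.
move=> uw; have free : row_free (dsubmx w).
  apply/row_freeP; exists (invmx w *m col_mx 0 1%:M).
  rewrite mulmxA mul_dsub_mx mulmxV // (@scalar_mx_block _ 1 N) /block_mx col_mxKd.
  by rewrite mul_row_col mul0mx add0r mulmx1.
move: free; rewrite /row_free => /eqP {1}<-.
rewrite -[dsubmx w]hsubmxK -mxrank_tr tr_row_mx -addsmxE.
apply: leq_trans (mxrank_adds_leqif _ _) _.
by rewrite !mxrank_tr; exact: leq_add (rank_leq_col _) (leqnn _).
Qed.

Lemma congruence_unit n (g M : 'M[R]_n) : g \in unitmx -> M \in unitmx ->
  g^T *m M *m g \in unitmx.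
Proof. by move=> ug uM; rewrite !unitmx_mul unitmx_tr ug uM. Qed.

Lemma congruence_skew n (g M : 'M[R]_n) : M^T = - M ->
  (g^T *m M *m g)^T = - (g^T *m M *m g).
Proof. by move=> skM; rewrite !trmx_mul trmxK skM mulNmx mulmxN mulmxA. Qed.

(** 1 + b^2 is the projection onto the indices left unmatched by b. *)
Lemma skew_monomial_sqr N (b : 'M[R]_N) : b^T = - b -> monomial_rows b ->
  forall i j, (1%:M + b *m b) i j = ((i == j) && [forall k, b i k == 0])%:R.
Proof.
move=> skb mb i j.
have skE k l : b l k = - b k l.
  by have := congr1 (fun M : 'M_N => M k l) skb; rewrite !mxE.
have [/forallP bi0 | /forallPn [k bik]] := boolP [forall k, b i k == 0].
  rewrite !mxE big1 ?addr0 ?andbT // => k _.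
  by rewrite (eqP (bi0 k)) mul0r.
rewrite andbF !mxE (bigD1 k) //= big1 ?addr0 => [|l lk]; last first.
  have [_ H] := mb i; have -> : b i l = 0; last by rewrite mul0r.
  by apply/eqP; apply: contraNT lk => bil; rewrite (H _ _ bil bik).
have [H1 _] := mb i; have := H1 k; rewrite !inE (negPf bik) /=.
have [<- | ij] := eqVneq i j.
  (* Only the partner k of i contributes, and b i k is a sign. *)
  have sq1 x : (x == 1) || (x == -1) -> x * x = 1 :> R.
    by case/orP => /eqP ->; rewrite ?mulrNN mulr1.
  by move=> /sq1 b2; rewrite (skE i k) mulrN b2 subrr.
rewrite add0r => _; have -> : b k j = 0; last by rewrite mulr0.
have bki : b k i != 0 by rewrite skE oppr_eq0.
have [_ H] := mb k; apply/eqP; apply: contraNT ij => bkj.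
by rewrite (H _ _ bki bkj).
Qed.

(** The shift v adds v^T b to the row a of e_1.  With v proportional to
    (a b)^T, the new row is proportional to q = a (1 + b^2), which is supported
    on the unmatched indices.  Two nonzero entries of q would give two
    proportional rows of an invertible matrix, and q is not zero; so q has
    exactly one nonzero entry, and c scales it to 1. *)
Lemma symplectic_reduction N (w : 'M[R]_(1 + N)) :
  w^T = - w -> w \in unitmx -> monomial_rows (drsubmx w) ->
  exists (c : R) (v : 'cV[R]_N) (m : 'I_N), let h := block_mx c%:M 0 v 1%:M in
  [/\ c != 0, row m (drsubmx w) = 0 & h^T *m w *m h =
    block_mx 0 (delta_mx 0 m) (- delta_mx m 0) (drsubmx w) :> 'M_(1 + N)].
Proof.
move=> skw uw mw; have [wE skb] := skew_matrix_blocks skw.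
move: mw skb wE; set a := ursubmx w; set b := drsubmx w => mb skb wE.
have act (c : R) (v : 'cV[R]_N) : (block_mx c%:M 0 v 1%:M)^T *m w *m block_mx c%:M 0 v 1%:M =
    block_mx 0 (c *: a + v^T *m b) (- (c *: a + v^T *m b)^T) b.
  set X := (_ *m _).
  have skX : X^T = - X by exact: congruence_skew.
  have Xur : ursubmx X = c *: a + v^T *m b.
    rewrite /X wE tr_block_mx !mulmx_block block_mxKur.
    by rewrite !mulmx0 !add0r mulmx1 tr_scalar_mx mul_scalar_mx.
  have Xdr : drsubmx X = b.
    rewrite /X wE tr_block_mx !mulmx_block block_mxKdr.
    by rewrite !mulmx0 trmx0 mul0mx trmx1 !add0r mul1mx mulmx1.
  have [XE _] := skew_matrix_blocks skX.
  by rewrite XE Xur Xdr.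
clearbody a b; clear wE.
pose q := a *m (1%:M + b *m b).
have pE := skew_monomial_sqr skb mb.
have qE c : c *: a + (c *: (a *m b)^T)^T *m b = c *: q.
  by rewrite linearZ /= trmxK -scalemxAl -scalerDr /q mulmxDr mulmx1 mulmxA.
have uq c : c != 0 -> block_mx 0 (c *: q) (- (c *: q)^T) b \in unitmx.
  move=> c0; rewrite -qE -act; apply: (congruence_unit _ uw).
  by rewrite unitmxE det_lblock det1 mulr1 det_scalar1 unitfE.
have [m qm] : exists m, q 0 m != 0.
  have [j] := unitmx_row_neq0 (lshift N 0) (uq 1 (oner_neq0 _)).
  rewrite scale1r -(splitK j); case: (split j) => k /=.
    by rewrite block_mxEul mxE eqxx.
  by rewrite block_mxEur => qk; exists k.
have qZ i : q 0 i != 0 -> row i b = 0.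
  rewrite mxE (bigD1 i) //= big1 ?addr0 => [|k ki]; last by rewrite pE (negPf ki) mulr0.
  rewrite pE eqxx /=; have [/forallP bi0 _ | _] := boolP [forall k, b i k == 0].
    by apply/rowP => k; rewrite !mxE (eqP (bi0 k)).
  by rewrite mulr0 eqxx.
clearbody q.
have qi i : i != m -> q 0 i = 0.
  move=> im; apply/eqP; apply/negPn/negP => qi.
  pose u : 'rV_(1 + N) := row_mx 0 (q 0 i *: delta_mx 0 m - q 0 m *: delta_mx 0 i).
  have u0 : u *m block_mx 0 (1 *: q) (- (1 *: q)^T) b = 0.
    rewrite scale1r mul_row_block !mul0mx !add0r mulmxBl mulmxBl -!scalemxAl -!rowE.
    rewrite (qZ i) // (qZ m) // !scaler0 subr0.
    rewrite (_ : _ - _ = 0) ?row_mx0 //; apply/matrixP => k l.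
    by rewrite !ord1 !mxE mulrN mulrN [q 0 m * _]mulrC subrr.
  have : u = 0 by rewrite -[u](mulmxK (uq 1 (oner_neq0 _))) u0 mul0mx.
  move=> /(congr1 (fun v : 'rV_(1 + N) => v 0 (rshift 1 m))).
  rewrite row_mxEr !mxE !eqxx eq_sym (negPf im) mulr0 subr0 mulr1.
  by move=> qi0; rewrite qi0 eqxx in qi.
have qd : q = q 0 m *: delta_mx 0 m.
  apply/rowP => i; rewrite !mxE eqxx; have [-> | im] := eqVneq i m; first by rewrite mulr1.
  by rewrite mulr0 qi.
(* For every c, the choice v = c (a b)^T gives the new row c q. *)
exists (q 0 m)^-1, ((q 0 m)^-1 *: (a *m b)^T), m => /=.
rewrite invr_eq0 qm act qE.
have -> : (q 0 m)^-1 *: q = delta_mx 0 m by rewrite {2}qd scalerA mulVf // scale1r.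
by split=> //; [exact: qZ | rewrite trmx_delta].
Qed.

Lemma bool_mem (t : bool) : t%:R \in [:: 0; 1; -1 : R] /\ - t%:R \in [:: 0; 1; -1 : R].
Proof. by case: t; rewrite ?mulr1n ?mulr0n ?oppr0 !inE !eqxx ?orbT. Qed.

Lemma matching_form_monomial N (b : 'M[R]_N) (m : 'I_N) : monomial_rows b ->
  row m b = 0 ->
  monomial_rows (block_mx 0 (delta_mx 0 m) (- delta_mx m 0) b : 'M_(1 + N)).
Proof.
move=> mb bm0 i.
rewrite -(splitK i); case: (split i) => k /=.
  split=> [j | j j'].
    rewrite -(splitK j); case: (split j) => l /=; rewrite ?block_mxEul ?block_mxEur.
      by rewrite mxE inE eqxx.
    by rewrite mxE !inE; case: (_ && _); rewrite eqxx ?orbT.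
  rewrite -(splitK j) -(splitK j'); case: (split j) => l; case: (split j') => l' /=;
    rewrite ?block_mxEul ?block_mxEur.
  - by rewrite mxE eqxx.
  - by rewrite mxE eqxx.
  - by move=> _; rewrite mxE eqxx.
  rewrite !mxE ord1 eqxx /=; case: (l =P m) => [-> _|_]; last by rewrite mulr0n eqxx.
  by case: (l' =P m) => [->|_] //; rewrite mulr0n eqxx.
have [H1 H2] := mb k; split=> [j | j j'].
  rewrite -(splitK j); case: (split j) => l /=; rewrite ?block_mxEdl ?block_mxEdr;
    last exact: H1.
  by rewrite !mxE; case: (bool_mem ((k == m) && (l == 0))).
have dm l : (- delta_mx m 0 : 'cV[R]_N) k l != 0 -> k = m.
  by rewrite !mxE; case: (k =P m) => //= _; rewrite oppr0 eqxx.
have bk l : k = m -> b k l = 0.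
  by move=> ->; have /rowP/(_ l) := bm0; rewrite !mxE.
rewrite -(splitK j) -(splitK j'); case: (split j) => l; case: (split j') => l' /=;
  rewrite ?block_mxEdl ?block_mxEdr.
- by rewrite !ord1.
- by move=> /dm /(bk l') ->; rewrite eqxx.
- by move=> bl /dm /(bk l) bl0; rewrite bl0 eqxx in bl.
by move=> nl nl'; rewrite (H2 _ _ nl nl').
Qed.

End NormalForm.

(** * Symplectic normal form *)

Section SymplecticNormalForm.
Local Open Scope ring_scope.
Local Open Scope classical_set_scope.
Variables (R : realType) (N : nat).
Variable br : {bilinear 'cV[R]_N.+1 -> 'cV[R]_N.+1 -> 'cV[R]_N.+1}.

Lemma symplectic_normal_form (J : 'M[R]_N) (w : 'M[R]_N.+1) :
  lie_algebra br -> is_semidirect br J -> real_jordan_normal_form J ->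
  symplectic_forms br w ->
  exists s : 'S_N,
    form_class br w = form_class br (form_act (lift0_mx (perm_mx s)) (omega0 R N)).
Proof.
move=> lie_br HJ [Bs [eN [ordBs JE]]] [skw rkw cw].
have uw : w \in unitmx by rewrite -row_free_unit /row_free rkw.
change 'M[R]_(1 + N) in w.
have skb : (drsubmx w)^T = - drsubmx w by have [] := skew_matrix_blocks skw.
have Jb := closed_form_dual lie_br HJ skw cw.
have [g [ug cg mg]] : exists g : 'M[R]_N, [/\ g \in unitmx, g *m J = J *m g &
    monomial_rows (g^T *m drsubmx w *m g)].
  move: (drsubmx w) skb Jb (rank_drsubmx uw) => b; rewrite {}JE.
  move: b; case: N / eN => b; rewrite castmx_id => skb Jb rb.
  exact: jordan_block_matching (jordan_ordered_valid ordBs) skb Jb rb.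
pose h : 'M_(1 + N) := block_mx 1%:M 0 0 g.
have ah : scaled_aut br h by apply: (block_scaled_aut lie_br HJ) => //; exact: oner_neq0.
have uh := scaled_aut_unit ah.
pose w1 : 'M_(1 + N) := h^T *m w *m h.
have w1d : drsubmx w1 = g^T *m drsubmx w *m g.
  rewrite /w1 -{1}[w]submxK tr_block_mx !mulmx_block block_mxKdr.
  by rewrite !trmx0 !mul0mx !mulmx0 !add0r.
have skw1 : w1^T = - w1 by exact: congruence_skew.
have uw1 : w1 \in unitmx by exact: congruence_unit.
rewrite -w1d in mg.
have [c [v [m /= [c0 bm0 w2E]]]] := symplectic_reduction skw1 uw1 mg.
move: w2E; set h2 := block_mx c%:M 0 v 1%:M => w2E.
have ah2 : scaled_aut br h2.
  by apply: (block_scaled_aut lie_br HJ) => //; rewrite ?unitmx1 // mul1mx mulmx1.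
have uh2 := scaled_aut_unit ah2.
pose K : 'M_(1 + N) := h2^T *m w1 *m h2.
have skK : K^T = - K by exact: congruence_skew.
have uK : K \in unitmx by exact: congruence_unit.
have KE : K = block_mx 0 (delta_mx 0 m) (- delta_mx m 0) (drsubmx w1) := w2E.
have mK : monomial_rows K by rewrite KE; exact: matching_form_monomial.
have K0m : K 0 (rshift 1 m) = 1.
  rewrite KE (_ : 0 = lshift N 0 :> 'I_(1 + N)); last exact: val_inj.
  by rewrite block_mxEur mxE !eqxx.
have [s sE] := skew_monomial_permuted_omega0 skK mK uK K0m.
exists s; rewrite -sE.
by rewrite /K (form_class_congr _ ah2) /w1 (form_class_congr _ ah).
Qed.

End SymplecticNormalForm.

Theorem theorem6p3 (R : realType) (N : nat)
    (br : {bilinear 'cV[R]_N.+1 -> 'cV[R]_N.+1 -> 'cV[R]_N.+1}%R)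
    (J : 'M[R]_N)
    (Hg : almost_abelian br)
    (HJ : is_semidirect br J)
    (Hjordan : real_jordan_normal_form J) :
  finite_set (symplectic_moduli br) /\
  (forall w : 'M[R]_N.+1, symplectic_moduli br (form_class br w) ->
     exists2 P : 'M[R]_N.+1, Per_e1 P &
       form_class br w = form_class br (form_act P (omega0 R N))).
Proof.
have [lie_br _ _] := Hg.
split; last first.
  move=> w [w' sw' <-]; have [s ->] := symplectic_normal_form lie_br HJ Hjordan sw'.
  by exists (lift0_mx (perm_mx s)); first by exists s.
pose cls (s : 'S_N) := form_class br (form_act (lift0_mx (perm_mx s)) (omega0 R N)).
apply: (sub_finite_set (B := (cls @` setT)%classic)) => [_ [w sw <-]|].
  by have [s ->] := symplectic_normal_form lie_br HJ Hjordan sw; exists s.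
by apply: finite_image; exact: finite_finset.
Qed.
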